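(* Let $M=e^H$ be a convex exponential set in $\Sigma$, and suppose there is a closed orthogonal supplement $S$ for $H$, namely a closed subspace $S\subset{\cal A}_h$ with ${\cal A}_h=H\oplus S$ and $\tau(hs)=0$ for all $h\in H$, $s\in S$. Then for any point $r\in\Sigma$ there is a geodesic through $r$ orthogonal to $M$.
   Context: ${\cal A}$ is a von Neumann algebra with a finite, normal, faithful tracial state $\tau$; ${\cal A}_h$ is the real space of selfadjoint elements (closedness of subspaces refers to the operator norm); $\Sigma=e^{{\cal A}_h}$ is the set of positive invertible elements of ${\cal A}$, with tangent space ${\cal A}_h$ at each point. For $a\in\Sigma$, $x,y\in{\cal A}_h$ put $\langle x,y\rangle_a=\tau(xa^{-1}ya^{-1})$. For $p,q\in\Sigma$ the geodesic joining $p$ to $q$ is $\delta_{p,q}(t)=p^{1/2}(p^{-1/2}qp^{-1/2})^tp^{1/2}$, and ${\rm Exp}_p(v)=p^{1/2}e^{p^{-1/2}vp^{-1/2}}p^{1/2}$ for $v\in{\cal A}_h$. A subset $M\subset\Sigma$ is convex if $\delta_{p,q}(t)\in M$ for all $p,q\in M$ and all real $t$. An exponential set is $M=e^H$ with $H$ a norm closed real subspace of ${\cal A}_h$. For a convex exponential set $M=e^H$ and $p\in M$, $T_pM=p^{1/2}Hp^{1/2}$. ''There is a geodesic through $r$ orthogonal to $M$'' means: there are $p\in M$ and $v\in{\cal A}_h$ with $\langle v,w\rangle_p=0$ for all $w\in T_pM$ and ${\rm Exp}_p(v)=r$ ($v=0$ being allowed, when $r=p\in M$). *)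

(* Defs.v *)
From HB Require Import structures.
From mathcomp Require Import all_boot all_order all_algebra.
From mathcomp Require Import complex.
From mathcomp Require Import all_classical all_reals all_analysis.

Set Implicit Arguments.
Unset Strict Implicit.
Unset Printing Implicit Defensive.

Import Order.TTheory GRing.Theory Num.Theory.
Import numFieldNormedType.Exports.

Local Open Scope classical_set_scope.
Local Open Scope ring_scope.
Local Open Scope complex_scope.

Record hilbertSpace (R : realType) := HilbertSpace {
  hilbert_sort :> completeNormedModType R[i];
  hdot : {dot hilbert_sort for (@Num.conj R[i])};
  hdot_norm : forall x, `|x| ^+ 2 = hdot x x }.

(* The commutant of X inside the bounded operators (= continuous linear maps). *)
Definition commutant (R : realType) (K : hilbertSpace R) (X : set (K -> K)) :
    set (K -> K) :=
  [set S : K -> K | [/\ linear S, continuous S &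
                        forall T, X T -> S \o T = T \o S]].

(* A von Neumann algebra is a *-algebra of bounded operators on a Hilbert
   space, containing the identity, that equals its bicommutant.  Here its
   elements form a type, identified with operators by vn_op, so that the norm
   topology and the ring operations are available as library structures.
   The last two axioms say that the norm is the operator norm; in particular
   vn_op is injective, so the algebraic laws (vn_star being an involution, the
   C*-identity, ...) are inherited from operators.  The algebra is nonzero, as
   is any algebra carrying a state. *)
Record vonNeumannAlgebra (R : realType) := VonNeumannAlgebra {
  vn_space : completeNormedModType R[i];
  vn_one : vn_space;
  vn_mul : vn_space -> vn_space -> vn_space;
  vn_star : vn_space -> vn_space;
  vn_hilbert : hilbertSpace R;
  vn_op : vn_space -> vn_hilbert -> vn_hilbert;
  vn_opP : forall (c : R[i]) a b x,
    vn_op (c *: a + b) x = c *: vn_op a x + vn_op b x;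
  vn_op1 : forall x, vn_op vn_one x = x;
  vn_opM : forall a b x, vn_op (vn_mul a b) x = vn_op a (vn_op b x);
  vn_adj : forall a x y,
    hdot vn_hilbert (vn_op a x) y = hdot vn_hilbert x (vn_op (vn_star a) y);
  vn_bicommutant : commutant (commutant (range vn_op)) = range vn_op;
  vn_one_neq0 : vn_one != 0;
  vn_norm_ub : forall a x, `|vn_op a x| <= `|a| * `|x|;
  vn_norm_lub : forall a (c : R[i]), 0 <= c ->
    (forall x, `|vn_op a x| <= c * `|x|) -> `|a| <= c }.

Definition vn_carrier (R : realType) (A : vonNeumannAlgebra R) : Type :=
  vn_space A.
Coercion vn_carrier : vonNeumannAlgebra >-> Sortclass.

HB.instance Definition _ (R : realType) (A : vonNeumannAlgebra R) :=
  CompleteNormedModule.on (vn_carrier A).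

Section VonNeumannRing.
Variables (R : realType) (A : vonNeumannAlgebra R).
Local Notation op := (@vn_op R A).
Local Notation mul := (@vn_mul R A).

Lemma vn_op_inj (a b : A) : (forall x, op a x = op b x) -> a = b.
Proof.
move=> ab; apply/eqP; rewrite -subr_eq0 -normr_eq0 eq_le normr_ge0 andbT.
apply: (@vn_norm_lub R A) => // x.
by rewrite addrC -scaleN1r vn_opP ab scaleN1r addNr normr0 mul0r.
Qed.

Lemma vn_opD (a b : A) x : op (a + b) x = op a x + op b x.
Proof. by rewrite -[a]scale1r vn_opP !scale1r. Qed.

Lemma vn_opZ (c : R[i]) (a : A) x : op (c *: a) x = c *: op a x.
Proof.
have op0 : op 0 x = 0 by apply: (addIr (op 0 x)); rewrite -vn_opD !add0r.
by rewrite -[c *: a]addr0 vn_opP op0 addr0.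
Qed.

Lemma vn_op_linear (a : A) : linear (op a).
Proof.
have : range op (op a) by exists a.
by rewrite -vn_bicommutant => -[].
Qed.

Lemma vn_op_lD (a : A) x y : op a (x + y) = op a x + op a y.
Proof. by have := vn_op_linear a 1 x y; rewrite !scale1r. Qed.

Lemma vn_op_lZ (a : A) (c : R[i]) x : op a (c *: x) = c *: op a x.
Proof.
have op0 : op a 0 = 0 by apply: (addIr (op a 0)); rewrite -vn_op_lD !add0r.
by have := vn_op_linear a c x 0; rewrite op0 !addr0.
Qed.

Lemma vn_mulA : associative (mul : A -> A -> A).
Proof. by move=> a b c; apply: vn_op_inj => x; rewrite !vn_opM. Qed.

Lemma vn_mul1 : left_id (vn_one A : A) mul.
Proof. by move=> a; apply: vn_op_inj => x; rewrite vn_opM vn_op1. Qed.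

Lemma vn_mulr1 : right_id (vn_one A : A) mul.
Proof. by move=> a; apply: vn_op_inj => x; rewrite vn_opM vn_op1. Qed.

Lemma vn_mulDl : left_distributive (mul : A -> A -> A) +%R.
Proof.
by move=> a b c; apply: vn_op_inj => x; rewrite !(vn_opM, vn_opD).
Qed.

Lemma vn_mulDr : right_distributive (mul : A -> A -> A) +%R.
Proof.
by move=> a b c; apply: vn_op_inj => x; rewrite !(vn_opM, vn_opD) vn_op_lD.
Qed.

Lemma vn_scaleAl (c : R[i]) (a b : A) : c *: (mul a b : A) = mul (c *: a) b.
Proof. by apply: vn_op_inj => x; rewrite !(vn_opM, vn_opZ). Qed.

Lemma vn_scaleAr (c : R[i]) (a b : A) : c *: (mul a b : A) = mul a (c *: b).
Proof.
by apply: vn_op_inj => x; rewrite !(vn_opM, vn_opZ) vn_op_lZ.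
Qed.

End VonNeumannRing.

HB.instance Definition _ (R : realType) (A : vonNeumannAlgebra R) :=
  GRing.Zmodule_isNzRing.Build (vn_carrier A) (@vn_mulA R A) (@vn_mul1 R A)
    (@vn_mulr1 R A) (@vn_mulDl R A) (@vn_mulDr R A) (vn_one_neq0 A).

HB.instance Definition _ (R : realType) (A : vonNeumannAlgebra R) :=
  GRing.Lmodule_isLalgebra.Build R[i] (vn_carrier A) (@vn_scaleAl R A).

HB.instance Definition _ (R : realType) (A : vonNeumannAlgebra R) :=
  GRing.Lalgebra_isAlgebra.Build R[i] (vn_carrier A) (@vn_scaleAr R A).

Section VonNeumannInverse.
Variables (R : realType) (A : vonNeumannAlgebra R).

Definition vn_inverses (a : A) : set A := [set b | b * a = 1 /\ a * b = 1].

Definition vn_unit : pred A := fun a => `[< exists b, vn_inverses a b >].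

Definition vn_inv (a : A) : A := xget a (vn_inverses a).

Lemma vn_invP (a : A) : vn_unit a -> vn_inverses a (vn_inv a).
Proof. by move=> /asboolP[b ab]; exact: (xgetPex _ (ex_intro _ b ab)). Qed.

Lemma vn_mulVr : {in vn_unit, left_inverse 1 vn_inv *%R}.
Proof. by move=> a /vn_invP[]. Qed.

Lemma vn_divrr : {in vn_unit, right_inverse 1 vn_inv *%R}.
Proof. by move=> a /vn_invP[]. Qed.

Lemma vn_unitP (a b : A) : b * a = 1 /\ a * b = 1 -> vn_unit a.
Proof. by move=> ab; apply/asboolP; exists b. Qed.

Lemma vn_inv_out : {in [predC vn_unit], vn_inv =1 id}.
Proof.
move=> a /negP na; rewrite /vn_inv; case: xgetP => // b _ ab.
by case: na; apply/asboolP; exists b.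
Qed.

End VonNeumannInverse.

HB.instance Definition _ (R : realType) (A : vonNeumannAlgebra R) :=
  GRing.NzRing_hasMulInverse.Build (vn_carrier A) (@vn_mulVr R A)
    (@vn_divrr R A) (@vn_unitP R A) (@vn_inv_out R A).

Section VonNeumann.
Variables (R : realType) (A : vonNeumannAlgebra R).
Implicit Types (a b p q v w x y z : A) (H S M D : set A).

Definition star a : A := vn_star a.

Definition selfadjoint : set A := [set x | star x = x].

Definition positive : set A := [set x | exists b, x = star b * b].

Definition op_le x y := positive (y - x).

Definition op_lub D s :=
  [/\ selfadjoint s, (forall x, D x -> op_le x s) &
      forall y, selfadjoint y -> (forall x, D x -> op_le x y) -> op_le s y].

Definition op_directed D :=
  D !=set0 /\
  forall x y, D x -> D y -> exists z, [/\ D z, op_le x z & op_le y z].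

(* tau preserves suprema of bounded upward directed sets of selfadjoint
   elements; tau d <= tau s for d in D already follows from positivity. *)
Definition normal_functional (tau : A -> R[i]) :=
  forall D s, D `<=` selfadjoint -> op_directed D -> op_lub D s ->
    forall m : R[i], (forall d, D d -> tau d <= m) -> tau s <= m.

Record normal_faithful_tracial_state (tau : {scalar A}) : Prop := {
  tau_pos : forall a, 0 <= tau (star a * a);
  tau_unit : tau 1 = 1;
  tau_tracial : forall a b, tau (a * b) = tau (b * a);
  tau_faithful : forall a, tau (star a * a) = 0 -> a = 0;
  tau_normal : normal_functional tau }.

Definition op_exp x : A :=
  lim (series (fun n => n`!%:R^-1 *: x ^+ n : A) @ \oo).

Definition Sigma : set A := op_exp @` selfadjoint.

(* The exponential is injective on selfadjoint elements, so for p in Sigma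
   this is the logarithm of p; it is 0 outside Sigma. *)
Definition op_ln p : A := xget 0 [set x | selfadjoint x /\ op_exp x = p].

Definition op_pow p (t : R) : A := op_exp (t%:C *: op_ln p).

Definition metric (tau : A -> R[i]) a x y : R[i] := tau (x * a^-1 * y * a^-1).

Definition geodesic p q (t : R) : A :=
  op_pow p 2^-1 * op_pow (op_pow p (- 2^-1) * q * op_pow p (- 2^-1)) t
    * op_pow p 2^-1.

Definition Exp p v : A :=
  op_pow p 2^-1 * op_exp (op_pow p (- 2^-1) * v * op_pow p (- 2^-1))
    * op_pow p 2^-1.

Definition geodesically_convex M :=
  M `<=` Sigma /\ forall p q (t : R), M p -> M q -> M (geodesic p q t).

Definition closed_real_subspace H :=
  [/\ H `<=` selfadjoint, H 0,
      forall (t : R) x y, H x -> H y -> H (t%:C *: x + y) & closed H].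

Definition exp_set H : set A := op_exp @` H.

Definition tangent_space H p : set A :=
  [set op_pow p 2^-1 * h * op_pow p 2^-1 | h in H].

Definition direct_sum H S :=
  H `&` S = [set 0] /\ selfadjoint = [set h + s | h in H & s in S].

Definition closed_orthogonal_supplement (tau : A -> R[i]) H S :=
  [/\ closed_real_subspace S, direct_sum H S &
      forall h s, H h -> S s -> tau (h * s) = 0].

Definition orthogonal_geodesic_through (tau : A -> R[i]) H (r : A) :=
  exists p v, [/\ exp_set H p, selfadjoint v,
    (forall w, tangent_space H p w -> metric tau p v w = 0) & Exp p v = r].

End VonNeumann.

(* Main.v *)
Require Import Defs.
From HB Require Import structures.
From mathcomp Require Import all_boot all_order all_algebra.
From mathcomp Require Import complex.
From mathcomp Require Import all_classical all_reals all_analysis.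
From mathcomp Require Import ring lra.

Set Implicit Arguments.
Unset Strict Implicit.
Unset Printing Implicit Defensive.

Import Order.TTheory GRing.Theory Num.Theory.
Import numFieldNormedType.Exports.

Local Open Scope classical_set_scope.
Local Open Scope ring_scope.

(** Write the point as the exponential of a selfadjoint rho.  An orthogonal
    geodesic from e^h reaches it exactly when

      e^rho = e^(h/2) e^s e^(h/2)   with h in H and tau (s k) = 0 for k in H,

    the initial vector then being e^(h/2) s e^(h/2).  So e^h has to be a point
    of M nearest to e^rho for the distance

      dist (e^x, e^y) = || log (e^(-x/2) e^y e^(-x/2)) ||_2,

    and the proof finds such a point and differentiates there.  Here
    ||x||_2 = sqrt (tau (x x)), a norm for which Sigma need not be complete;
    this is why the minimisation takes place on balls of the operator norm,
    where compatibility of the two norms is the main concern.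

    Existence.  The distance satisfies the triangle inequality
    ([dst_triangle]), is at least the L2 distance of the logarithms
    ([dst_ge_n2]), and therefore satisfies the semiparallelogram law of
    nonpositive curvature ([semiparallelogram]).  Convexity makes the ball
    of radius K of H, hence the set of its exponentials, stable under geodesic
    midpoints ([exp_H_midpoint]), and this ball is complete for the L2 norm:
    norm balls of a von Neumann algebra with a normal trace are
    ([l2_complete]), and H is the L2-orthogonal of S.  A minimising sequence
    in the ball is thus L2-Cauchy and its limit is a nearest point
    ([nearest_point]).

    Why a ball is enough.  If e^s = e^(-h/2) e^rho e^(-h/2), monotonicity of
    the logarithm gives ||s + h|| <= ||rho||, however large h is
    ([ln_conj_bound]).  The orthogonal projection P onto H along S is bounded
    for the operator norm, by a category argument ([proj_bounded]); so
    K = ||P|| ||rho|| bounds P (s + h) = P s + h.  Starting at the minimiser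
    e^h, the points e^((1-e)h/2) e^(e P(s+h)) e^((1-e)h/2) of M have logarithms
    in the same ball ([competitor_point]) and leave e^h in the direction P s.
    The first variation of the squared distance along them is
    -2 e tau (s P s) = -2 e ||P s||_2^2, and minimality forces P s = 0
    ([critical_point]).

    The inequalities satisfied by the distance come from one first order
    estimate ([first_variation]): moving e^u to e^(u/2) k e^(u/2) changes
    ||u||_2^2 by at most 2 tau (u (k - 1)) up to a quadratic error.  Integrated
    along a discretised path it gives subadditivity of
    g |-> || log (g^adj g) ||_2 on the invertible elements ([loglenM]), from
    which the triangle inequality is immediate.  Applied to powers of
    Z = e^y e^-x, which is similar to a positive element, subadditivity gives
    2 dist (e^x, e^y) <= dist (e^2x, e^2y) ([dst_double]); comparing with the
    infinitesimal distance at 1 yields [dst_ge_n2].  There is no functional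
    calculus behind these arguments: square roots and logarithms of positive
    elements are built from explicit iterations, and the order between
    selfadjoint elements is used through quadratic forms. *)

(** * Real-valued norms and convergence *)

Section RealNorm.
Variables (R : realType) (V : normedModType R[i]).
Local Open Scope complex_scope.
Implicit Types (x y z : V) (t : R).

(** The norm of a module over the complex numbers is itself a complex number;
    this real version, whose image it is ([nrmE]), can be used in real
    inequalities. *)
Definition nrm x : R := complex.Re `|x|.

Lemma nrmE x : (nrm x : R)%:C = `|x|.
Proof. by rewrite /nrm RRe_real // ger0_real. Qed.

Lemma nrm_ge0 x : 0 <= nrm x.
Proof. by rewrite -ler0c nrmE. Qed.

Lemma nrm0 : nrm 0 = 0.
Proof. by rewrite /nrm normr0. Qed.

Lemma nrm_eq0 x : nrm x = 0 -> x = 0.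
Proof. by move=> x0; apply/normr0_eq0; rewrite -nrmE x0. Qed.

Lemma nrmN x : nrm (- x) = nrm x.
Proof. by rewrite /nrm normrN. Qed.

Lemma nrmD x y : nrm (x + y) <= nrm x + nrm y.
Proof. by rewrite -lecR rmorphD /= !nrmE ler_normD. Qed.

Lemma nrmB x y : nrm (x - y) <= nrm x + nrm y.
Proof. by rewrite -(nrmN y) nrmD. Qed.

Lemma nrm_distC x y : nrm (x - y) = nrm (y - x).
Proof. by rewrite -nrmN opprB. Qed.

Lemma nrm_dist x y z : nrm (x - z) <= nrm (x - y) + nrm (y - z).
Proof. by rewrite (le_trans _ (nrmD _ _))// addrA subrK. Qed.

Lemma nrmZ t x : nrm (t%:C *: x) = `|t| * nrm x.
Proof.
apply: (@complexI R); rewrite nrmE normrZ rmorphM /= nrmE; congr (_ * _).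
by rewrite normc_def /= expr0n addr0 sqrtr_sqr.
Qed.

Lemma nrm_sum (I : Type) (s : seq I) (P : pred I) (F : I -> V) :
  nrm (\sum_(i <- s | P i) F i) <= \sum_(i <- s | P i) nrm (F i).
Proof.
elim/big_rec2: _ => [|i u v _ h]; first by rewrite nrm0.
by rewrite (le_trans (nrmD _ _)) // lerD2l.
Qed.

End RealNorm.

Section RealSequences.
Variable R : realType.
Implicit Types (r s : nat -> R) (c e q : R).

(** One-sided, so that domination by a null sequence is enough whatever the
    sign; the sequences of interest are norms. *)
Definition null_seq r := forall e, 0 < e -> exists N, forall n, (N <= n)%N -> r n <= e.

Lemma null_seq_le r s : (forall n, r n <= s n) -> null_seq s -> null_seq r.
Proof.
by move=> rs s0 e /s0[N h]; exists N => n /h; exact: le_trans (rs n).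
Qed.

Lemma null_seqD r s : null_seq r -> null_seq s -> null_seq (fun n => r n + s n).
Proof.
move=> hr hs e e0; have e20 : 0 < e / 2 by rewrite divr_gt0.
have [N h] := hr _ e20; have [M k] := hs _ e20; exists (maxn N M) => n.
by rewrite geq_max => /andP[/h a /k b]; rewrite (splitr e) lerD.
Qed.

Lemma null_seqZ c r : 0 <= c -> null_seq r -> null_seq (fun n => c * r n).
Proof.
rewrite le_eqVlt => /predU1P[<-|c0] hr e e0.
  by exists 0 => n _; rewrite mul0r ltW.
have [N h] := hr (e / c) (divr_gt0 e0 c0); exists N => n /h.
by rewrite ler_pdivlMr // mulrC.
Qed.

Lemma null_seq_comp r (f : nat -> nat) :
  (forall n, (n <= f n)%N) -> null_seq r -> null_seq (fun n => r (f n)).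
Proof.
move=> hf h e /h[N k]; exists N => n Nn; apply: k; exact: leq_trans Nn (hf n).
Qed.

Lemma null_seq_bound r c : null_seq r -> (forall n, c <= r n) -> c <= 0.
Proof.
move=> hr h; apply/ler_addgt0Pr => e /hr[N k]; rewrite add0r.
exact: le_trans (h N) (k N (leqnn _)).
Qed.

Lemma null_seq_cvg r : r @ \oo --> 0 -> null_seq r.
Proof.
move=> r0 e e0; move/cvgrPdist_le : r0 => /(_ _ e0)[N _ h]; exists N => n Nn.
by have := h n Nn; rewrite sub0r normrN; apply: le_trans; exact: ler_norm.
Qed.

Lemma null_seq_geo c q : 0 <= q < 1 -> 0 <= c -> null_seq (fun n => c * q ^+ n).
Proof.
move=> /andP[q0 q1] c0; apply: null_seqZ => //; apply: null_seq_cvg.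
by apply: cvg_expr; rewrite ger0_norm.
Qed.

Lemma null_seq_inv c : 0 <= c -> null_seq (fun n => c / n.+1%:R).
Proof.
move=> c0; apply: null_seqZ => //; apply: null_seq_cvg; exact: cvg_harmonic.
Qed.

End RealSequences.

Section Convergence.
Variables (R : realType) (V : normedModType R[i]).
Local Open Scope complex_scope.
Implicit Types (u v : nat -> V) (l m : V) (t c e : R).

Definition tends u l := null_seq (fun n => nrm (u n - l)).

Lemma tends_cvg u l : tends u l -> u @ \oo --> l.
Proof.
move=> h; apply/cvgrPdist_le => e; rewrite ltcE /= => /andP[/eqP i0 e0].
have [N k] := h _ e0; exists N => // n /= Nn.
by rewrite distrC -nrmE lecE /= i0 eqxx k.
Qed.

Lemma cvg_tends u l : u @ \oo --> l -> tends u l.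
Proof.
move=> /cvgrPdist_le h e e0; have e0C : 0 < e%:C :> R[i] by rewrite ltcR.
have [N _ k] := h _ e0C; exists N => n Nn.
by have := k n Nn; rewrite distrC -nrmE lecR.
Qed.

Lemma tends_le_nrm u l (r : nat -> R) :
  (forall n, nrm (u n - l) <= r n) -> null_seq r -> tends u l.
Proof. exact: null_seq_le. Qed.

Lemma tends_cst l : tends (fun=> l) l.
Proof. by move=> e e0; exists 0 => n _; rewrite subrr nrm0 ltW. Qed.

Lemma tendsD u v l m : tends u l -> tends v m -> tends (fun n => u n + v n) (l + m).
Proof.
move=> h k; apply: tends_le_nrm (null_seqD h k) => n.
by rewrite opprD addrACA nrmD.
Qed.

Lemma tendsZ t u l : tends u l -> tends (fun n => t%:C *: u n) (t%:C *: l).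
Proof.
move=> h; apply: tends_le_nrm (null_seqZ (normr_ge0 t) h) => n.
by rewrite -scalerBr nrmZ.
Qed.

Lemma tendsN u l : tends u l -> tends (fun n => - u n) (- l).
Proof.
by move=> h; apply: tends_le_nrm h => n; rewrite -opprD nrmN.
Qed.

Lemma tendsB u v l m : tends u l -> tends v m -> tends (fun n => u n - v n) (l - m).
Proof. by move=> h k; apply: tendsD h (tendsN k). Qed.

Lemma tends_bounded u l : tends u l -> exists c, forall n, nrm (u n) <= c.
Proof.
move=> h; have [N k] := h 1 ltr01.
exists (\sum_(i < N) nrm (u i) + (nrm l + 1)) => n.
have l1 : 0 <= nrm l + 1 by rewrite addr_ge0 ?nrm_ge0.
have s0 : 0 <= \sum_(i < N) nrm (u i) by apply: sumr_ge0 => i _; exact: nrm_ge0.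
have [nN|Nn] := ltnP n N.
  rewrite (bigD1 (Ordinal nN)) //= -addrA lerDl addr_ge0 //.
  by apply: sumr_ge0 => i _; exact: nrm_ge0.
rewrite -[u n](subrK l) (le_trans (nrmD _ _)) // addrC.
by apply: ler_wpDl => //; rewrite lerD2l k.
Qed.

Lemma tends_sub u l (f : nat -> nat) :
  (forall n, (n <= f n)%N) -> tends u l -> tends (fun n => u (f n)) l.
Proof. by move=> hf h; exact: null_seq_comp hf h. Qed.

Lemma tends_nrm_le u l c : tends u l -> (forall n, nrm (u n) <= c) -> nrm l <= c.
Proof.
move=> h k; rewrite -subr_le0; apply: (null_seq_bound h) => n.
rewrite lerBlDr; apply: le_trans (_ : _ <= nrm (l - u n) + nrm (u n)) _.
  by rewrite -{1}(subrK (u n) l) nrmD.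
by rewrite nrm_distC lerD2l k.
Qed.

Lemma tends_uniq u l m : tends u l -> tends u m -> l = m.
Proof.
move=> h k; apply/eqP; rewrite -subr_eq0; apply/eqP/nrm_eq0.
apply/le_anti; rewrite nrm_ge0 andbT.
apply: (null_seq_bound (null_seqD h k)) => n.
by rewrite (le_trans (nrm_dist _ (u n) _)) // nrm_distC.
Qed.

Lemma tends_ext u v l : (forall n, u n = v n) -> tends u l -> tends v l.
Proof. by move=> uv; rewrite (_ : u = v) //; exact/funext. Qed.

End Convergence.

Section CauchySequences.
Variables (R : realType) (V : completeNormedModType R[i]).
Implicit Types (u : nat -> V) (e : R).

Definition cauchy_seq u := forall e, 0 < e ->
  exists N, forall m n : nat, (N <= m)%N -> (N <= n)%N -> nrm (u m - u n) <= e.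

Lemma complete_seq u : cauchy_seq u -> exists l, tends u l.
Proof.
move=> h; suff /cvg_ex[l ul] : cvgn u by exists l; exact: cvg_tends.
apply: cauchy_cvg; apply/cauchy_ballP => e.
rewrite ltcE /= => /andP[/eqP i0 e0].
have [N k] := h (complex.Re e / 2) (divr_gt0 e0 (ltr0n _ 2)).
exists (u @` [set n | (N <= n)%N], u @` [set n | (N <= n)%N]) => /=.
  by split; exists N => // n /= Nn; exists n.
move=> [_ _] [[m /= Nm <-] [n /= Nn <-]].
rewrite -ball_normE /= -nrmE ltcE /= i0 eqxx /=.
by rewrite (le_lt_trans (k _ _ Nm Nn)) // ltr_pdivrMr // mulr_natr mulr2n ltrDl.
Qed.

Lemma complete_rate u (r : nat -> R) : null_seq r ->
  (forall n m : nat, (n <= m)%N -> nrm (u m - u n) <= r n) -> exists l, tends u l.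
Proof.
move=> hr h; apply: complete_seq => e e0.
have e20 : 0 < e / 2 by rewrite divr_gt0.
have [N k] := hr _ e20; exists N => m n Nm Nn.
rewrite (le_trans (nrm_dist _ (u N) _)) // (splitr e) lerD //.
  by rewrite (le_trans (h _ _ Nm)) // k.
by rewrite nrm_distC (le_trans (h _ _ Nn)) // k.
Qed.

(** The increments of u are dominated by those of a null sequence r, so the
    distance from u n to the limit is at most r n: the sum telescopes. *)
Lemma telescoping_tends u (r : nat -> R) : (forall n, 0 <= r n) -> null_seq r ->
  (forall n, nrm (u n.+1 - u n) <= r n - r n.+1) ->
  exists l, tends u l /\ forall n, nrm (l - u n) <= r n.
Proof.
move=> r0 hr h.
have k n j : nrm (u (n + j)%N - u n) <= r n - r (n + j)%N.
  elim: j => [|j ih]; first by rewrite addn0 !subrr nrm0.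
  rewrite (le_trans (nrm_dist _ (u (n + j)%N) _)) // addnS.
  by have := h (n + j)%N; lra.
have k' n j : nrm (u (n + j)%N - u n) <= r n.
  by rewrite (le_trans (k n j)) // lerBlDr lerDl.
have [l ul] : exists l, tends u l.
  by apply: complete_rate hr _ => n m nm; rewrite -(subnKC nm).
exists l; split=> // n.
have um : tends (fun j => u (n + j)%N) l.
  by apply: (tends_sub (f := addn n) _ ul) => j; exact: leq_addl.
by apply: (tends_nrm_le (tendsB um (tends_cst (u n)))) => j.
Qed.

End CauchySequences.

(** * The involution and the real inner product *)

(** The action, with its argument typed in the algebra and not in the
    underlying normed space, so that ring operations under it are found. *)
Definition vop (R : realType) (A : vonNeumannAlgebra R) (a : A) :
  vn_hilbert A -> vn_hilbert A := vn_op a.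

Section Norms.
Variables (R : realType) (A : vonNeumannAlgebra R).
Local Open Scope complex_scope.
Local Notation K := (vn_hilbert A).
Local Notation op := (@vop R A).
Implicit Types (a b x y z : A) (xi eta : K) (s t c : R).

(** The real part determines a Hermitian form and keeps every estimate in R. *)
Definition rdot xi eta : R := complex.Re (hdot K xi eta).
Definition qf x xi : R := rdot (op x xi) xi.
Definition sa x : Prop := star x = x.

(** On selfadjoint elements this is the order given by positivity ([op_leP] below);
    in this form it is verified vector by vector, without exhibiting a square
    root of the difference. *)
Definition ople x y : Prop := forall xi, qf x xi <= qf y xi.

Lemma rdotE xi : hdot K xi xi = (rdot xi xi : R)%:C.
Proof. by rewrite /rdot RRe_real // -hdot_norm ger0_real // exprn_ge0. Qed.

Lemma hdotC xi eta : hdot K xi eta = Num.conj (hdot K eta xi).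
Proof. by rewrite (hermitian_subproof xi) expr0 mul1r. Qed.

Lemma rdotC xi eta : rdot xi eta = rdot eta xi.
Proof.
by rewrite /rdot hdotC; case: (hdot K eta xi).
Qed.

Lemma rdotDl xi eta ze : rdot (xi + eta) ze = rdot xi ze + rdot eta ze.
Proof. by rewrite /rdot linearDl /= raddfD. Qed.

Lemma rdotDr xi eta ze : rdot ze (xi + eta) = rdot ze xi + rdot ze eta.
Proof. by rewrite !(rdotC ze) rdotDl. Qed.

Lemma Re_realM t (z : R[i]) : complex.Re (t%:C * z) = t * complex.Re z.
Proof. by case: z => z1 z2 /=; rewrite mul0r subr0. Qed.

Lemma rdotZl t xi eta : rdot (t%:C *: xi) eta = t * rdot xi eta.
Proof. by rewrite /rdot linearZl_LR /= Re_realM. Qed.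

Lemma rdotZr t xi eta : rdot xi (t%:C *: eta) = t * rdot xi eta.
Proof. by rewrite !(rdotC xi) rdotZl. Qed.

Lemma rdotNl xi eta : rdot (- xi) eta = - rdot xi eta.
Proof. by rewrite /rdot linearNl /= raddfN. Qed.

Lemma rdotNr xi eta : rdot xi (- eta) = - rdot xi eta.
Proof. by rewrite !(rdotC xi) rdotNl. Qed.

Lemma rdot_ge0 xi : 0 <= rdot xi xi.
Proof. by rewrite -ler0c -rdotE -hdot_norm exprn_ge0. Qed.

Lemma rdot_eq0 xi : rdot xi xi = 0 -> xi = 0.
Proof.
move=> x0; have := hdot_norm xi; rewrite rdotE x0 => /eqP.
by rewrite expf_eq0 /= normr_eq0 => /eqP.
Qed.

Lemma rdot0r xi : rdot xi 0 = 0.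
Proof. by rewrite -(scale0r (0 : K)) -(rmorph0 (real_complex R)) rdotZr mul0r. Qed.

Lemma rdot_CS xi eta : (rdot xi eta) ^+ 2 <= rdot xi xi * rdot eta eta.
Proof.
have [/rdot_eq0 ->|e0] := eqVneq (rdot eta eta) 0.
  by rewrite !rdot0r expr0n mulr0.
have {}e0 : 0 < rdot eta eta by rewrite lt_neqAle eq_sym e0 rdot_ge0.
have := rdot_ge0 ((rdot eta eta : R)%:C *: xi - (rdot xi eta : R)%:C *: eta).
rewrite !(rdotDl, rdotDr, rdotNl, rdotNr, rdotZl, rdotZr) (rdotC eta xi).
set p := rdot xi xi; set q := rdot eta eta in e0 *; set r := rdot xi eta.
move=> h; have {h} : 0 <= q * (p * q - r ^+ 2) by lra.
by rewrite pmulr_rge0 // subr_ge0.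
Qed.

Lemma opD x y xi : op (x + y) xi = op x xi + op y xi.
Proof. exact: vn_opD. Qed.
Lemma opZ (c : R[i]) x xi : op (c *: x) xi = c *: op x xi.
Proof. exact: vn_opZ. Qed.
Lemma opN x xi : op (- x) xi = - op x xi.
Proof. by rewrite -scaleN1r opZ scaleN1r. Qed.
Lemma opB x y xi : op (x - y) xi = op x xi - op y xi.
Proof. by rewrite opD opN. Qed.
Lemma opM x y xi : op (x * y) xi = op x (op y xi).
Proof. exact: vn_opM. Qed.
Lemma op1 xi : op 1 xi = xi.
Proof. exact: vn_op1. Qed.
Lemma op0 xi : op 0 xi = 0.
Proof. by rewrite -(scale0r (0 : A)) opZ scale0r. Qed.
Lemma op_vD x xi eta : op x (xi + eta) = op x xi + op x eta.
Proof. exact: vn_op_lD. Qed.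
Lemma op_vZ x (c : R[i]) xi : op x (c *: xi) = c *: op x xi.
Proof. exact: vn_op_lZ. Qed.
Lemma op_vN x xi : op x (- xi) = - op x xi.
Proof. by rewrite -scaleN1r op_vZ scaleN1r. Qed.

Lemma hdot_adj x xi eta : hdot K (op x xi) eta = hdot K xi (op (star x) eta).
Proof. exact: vn_adj. Qed.

Lemma rdot_adj x xi eta : rdot (op x xi) eta = rdot xi (op (star x) eta).
Proof. by rewrite /rdot hdot_adj. Qed.

Lemma hdot_inj xi eta : (forall ze, hdot K ze xi = hdot K ze eta) -> xi = eta.
Proof.
move=> h; apply/eqP; rewrite -subr_eq0; apply/eqP/rdot_eq0.
by rewrite {1}/rdot linearBr /= h subrr.
Qed.

Lemma star_inj x y : (forall xi eta, hdot K (op x xi) eta = hdot K (op y xi) eta)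
  -> x = y.
Proof.
move=> h; apply: vn_op_inj => xi; apply: hdot_inj => ze.
by rewrite hdotC -[vn_op x xi]/(op x xi) h -hdotC.
Qed.

Lemma vn_adjr x xi eta : hdot K (op (star x) xi) eta = hdot K xi (op x eta).
Proof. by rewrite hdotC -hdot_adj -hdotC. Qed.

Lemma starK : involutive (@star R A).
Proof. by move=> x; apply: star_inj => xi eta; rewrite vn_adjr -hdot_adj. Qed.

Lemma starD x y : star (x + y) = star x + star y.
Proof.
by apply: star_inj => xi eta; rewrite vn_adjr !opD linearDl linearDr /= !vn_adjr.
Qed.

Lemma starZ t x : star (t%:C *: x) = t%:C *: star x.
Proof.
apply: star_inj => xi eta; rewrite vn_adjr !opZ linearZl_LR linearZr_LR /=.
by rewrite vn_adjr; congr (_ * _); apply/CrealP/complex_realP; exists t.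
Qed.

Lemma starN x : star (- x) = - star x.
Proof.
have N1 (u : A) : - u = (-1 : R)%:C *: u.
  by rewrite (_ : (-1 : R)%:C = -1) ?scaleN1r // rmorphN1.
by rewrite N1 starZ -N1.
Qed.

Lemma starB x y : star (x - y) = star x - star y.
Proof. by rewrite starD starN. Qed.

Lemma star0 : star (0 : A) = 0.
Proof. by rewrite -{1}(subrr (0 : A)) starB subrr. Qed.

Lemma starM x y : star (x * y) = star y * star x.
Proof.
by apply: star_inj => xi eta; rewrite vn_adjr !opM !vn_adjr.
Qed.

Lemma star1 : star (1 : A) = 1.
Proof. by apply: star_inj => xi eta; rewrite vn_adjr !op1. Qed.

Lemma starX x n : star (x ^+ n) = star x ^+ n.
Proof.
elim: n => [|n ih]; first by rewrite !expr0 star1.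
by rewrite exprS starM ih -exprSr.
Qed.
End Norms.

(** * Operator norm and order *)

Section Order.
Variables (R : realType) (A : vonNeumannAlgebra R).
Local Open Scope complex_scope.
Local Notation K := (vn_hilbert A).
Local Notation op := (@vop R A).
Implicit Types (a b g x y z : A) (xi eta : K) (s t c : R).

Lemma nrm_sqr_rdot xi : nrm xi ^+ 2 = rdot xi xi.
Proof. by apply: (@complexI R); rewrite rmorphXn /= nrmE hdot_norm rdotE. Qed.

Lemma nrm_op x xi : nrm (op x xi) <= nrm x * nrm xi.
Proof. by rewrite -lecR rmorphM /= !nrmE; exact: vn_norm_ub. Qed.

Lemma rdot_op_le x xi :
  rdot (op x xi) (op x xi) <= nrm x ^+ 2 * rdot xi xi.
Proof.
rewrite -!nrm_sqr_rdot -exprMn ler_pXn2r ?nnegrE ?nrm_ge0 ?nrm_op //.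
by rewrite mulr_ge0 ?nrm_ge0.
Qed.

Lemma nrm_lub x c : 0 <= c ->
  (forall xi, rdot (op x xi) (op x xi) <= c ^+ 2 * rdot xi xi) -> nrm x <= c.
Proof.
move=> c0 h; rewrite -lecR nrmE; apply: (@vn_norm_lub R A) => [|xi].
  by rewrite ler0c.
rewrite -[vn_op x xi]/(op x xi) -!nrmE -rmorphM /= lecR.
rewrite -(@ler_pXn2r _ 2) ?nnegrE ?nrm_ge0 ?mulr_ge0 ?nrm_ge0 //.
by rewrite exprMn !nrm_sqr_rdot.
Qed.

Lemma nrmM x y : nrm (x * y) <= nrm x * nrm y.
Proof.
apply: nrm_lub => [|xi]; first by rewrite mulr_ge0 ?nrm_ge0.
rewrite opM (le_trans (rdot_op_le _ _)) // exprMn -[leRHS]mulrA.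
by rewrite ler_wpM2l ?rdot_op_le // sqr_ge0.
Qed.

Lemma nrm1_le : nrm (1 : A) <= 1.
Proof. by apply: nrm_lub => // xi; rewrite op1 expr1n mul1r. Qed.

Lemma nrm1 : nrm (1 : A) = 1.
Proof.
have n0 : 0 < nrm (1 : A).
  rewrite lt_neqAle nrm_ge0 andbT eq_sym; apply/eqP => /nrm_eq0/eqP.
  by rewrite oner_eq0.
apply/eqP; rewrite eq_le nrm1_le /= -(ler_pM2l n0) mulr1.
by rewrite -{1}(mulr1 (1 : A)) nrmM.
Qed.

Lemma nrmM_le x y c d : nrm x <= c -> nrm y <= d -> nrm (x * y) <= c * d.
Proof. by move=> xc yd; rewrite (le_trans (nrmM _ _)) // ler_pM ?nrm_ge0. Qed.

Lemma nrmX x n : nrm (x ^+ n) <= nrm x ^+ n.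
Proof.
elim: n => [|n ih]; first by rewrite !expr0 nrm1.
by rewrite !exprS nrmM_le.
Qed.

Lemma sqr_le_le (u c : R) : 0 <= c -> u ^+ 2 <= c ^+ 2 -> u <= c.
Proof.
move=> c0 h; rewrite (le_trans (ler_norm u)) //.
by rewrite -(@ler_pXn2r _ 2) ?nnegrE // real_normK ?num_real.
Qed.

Lemma nrm_starM_ge x : nrm x ^+ 2 <= nrm (star x * x).
Proof.
have h : nrm x <= Num.sqrt (nrm (star x * x)).
  apply: nrm_lub => [|xi]; first exact: sqrtr_ge0.
  rewrite sqr_sqrtr ?nrm_ge0 // rdot_adj -opM.
  apply: sqr_le_le; first by rewrite mulr_ge0 ?nrm_ge0 ?rdot_ge0.
  rewrite (le_trans (rdot_CS _ _)) // exprMn (expr2 (rdot xi xi)).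
  by rewrite mulrA [leRHS]mulrC ler_wpM2l ?rdot_ge0 // rdot_op_le.
rewrite -[leRHS]sqr_sqrtr ?nrm_ge0 //.
by rewrite ler_pXn2r ?nnegrE ?nrm_ge0 ?sqrtr_ge0.
Qed.

Lemma nrm_star x : nrm (star x) = nrm x.
Proof.
have h (y : A) : nrm y <= nrm (star y).
  have [->|y0] := eqVneq (nrm y) 0; first exact: nrm_ge0.
  have {}y0 : 0 < nrm y by rewrite lt_neqAle eq_sym y0 nrm_ge0.
  by rewrite -(ler_pM2r y0) -expr2 (le_trans (nrm_starM_ge _)) // nrmM.
by apply/eqP; rewrite eq_le h andbT; have := h (star x); rewrite starK.
Qed.

Lemma nrm_starM x : nrm (star x * x) = nrm x ^+ 2.
Proof.
apply/eqP; rewrite eq_le nrm_starM_ge andbT.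
by rewrite (le_trans (nrmM _ _)) // nrm_star expr2.
Qed.

Lemma saD x y : sa x -> sa y -> sa (x + y).
Proof. by rewrite /sa starD => -> ->. Qed.
Lemma saN x : sa x -> sa (- x).
Proof. by rewrite /sa starN => ->. Qed.
Lemma saB x y : sa x -> sa y -> sa (x - y).
Proof. by move=> hx hy; apply: saD => //; apply: saN. Qed.
Lemma saZ t x : sa x -> sa (t%:C *: x).
Proof. by rewrite /sa starZ => ->. Qed.
Lemma sa0 : sa (0 : A). Proof. exact: star0. Qed.
Lemma sa1 : sa (1 : A). Proof. exact: star1. Qed.
Lemma saX x n : sa x -> sa (x ^+ n).
Proof. by rewrite /sa starX => ->. Qed.
Lemma sa_sq x : sa x -> sa (x * x).
Proof. by rewrite /sa starM => ->. Qed.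
Lemma sa_starM x : sa (star x * x).
Proof. by rewrite /sa starM starK. Qed.
Lemma sa_conj g x : sa x -> sa (star g * x * g).
Proof. by rewrite /sa !starM starK mulrA => ->. Qed.
Lemma sa_conjs g x : sa x -> sa g -> sa (g * x * g).
Proof. by rewrite /sa !starM mulrA => -> ->. Qed.

Lemma nrm_sa_sq x : sa x -> nrm (x * x) = nrm x ^+ 2.
Proof. by move=> hx; rewrite -{1}hx nrm_starM. Qed.

Lemma qfD x y xi : qf (x + y) xi = qf x xi + qf y xi.
Proof. by rewrite /qf -/(op _ _) opD rdotDl. Qed.
Lemma qfN x xi : qf (- x) xi = - qf x xi.
Proof. by rewrite /qf -/(op _ _) opN rdotNl. Qed.
Lemma qfZ t x xi : qf (t%:C *: x) xi = t * qf x xi.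
Proof. by rewrite /qf -/(op _ _) opZ rdotZl. Qed.
Lemma qf1 xi : qf (1 : A) xi = rdot xi xi.
Proof. by rewrite /qf -/(op _ _) op1. Qed.
Lemma qf0 xi : qf (0 : A) xi = 0.
Proof. by rewrite -(subrr (0 : A)) qfD qfN subrr. Qed.
Lemma qf_conj g x xi : qf (star g * x * g) xi = qf x (op g xi).
Proof. by rewrite /qf -!/(op _ _) !opM rdot_adj starK. Qed.
Lemma qf_starM g xi : qf (star g * g) xi = rdot (op g xi) (op g xi).
Proof. by rewrite /qf -!/(op _ _) !opM rdot_adj starK. Qed.
Lemma qf_conjs g x xi : sa g -> qf (g * x * g) xi = qf x (op g xi).
Proof. by move=> hg; rewrite -{1}hg qf_conj. Qed.

Lemma qf_le_nrm x xi : `|qf x xi| <= nrm x * rdot xi xi.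
Proof.
rewrite -(@ler_pXn2r _ 2) ?nnegrE ?mulr_ge0 ?nrm_ge0 ?rdot_ge0 //.
rewrite real_normK ?num_real // (le_trans (rdot_CS _ _)) //.
by rewrite exprMn (expr2 (rdot xi xi)) mulrA ler_wpM2r ?rdot_ge0 // rdot_op_le.
Qed.

(** Polarisation at eta = x xi / c:
    4 <x xi, eta> = q (xi + eta) - q (xi - eta), and the bound on q together
    with the parallelogram law gives 2 c (|xi|^2 + |eta|^2).  The factor 1 / c
    balances the two squares. *)
Lemma nrm_qf_le_pos x c : sa x -> 0 < c ->
  (forall xi, `|qf x xi| <= c * rdot xi xi) -> nrm x <= c.
Proof.
move=> hx c0 h.
apply: nrm_lub => [|xi]; first exact: ltW.
have e1 : 4 * c^-1 * rdot (op x xi) (op x xi) =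
   qf x (xi + c^-1%:C *: op x xi) - qf x (xi - c^-1%:C *: op x xi).
  rewrite /qf -!/(op _ _) !op_vD !op_vN !op_vZ.
  rewrite !(rdotDl, rdotDr, rdotNl, rdotNr, rdotZl, rdotZr).
  by rewrite (rdot_adj x (op x xi)) hx; lra.
have := h (xi + c^-1%:C *: op x xi); have := h (xi - c^-1%:C *: op x xi).
rewrite !ler_norml => /andP[h1 _] /andP[_ h2].
have {h1 h2} := lerB h2 h1; rewrite -e1 opprK => h1.
have {h1} : 4 * c^-1 * rdot (op x xi) (op x xi) <=
  2 * c * rdot xi xi + 2 * c * c^-1 * c^-1 * rdot (op x xi) (op x xi).
  apply: le_trans h1 _.
  by rewrite !(rdotDl, rdotDr, rdotNl, rdotNr, rdotZl, rdotZr); lra.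
rewrite -(mulrA 2 c c^-1) divff ?gt_eqF // mulr1 => h1.
have {h1} : c^-1 * rdot (op x xi) (op x xi) <= c * rdot xi xi by lra.
by rewrite -(ler_pM2l c0) mulrA divff ?gt_eqF // mul1r mulrA.
Qed.

Lemma nrm_qf_le x c : sa x -> 0 <= c ->
  (forall xi, `|qf x xi| <= c * rdot xi xi) -> nrm x <= c.
Proof.
move=> hx c0 h; apply/ler_addgt0Pr => e e0.
apply: nrm_qf_le_pos => // [|xi]; first exact: ltr_wpDl.
by rewrite (le_trans (h xi)) // ler_wpM2r ?rdot_ge0 // lerDl ltW.
Qed.

Lemma ople_refl x : ople x x. Proof. by move=> xi. Qed.
Lemma ople_trans x y z : ople x y -> ople y z -> ople x z.
Proof. by move=> h k xi; exact: le_trans (h xi) (k xi). Qed.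
Lemma ople_anti x y : sa x -> sa y -> ople x y -> ople y x -> x = y.
Proof.
move=> hx hy h k; apply/eqP; rewrite -subr_eq0; apply/eqP/nrm_eq0.
apply/le_anti; rewrite nrm_ge0 andbT; apply: nrm_qf_le => // [|xi]; first exact: saB.
by rewrite mul0r qfD qfN (@le_anti _ _ (qf x xi) (qf y xi)) ?subrr ?normr0 ?h ?k.
Qed.
Lemma opleD x y z w : ople x y -> ople z w -> ople (x + z) (y + w).
Proof. by move=> h k xi; rewrite !qfD lerD. Qed.
Lemma ople_conj g x y : ople x y -> ople (star g * x * g) (star g * y * g).
Proof. by move=> h xi; rewrite !qf_conj. Qed.
Lemma ople_conjs g x y : sa g -> ople x y -> ople (g * x * g) (g * y * g).
Proof. by move=> hg h xi; rewrite !qf_conjs. Qed.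
Lemma ople_starM g : ople 0 (star g * g).
Proof. by move=> xi; rewrite qf0 qf_starM rdot_ge0. Qed.
Lemma ople_sq x : sa x -> ople 0 (x * x).
Proof. by move=> hx; rewrite -{1}hx; exact: ople_starM. Qed.
Lemma ople_nrm x : ople x ((nrm x : R)%:C *: 1).
Proof. by move=> xi; rewrite qfZ qf1 (le_trans _ (qf_le_nrm _ _)) // ler_norm. Qed.
Lemma ople_nrmN x : ople ((- nrm x : R)%:C *: 1) x.
Proof.
move=> xi; rewrite qfZ qf1 mulNr; have := qf_le_nrm x xi.
by rewrite ler_norml => /andP[].
Qed.
Lemma nrm_ople x c : sa x -> 0 <= c ->
  ople ((- c : R)%:C *: 1) x -> ople x (c%:C *: 1) -> nrm x <= c.
Proof.
move=> hx c0 h k; apply: nrm_qf_le => // xi; rewrite ler_norml -mulNr.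
by have := h xi; have := k xi; rewrite !qfZ !qf1 => -> ->.
Qed.
End Order.

(** * Norm limits of operators *)

Section OperatorConvergence.
Variables (R : realType) (A : vonNeumannAlgebra R).
Local Open Scope complex_scope.
Implicit Types (u v : nat -> A) (x y z l m : A) (t c e : R).

Lemma tendsMl x u l : tends u l -> tends (fun n => x * u n) (x * l).
Proof.
move=> h; apply: tends_le_nrm (null_seqZ (nrm_ge0 x) h) => n.
by rewrite -mulrBr nrmM.
Qed.

Lemma tendsMr x u l : tends u l -> tends (fun n => u n * x) (l * x).
Proof.
move=> h; apply: tends_le_nrm (null_seqZ (nrm_ge0 x) h) => n.
by rewrite -mulrBl mulrC nrmM.
Qed.

Lemma tendsM u v l m : tends u l -> tends v m -> tends (fun n => u n * v n) (l * m).
Proof.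
move=> h k; have [c hc] := tends_bounded h.
have c0 : 0 <= c := le_trans (nrm_ge0 (u 0)) (hc 0).
apply: tends_le_nrm (null_seqD (null_seqZ c0 k) (null_seqZ (nrm_ge0 m) h)) => n.
rewrite (_ : _ - _ = u n * (v n - m) + (u n - l) * m).
  rewrite (le_trans (nrmD _ _)) // lerD //; first exact: nrmM_le.
  by rewrite mulrC nrmM.
by rewrite mulrBr mulrBl addrA subrK.
Qed.

Lemma tends_star u l : tends u l -> tends (fun n => star (u n)) (star l).
Proof.
by move=> h; apply: tends_le_nrm h => n; rewrite -starB nrm_star.
Qed.

Lemma tends_sa u l : (forall n, sa (u n)) -> tends u l -> sa l.
Proof.
move=> h k; by apply: (tends_uniq _ k); apply: tends_ext (tends_star k).
Qed.

Lemma tends_qf u l xi : tends u l ->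
  null_seq (fun n => `|qf (u n) xi - qf l xi|).
Proof.
move=> h; apply: null_seq_le (null_seqZ (rdot_ge0 xi) h) => n.
by rewrite -qfN -qfD mulrC qf_le_nrm.
Qed.

Lemma tends_ople u v l m : tends u l -> tends v m ->
  (forall n, ople (u n) (v n)) -> ople l m.
Proof.
move=> h k uv xi; rewrite -subr_le0.
apply: (null_seq_bound (null_seqD (tends_qf xi h) (tends_qf xi k))) => n.
have := uv n xi; have := ler_norm (qf l xi - qf (u n) xi).
have := ler_norm (qf (v n) xi - qf m xi); rewrite (distrC (qf l xi)); lra.
Qed.

End OperatorConvergence.

(** * The exponential series *)

Section ExpSeries.
Variable R : realType.
Implicit Types (c : R).

Definition exp_psum c n : R := \sum_(k < n) k`!%:R^-1 * c ^+ k.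

Lemma exp_psumE c n : exp_psum c n = series (exp_coeff c) n.
Proof.
rewrite /exp_psum seriesEord; apply: eq_bigr => i _.
by rewrite /exp_coeff mulrC.
Qed.

Lemma exp_psum_cvg c : exp_psum c @ \oo --> expR c.
Proof.
rewrite (_ : exp_psum c = series (exp_coeff c)).
  exact: is_cvg_series_exp_coeff.
by apply/funext => n; exact: exp_psumE.
Qed.

Lemma exp_psum_le c n : 0 <= c -> exp_psum c n <= expR c.
Proof.
move=> c0; rewrite exp_psumE; apply: nondecreasing_cvgn_le.
  apply/nondecreasing_seqP => m.
  by rewrite seriesSr lerDl divr_ge0 ?exprn_ge0.
exact: is_cvg_series_exp_coeff.
Qed.
End ExpSeries.

Section ExpProduct.

Lemma sum_triangle (V : zmodType) (G : nat -> nat -> V) n :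
  \sum_(i < n) \sum_(0 <= j < n - i) G i j =
  \sum_(k < n) \sum_(i < k.+1) G i (k - i)%N.
Proof.
elim: n => [|n ih]; first by rewrite !big_ord0.
rewrite [RHS]big_ord_recr /= -ih.
transitivity (\sum_(i < n.+1) (\sum_(0 <= j < n - i) G i j + G i (n - i)%N)).
  apply: eq_bigr => i _; rewrite subSn; last by rewrite -ltnS.
  by rewrite big_nat_recr.
by rewrite big_split /= [X in X + _]big_ord_recr /= subnn big_geq // addr0.
Qed.

Variables (F : numFieldType) (T : algType F).
Implicit Types x y : T.

Definition epart x n : T := \sum_(k < n) (k`!%:R^-1 : F) *: x ^+ k.

(** General term of the Cauchy product of two exponential series. *)
Definition eterm x y (i j : nat) : T :=
  (i`!%:R^-1 * j`!%:R^-1 : F) *: (x ^+ i * y ^+ j).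

(** The double sum over the square [0, n[ x [0, n[ is split along the diagonal
    i + j = n; by the binomial formula the lower triangle is a truncated
    exponential.  Stated over any algebra because the remainder for operators
    is bounded by the same remainder for real numbers. *)
Lemma epart_mul x y n : x * y = y * x ->
  epart x n * epart y n = epart (x + y) n +
    \sum_(i < n) \sum_(n - i <= j < n) eterm x y i j.
Proof.
move=> xy; transitivity (\sum_(i < n) \sum_(0 <= j < n) eterm x y i j).
  rewrite /epart mulr_suml; apply: eq_bigr => i _.
  rewrite mulr_sumr big_mkord; apply: eq_bigr => j _.
  by rewrite -scalerAl -scalerAr scalerA.
transitivity (\sum_(i < n) (\sum_(0 <= j < n - i) eterm x y i j +
    \sum_(n - i <= j < n) eterm x y i j)).
  by apply: eq_bigr => i _; rewrite -big_cat_nat //= leq_subr.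
rewrite big_split /= sum_triangle; congr (_ + _).
apply: eq_bigr => k _; rewrite addrC exprDn_comm // scaler_sumr.
apply: eq_bigr => i _; rewrite /eterm.
have ik : (i <= k)%N by rewrite -ltnS.
rewrite -[X in _ = _ *: X](@scaler_nat F) scalerA; congr (_ *: _).
  rewrite -(bin_fact ik) !natrM invfM mulrAC mulVf; last first.
    by rewrite pnatr_eq0 -lt0n bin_gt0.
  by rewrite mul1r invfM.
by apply/commrX/commr_sym/commrX.
Qed.

End ExpProduct.

Section Exp.
Variables (R : realType) (A : vonNeumannAlgebra R).
Local Open Scope complex_scope.
Implicit Types (u v : nat -> A) (x y z l m : A) (s t c e : R).

Local Notation ep := (@epart R[i] A).

Lemma natVC n : (n%:R^-1 : R[i]) = (n%:R^-1 : R)%:C.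
Proof. by rewrite fmorphV rmorph_nat. Qed.

Lemma epartE x n : ep x n = series (fun k => k`!%:R^-1 *: x ^+ k : A) n.
Proof. by rewrite seriesEord. Qed.

Lemma exp_psumS c n : exp_psum c n.+1 = exp_psum c n + n`!%:R^-1 * c ^+ n.
Proof. by rewrite /exp_psum big_ord_recr. Qed.

Lemma epartB_le x (n m : nat) : (n <= m)%N ->
  nrm (ep x m - ep x n) <= exp_psum (nrm x) m - exp_psum (nrm x) n.
Proof.
have e1 j : ep x j = \sum_(0 <= k < j) (k`!%:R^-1 : R[i]) *: x ^+ k.
  by rewrite big_mkord.
have e2 j : exp_psum (nrm x) j = \sum_(0 <= k < j) k`!%:R^-1 * nrm x ^+ k.
  by rewrite big_mkord.
move=> nm; rewrite !e1 !e2 !(big_cat_nat (leq0n n) nm) /=.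
rewrite ![_ + _ - _]addrC !addKr.
rewrite (le_trans (nrm_sum _ _ _)) //; apply: ler_sum => i _.
by rewrite natVC nrmZ ger0_norm ?invr_ge0 // ler_wpM2l ?invr_ge0 // nrmX.
Qed.

Lemma exp_psum_tail c : 0 <= c -> null_seq (fun n => expR c - exp_psum c n).
Proof.
move=> c0; apply: null_seq_cvg; rewrite -(subrr (expR c)).
by apply: cvgB; [exact: cvg_cst|exact: exp_psum_cvg].
Qed.

Lemma epart_exp x : tends (ep x) (op_exp x).
Proof.
have [l xl] : exists l, tends (ep x) l.
  apply: complete_rate (exp_psum_tail (nrm_ge0 x)) _ => n m nm.
  rewrite (le_trans (epartB_le _ nm)) // lerD2r.
  by rewrite exp_psum_le ?nrm_ge0.
suff -> : op_exp x = l by [].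
rewrite /op_exp -(_ : ep x = series _).
  by apply: cvg_lim; [exact: norm_hausdorff|exact: tends_cvg].
by apply/funext => n; rewrite epartE.
Qed.

Lemma nrm_epart x n : nrm (ep x n) <= exp_psum (nrm x) n.
Proof.
have := epartB_le x (leq0n n).
by rewrite {2}/epart {2}/exp_psum !big_ord0 !subr0.
Qed.

Lemma nrm_exp x : nrm (op_exp x) <= expR (nrm x).
Proof.
apply: (tends_nrm_le (epart_exp x)) => n.
by rewrite (le_trans (nrm_epart _ _)) // exp_psum_le ?nrm_ge0.
Qed.

Lemma exp_psum_real c n : epart (c : R^o) n = exp_psum c n.
Proof. by []. Qed.

(** The remainder of [epart_mul] has nonnegative coefficients, so its norm is at
    most the remainder for the real numbers nrm x and nrm y; that one vanishes
    in the limit because the real exponential is multiplicative. *)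
Lemma op_expD x y : x * y = y * x -> op_exp (x + y) = op_exp x * op_exp y.
Proof.
move=> xy; apply: (tends_uniq (epart_exp _)).
have h := tendsM (epart_exp x) (epart_exp y).
suff k : null_seq (fun n => nrm (ep x n * ep y n - ep (x + y) n)).
  apply: tends_le_nrm (null_seqD k h) => n.
  by rewrite (le_trans (nrm_dist _ (ep x n * ep y n) _)) // nrm_distC.
pose a := nrm x; pose b := nrm y.
have k : null_seq (fun n => exp_psum a n * exp_psum b n - exp_psum (a + b) n).
  apply: null_seq_cvg; rewrite -(subrr (expR (a + b))) {1}expRD.
  by apply: cvgB; [apply: cvgM; exact: exp_psum_cvg|exact: exp_psum_cvg].
apply: null_seq_le k => n; rewrite epart_mul // addrAC subrr add0r.
have /= := @epart_mul R R^o a b n (mulrC _ _).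
rewrite !exp_psum_real => ->; rewrite addrAC subrr add0r.
rewrite (le_trans (nrm_sum _ _ _)) //; apply: ler_sum => i _.
rewrite (le_trans (nrm_sum _ _ _)) //; apply: ler_sum => j _.
rewrite /eterm !natVC -rmorphM /= nrmZ ger0_norm ?mulr_ge0 ?invr_ge0 //.
rewrite ler_wpM2l ?mulr_ge0 ?invr_ge0 // nrmM_le //; exact: nrmX.
Qed.

Lemma op_exp0 : op_exp (0 : A) = 1.
Proof.
apply: (tends_uniq (epart_exp _)) => e e0; exists 1 => -[//|n] _.
rewrite /epart big_ord_recl fact0 invr1 scale1r expr0 big1 ?addr0 ?subrr ?nrm0 ?ltW//.
by move=> i _; rewrite exprS mul0r scaler0.
Qed.

Lemma op_expNl x : op_exp (- x) * op_exp x = 1.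
Proof. by rewrite -op_expD ?addNr ?op_exp0 // mulNr mulrN. Qed.
Lemma op_expNr x : op_exp x * op_exp (- x) = 1.
Proof. by rewrite -op_expD ?addrN ?op_exp0 // mulNr mulrN. Qed.

Lemma exp_unit x : op_exp x \is a GRing.unit.
Proof. by apply/unitrP; exists (op_exp (- x)); rewrite op_expNl op_expNr. Qed.

Lemma exp_inv x : (op_exp x)^-1 = op_exp (- x).
Proof. by rewrite -[RHS]mul1r -(mulVr (exp_unit x)) -mulrA op_expNr mulr1. Qed.

Lemma star_exp x : star (op_exp x) = op_exp (star x).
Proof.
apply: (tends_uniq (tends_star (epart_exp x))).
apply: tends_ext (epart_exp (star x)) => n.
rewrite /epart; elim: n => [|n ih]; first by rewrite !big_ord0 star0.
by rewrite !big_ord_recr /= starD ih natVC starZ starX.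
Qed.

Lemma sa_exp x : sa x -> sa (op_exp x).
Proof. by move=> hx; rewrite /sa star_exp hx. Qed.

Lemma comm_exp x y : x * y = y * x -> x * op_exp y = op_exp y * x.
Proof.
move=> xy; apply: (tends_uniq (tendsMl x (epart_exp y))).
apply: tends_ext (tendsMr x (epart_exp y)) => n.
rewrite /epart mulr_suml mulr_sumr; apply: eq_bigr => i _.
rewrite -scalerAl -scalerAr; congr (_ *: _).
exact/commr_sym/commrX.
Qed.

Lemma conjX g h x n : h * g = 1 -> g * h = 1 ->
  (g * x * h) ^+ n = g * x ^+ n * h.
Proof.
move=> hg gh; elim: n => [|n ih]; first by rewrite !expr0 mulr1.
by rewrite exprS ih !mulrA -(mulrA (g * x)) hg mulr1 exprS mulrA.
Qed.

Lemma exp_conj g h x : h * g = 1 -> g * h = 1 ->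
  op_exp (g * x * h) = g * op_exp x * h.
Proof.
move=> hg gh; apply: (tends_uniq (epart_exp _)).
apply: tends_ext (tendsMr h (tendsMl g (epart_exp x))) => n.
rewrite /epart mulr_sumr mulr_suml; apply: eq_bigr => i _.
by rewrite conjX // -scalerAr -scalerAl.
Qed.

End Exp.

(** * Order, square roots and monotonicity of the logarithm *)

Section ExpOrder.
Variables (R : realType) (A : vonNeumannAlgebra R).
Local Open Scope complex_scope.
Local Notation op := (@vop R A).
Implicit Types (u v : nat -> A) (a b g x y z l : A) (s t c e : R).

Lemma scalerC s t x : s%:C *: (t%:C *: x) = (s * t : R)%:C *: x.
Proof. by rewrite scalerA -rmorphM. Qed.
Lemma scale1C x : 1%:C *: x = x.
Proof. by rewrite rmorph1 scale1r. Qed.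
Lemma scalerDlC s t x : (s + t : R)%:C *: x = s%:C *: x + t%:C *: x.
Proof. by rewrite rmorphD scalerDl. Qed.
Lemma scaleNC s x : (- s : R)%:C *: x = - (s%:C *: x).
Proof. by rewrite rmorphN scaleNr. Qed.

Lemma comm_scale s t x : (s%:C *: x) * (t%:C *: x) = (t%:C *: x) * (s%:C *: x).
Proof. by rewrite -!scalerAl -!scalerAr !scalerC mulrC. Qed.

Lemma op_expZD s t x :
  op_exp ((s + t : R)%:C *: x) = op_exp (s%:C *: x) * op_exp (t%:C *: x).
Proof. by rewrite scalerDlC op_expD // comm_scale. Qed.

Lemma exp_half x : op_exp x = op_exp ((2^-1 : R)%:C *: x) * op_exp ((2^-1 : R)%:C *: x).
Proof. by rewrite -op_expZD (_ : _ + _ = 1) ?scale1C //; lra. Qed.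

Lemma exp_natZ n x : op_exp (n%:R%:C *: x) = op_exp x ^+ n.
Proof.
elim: n => [|n ih]; first by rewrite mulr0n rmorph0 scale0r op_exp0 expr0.
by rewrite -natr1 op_expZD ih scale1C exprSr.
Qed.

Lemma exp_scalar c : op_exp (c%:C *: (1 : A)) = (expR c : R)%:C *: 1.
Proof.
apply: (tends_uniq (epart_exp _)).
have E n : @epart R[i] A (c%:C *: 1) n = (exp_psum c n : R)%:C *: 1.
  elim: n => [|n ih]; first by rewrite /epart /exp_psum !big_ord0 scale0r.
  rewrite /epart big_ord_recr -/(epart _ _) ih exp_psumS scalerDlC; congr (_ + _).
  by rewrite natVC exprZn expr1n -rmorphXn scalerC.
apply: tends_le_nrm (null_seq_cvg (_ : (fun n => `|exp_psum c n - expR c|) @ \oo --> 0)).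
  move=> n; rewrite E -scalerBl -rmorphB nrmZ nrm1 mulr1; exact: lexx.
rewrite -(normr0 R) -(subrr (expR c)); apply: cvg_norm.
by apply: cvgB; [exact: exp_psum_cvg|exact: cvg_cst].
Qed.

Lemma exp_addscalar c x : op_exp (c%:C *: 1 + x) = (expR c : R)%:C *: op_exp x.
Proof.
rewrite op_expD; first by rewrite exp_scalar -scalerAl mul1r.
by rewrite -scalerAl -scalerAr mul1r mulr1.
Qed.

Lemma exp_ge0 x : sa x -> ople 0 (op_exp x).
Proof. by move=> hx; rewrite exp_half; apply/ople_sq/sa_exp/saZ. Qed.

Lemma ople_scale t x y : 0 <= t -> ople x y -> ople (t%:C *: x) (t%:C *: y).
Proof. by move=> t0 h xi; rewrite !qfZ ler_wpM2l. Qed.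

Lemma ople_scalar s t : s <= t -> ople (s%:C *: 1) (t%:C *: (1 : A)).
Proof. by move=> st xi; rewrite !qfZ qf1 ler_wpM2r ?rdot_ge0. Qed.

Lemma ople_subr x y : ople 0 (y - x) <-> ople x y.
Proof. by split=> h xi; have := h xi; rewrite qf0 qfD qfN subr_ge0. Qed.

(** An even power is a square, and an odd power is x conjugated by a power. *)
Lemma powers_ge0 x n : sa x -> ople 0 x -> ople 0 (x ^+ n).
Proof.
move=> hx h; rewrite -(odd_double_half n) -addnn exprD.
case: (odd n) => /=; last by rewrite mul1r exprD; apply/ople_sq/saX.
rewrite expr1 exprD mulrA -exprS exprSr => xi.
by rewrite qf_conjs ?qf0; [have := h (op (x ^+ n./2) xi); rewrite qf0|exact: saX].
Qed.

Lemma exp_ge1 x : sa x -> ople 0 x -> ople 1 (op_exp x).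
Proof.
move=> hx h; apply: (tends_ople (tends_cst (1 : A)) (tends_sub (f := S) _ (epart_exp x))) => //.
move=> n xi; rewrite /epart big_ord_recl fact0 invr1 scale1r expr0 qfD lerDl.
elim/big_ind: _ => [|y z hy hz|i _]; first by rewrite qf0.
  by rewrite qfD addr_ge0.
rewrite natVC qfZ mulr_ge0 ?invr_ge0 //.
by have := @powers_ge0 x i.+1 hx h xi; rewrite qf0.
Qed.

Lemma exp_le1 x : sa x -> ople x 0 -> ople (op_exp x) 1.
Proof.
move=> hx h; have hm : ople 1 (op_exp (- x)).
  apply: exp_ge1; first exact: saN.
  by move=> xi; have := h xi; rewrite !qf0 qfN oppr_ge0.
have hs : sa (op_exp ((2^-1 : R)%:C *: x)) by apply/sa_exp/saZ.
have := ople_conjs hs hm; rewrite mulr1 -exp_half.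
suff -> : op_exp ((2^-1 : R)%:C *: x) * op_exp (- x) * op_exp ((2^-1 : R)%:C *: x) = 1 by [].
have -> : - x = (-1 : R)%:C *: x by rewrite scaleNC scale1C.
by rewrite -!op_expZD (_ : _ + _ = 0) ?scale0r ?op_exp0 //; lra.
Qed.

Lemma exp_le_scalar x c : sa x -> ople x (c%:C *: 1) ->
  ople (op_exp x) ((expR c : R)%:C *: 1).
Proof.
move=> hx h; rewrite -[x](subrKC (c%:C *: 1)) exp_addscalar.
apply: ople_scale; first exact: expR_ge0.
apply: exp_le1; first by apply: saB => //; apply/saZ/sa1.
by move=> xi; have := h xi; rewrite qf0 qfD qfN subr_le0.
Qed.

Lemma exp_ge_scalar x c : sa x -> ople (c%:C *: 1) x ->
  ople ((expR c : R)%:C *: 1) (op_exp x).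
Proof.
move=> hx h; rewrite -[x](subrKC (c%:C *: 1)) exp_addscalar.
apply: ople_scale; first exact: expR_ge0.
apply: exp_ge1; first by apply: saB => //; apply/saZ/sa1.
by apply/ople_subr.
Qed.

Lemma epart1 x n : @epart R[i] A x n.+1 = 1 + \sum_(k < n) (k.+1`!%:R^-1 : R[i]) *: x ^+ k.+1.
Proof. by rewrite /epart big_ord_recl fact0 invr1 scale1r expr0. Qed.

Lemma fact_le_add2 k : (k`! <= k.+2`!)%N.
Proof. by rewrite !factS mulnA leq_pmull. Qed.

Lemma nrm_exp_rem x : nrm (op_exp x - 1 - x) <= nrm x ^+ 2 * expR (nrm x).
Proof.
have h := tends_sub (f := fun n => n.+2) (fun n => leqW (leqnSn n)) (epart_exp x).
apply: (tends_nrm_le (tendsB (tendsB h (tends_cst (1 : A))) (tends_cst x))) => n.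
rewrite epart1 big_ord_recl (_ : (@ord0 n).+1`! = 1%N) // invr1 scale1r expr1.
rewrite [1 + _]addrC addrK [x + _]addrC addrK (le_trans (nrm_sum _ _ _)) //.
apply: le_trans (_ : nrm x ^+ 2 * exp_psum (nrm x) n <= _); last first.
  by rewrite ler_wpM2l ?exprn_ge0 ?nrm_ge0 // exp_psum_le ?nrm_ge0.
rewrite mulr_sumr; apply: ler_sum => k _.
rewrite natVC nrmZ ger0_norm ?invr_ge0 // mulrCA -exprD add2n.
rewrite ler_pM ?invr_ge0 ?nrm_ge0 ?nrmX //.
by rewrite lef_pV2 ?posrE ?ltr0n ?fact_gt0 // ler_nat fact_le_add2.
Qed.

Lemma nrm_sa_pow2 x k : sa x -> nrm (x ^+ (2 ^ k)) = nrm x ^+ (2 ^ k).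
Proof.
move=> hx; elim: k => [|k ih]; first by rewrite !expr1.
by rewrite expnS mulnC !exprM expr2 nrm_sa_sq ?ih //; exact: saX.
Qed.

(** Powers of exponent 2^k of a selfadjoint element have norm nrm x ^ 2^k, which
    is unbounded as soon as nrm x exceeds 1. *)
Lemma power_bounded_le1 x c : sa x -> (forall n, nrm (x ^+ n) <= c) -> nrm x <= 1.
Proof.
move=> hx h; rewrite leNgt; apply/negP => x1.
have x0 : 0 < nrm x by rewrite (lt_trans ltr01).
have c0 : 0 <= c := le_trans (nrm_ge0 _) (h 0).
have : null_seq (fun n => c * (nrm x)^-1 ^+ n).
  by apply: null_seq_geo => //; rewrite invr_ge0 ltW //= invf_lt1.
move=> /(null_seq_comp (f := expn 2) (fun n => ltnW (ltn_expl n (ltnSn 1)))).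
move=> k; suff : (1 : R) <= 0 by rewrite ler10.
apply: (null_seq_bound k) => n; rewrite exprVn ler_pdivlMr ?exprn_gt0 // mul1r -nrm_sa_pow2 //.
Qed.

(** Let b = d d.  From a^2 <= b^2 follows nrm (a b^-1) <= 1.  The element
    d^-1 a d^-1 is similar to a b^-1, so its powers are bounded; it is
    selfadjoint, hence of norm at most 1, hence at most 1, and conjugation by d
    gives a <= b. *)
Lemma sqrt_mono a d di : sa a -> sa d -> sa di -> d * di = 1 -> di * d = 1 ->
  ople (a * a) ((d * d) * (d * d)) -> ople a (d * d).
Proof.
move=> ha hd hdi ddi did h.
have hbi : sa (di * di) by exact: sa_sq.
have abi1 : nrm (a * (di * di)) <= 1.
  apply: nrm_lub => // xi; rewrite expr1n mul1r -qf_starM starM ha hbi.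
  rewrite mulrA -(mulrA (di * di) a a); apply: le_trans (ople_conjs hbi h xi) _.
  rewrite !mulrA -(mulrA di di d) did mulr1 did mul1r.
  by rewrite -(mulrA d d di) ddi mulr1 ddi qf1.
have abin n : nrm ((a * (di * di)) ^+ n) <= 1.
  by rewrite (le_trans (nrmX _ _)) // exprn_ile1 ?nrm_ge0.
have hq : sa (di * a * di) by apply: sa_conjs.
(* up to the outer factors, the powers of di a di are those of a di di *)
have qS n : (di * a * di) ^+ n.+1 = di * (a * (di * di)) ^+ n * a * di.
  elim: n => [|n ih]; first by rewrite expr1 expr0 mulr1.
  by rewrite exprSr ih [in RHS]exprSr !mulrA.
have q1 : nrm (di * a * di) <= 1.
  apply: (@power_bounded_le1 _ (Num.max 1 (nrm di * 1 * nrm a * nrm di)) hq).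
  case=> [|n]; first by rewrite expr0 nrm1 le_max lexx.
  by rewrite qS le_max; apply/orP; right; do 3!apply: nrmM_le => //.
have ql1 : ople (di * a * di) 1.
  by apply: ople_trans (ople_nrm _) _; rewrite -[X in ople _ X]scale1C; exact: ople_scalar.
have := ople_conjs hd ql1; rewrite mulr1.
by rewrite !mulrA ddi mul1r -mulrA did mulr1.
Qed.

Lemma exp_sqrt_mono x y : sa x -> sa y -> ople (op_exp x) (op_exp y) ->
  ople (op_exp ((2^-1 : R)%:C *: x)) (op_exp ((2^-1 : R)%:C *: y)).
Proof.
move=> hx hy; rewrite (exp_half x) (exp_half y) => h.
have dd : op_exp ((4^-1 : R)%:C *: y) * op_exp ((4^-1 : R)%:C *: y) = op_exp ((2^-1 : R)%:C *: y).
  by rewrite -op_expZD (_ : 4^-1 + 4^-1 = 2^-1) //; lra.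
rewrite -dd in h *.
apply: (@sqrt_mono _ _ (op_exp ((- 4^-1 : R)%:C *: y))) h.
- exact/sa_exp/saZ.
- exact/sa_exp/saZ.
- exact/sa_exp/saZ.
- by rewrite -op_expZD addrN scale0r op_exp0.
- by rewrite -op_expZD addNr scale0r op_exp0.
Qed.

Lemma null_seq_pow2 c : 0 <= c -> null_seq (fun n => c * (2^-1 : R) ^+ n).
Proof.
move=> c0; apply: null_seq_geo => //.
by rewrite invr_ge0 ler0n /= invf_lt1 ?ltr1n.
Qed.

(** Recovers x from the dyadic roots of its exponential, to which
    [exp_sqrt_mono] applies. *)
Lemma exp_rate x : tends (fun k => (2 ^+ k : R)%:C *: (op_exp ((2^-1 ^+ k : R)%:C *: x) - 1)) x.
Proof.
apply: tends_le_nrm (null_seq_pow2 (mulr_ge0 (sqr_ge0 (nrm x)) (expR_ge0 (nrm x)))) => k.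
have k1 : (2^-1 : R) ^+ k <= 1 by rewrite exprn_ile1 ?invr_ge0 ?ler0n // invf_le1 ?ler1n.
have k0 : 0 <= (2^-1 : R) ^+ k by rewrite exprn_ge0 ?invr_ge0.
have kk : (2 : R) ^+ k * 2^-1 ^+ k = 1.
  by rewrite -exprMn divff ?expr1n // pnatr_eq0.
rewrite [X in _ - X](_ : x = (2 ^+ k : R)%:C *: ((2^-1 ^+ k : R)%:C *: x)); last first.
  by rewrite scalerC kk scale1C.
rewrite -scalerBr nrmZ ger0_norm ?exprn_ge0 //.
rewrite -(@ler_pM2l _ (2^-1 ^+ k)) ?exprn_gt0 ?invr_gt0 // mulrA (mulrC _ (2 ^+ k)) kk mul1r.
rewrite (le_trans (nrm_exp_rem _)) // nrmZ (ger0_norm k0).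
have ex : expR (2^-1 ^+ k * nrm x) <= expR (nrm x).
  by rewrite ler_expR ler_piMl ?nrm_ge0.
rewrite [leRHS](_ : _ = (2^-1 ^+ k * nrm x) ^+ 2 * expR (nrm x)); last by ring.
by rewrite ler_wpM2l ?sqr_ge0.
Qed.

(** Operator monotonicity of the logarithm: k square roots turn e^x <= e^y into
    2^k (e^(x/2^k) - 1) <= 2^k (e^(y/2^k) - 1), and k tends to infinity. *)
Lemma exp_mono_inv x y : sa x -> sa y -> ople (op_exp x) (op_exp y) -> ople x y.
Proof.
move=> hx hy h; apply: (tends_ople (exp_rate x) (exp_rate y)) => k.
apply: ople_scale; first by rewrite exprn_ge0.
apply: opleD; last exact: ople_refl.
elim: k => [|k ih]; first by rewrite !expr0 !scale1C.
by rewrite exprS -!scalerC; apply: exp_sqrt_mono => //; exact: saZ.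
Qed.

Lemma exp_inj x y : sa x -> sa y -> op_exp x = op_exp y -> x = y.
Proof.
by move=> hx hy e; apply: ople_anti => //; apply: exp_mono_inv => //; rewrite e;
  exact: ople_refl.
Qed.

Lemma op_lnK x : sa x -> op_ln (op_exp x) = x.
Proof.
move=> hx; rewrite /op_ln; case: xgetP => [y _ [hy e]|/(_ x)]; first exact: exp_inj.
by case; split.
Qed.

Lemma op_pow_exp x t : sa x -> op_pow (op_exp x) t = op_exp (t%:C *: x).
Proof. by move=> hx; rewrite /op_pow op_lnK. Qed.

Lemma comm_scaled z t x : z * x = x * z -> z * (t%:C *: x) = (t%:C *: x) * z.
Proof. by move=> h; rewrite -scalerAl -scalerAr h. Qed.

Section SquareRoot.
Variable a : A.
Hypotheses (ha : sa a) (a1 : nrm a <= 1).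

(** A fixed point t of t |-> (a + t^2) / 2 satisfies (1 - t)^2 = 1 - a. *)
Fixpoint root_iter n : A :=
  if n is n'.+1 then (2^-1 : R)%:C *: (a + root_iter n' * root_iter n') else 0.

(** The same iteration for a = 1; its increments dominate those of
    [root_iter]. *)
Fixpoint root_bound n : R :=
  if n is n'.+1 then 2^-1 * (1 + root_bound n' * root_bound n') else 0.

Lemma root_iter_comm z n : z * a = a * z -> z * root_iter n = root_iter n * z.
Proof.
move=> za; elim: n => [|n ih] /=; first by rewrite mulr0 mul0r.
apply: comm_scaled; rewrite mulrDl mulrDr za; congr (_ + _).
by rewrite mulrA ih -!mulrA ih.
Qed.

Lemma root_iter_commC n m : root_iter n * root_iter m = root_iter m * root_iter n.
Proof. by apply: root_iter_comm; apply/esym/root_iter_comm. Qed.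

Lemma root_bound01 n : 0 <= root_bound n <= 1.
Proof.
elim: n => [|n /andP[ih0 ih1]] /=; first by rewrite lexx ler01.
have h0 : 0 <= root_bound n * root_bound n by rewrite mulr_ge0.
have h1 : root_bound n * root_bound n <= 1 by rewrite mulr_ile1.
by apply/andP; split; lra.
Qed.

(** The iterates commute, so an increment is half the product of the previous
    increment with the sum of two iterates; in the scalar iteration this is an
    equality between nonnegative numbers. *)
Lemma root_iter_bound n :
  nrm (root_iter n) <= root_bound n /\
  nrm (root_iter n.+1 - root_iter n) <= root_bound n.+1 - root_bound n.
Proof.
have half : `|2^-1 : R| = 2^-1 by rewrite ger0_norm // invr_ge0.
elim: n => [|n [ih1 ih2]].
  split; rewrite /= ?nrm0 // mulr0 addr0 subr0 nrmZ half.
  by rewrite mulr0 addr0 subr0 ler_wpM2l ?invr_ge0.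
have b1 : nrm (root_iter n.+1) <= root_bound n.+1.
  rewrite /= nrmZ half ler_wpM2l ?invr_ge0 // (le_trans (nrmD _ _)) //.
  by rewrite lerD // nrmM_le.
split=> //.
have -> : root_iter n.+2 - root_iter n.+1 = (2^-1 : R)%:C *:
    ((root_iter n.+1 - root_iter n) * (root_iter n.+1 + root_iter n)).
  rewrite [root_iter n.+2]/= {3}[root_iter n.+1]/= -scalerBr; congr (_ *: _).
  rewrite opprD addrACA subrr add0r mulrDr !mulrBl (root_iter_commC n n.+1).
  by rewrite addrA subrK.
have -> : root_bound n.+2 - root_bound n.+1 = 2^-1 *
    ((root_bound n.+1 - root_bound n) * (root_bound n.+1 + root_bound n)).
  have e : root_bound n.+1 = 2^-1 * (1 + root_bound n * root_bound n) by [].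
  have -> : root_bound n.+2 = 2^-1 * (1 + root_bound n.+1 * root_bound n.+1) by [].
  by rewrite [X in _ - X]e; ring.
rewrite nrmZ half ler_wpM2l ?invr_ge0 // nrmM_le //.
by rewrite (le_trans (nrmD _ _)) // lerD.
Qed.

Lemma sqrt_near1 : exists s : A, [/\ sa s, ople 0 s & s * s = 1 - a].
Proof.
have bnd : has_ubound (range root_bound).
  by exists 1 => _ [n _ <-]; have /andP[] := root_bound01 n.
have mono : nondecreasing_seq root_bound.
  apply/nondecreasing_seqP => n; rewrite -subr_ge0.
  by have [_] := root_iter_bound n; apply: le_trans; exact: nrm_ge0.
have hc := nondecreasing_cvgn mono bnd.
set th := sup _ in hc.
have th1 n : root_bound n <= th.
  by have := nondecreasing_cvgn_le mono (cvgP _ hc) n; rewrite (cvg_lim _ hc).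
have [|||T [hT _]] := @telescoping_tends _ _ root_iter (fun n => th - root_bound n).
- by move=> n; rewrite subr_ge0.
- apply: null_seq_cvg; rewrite -(subrr th).
  by apply: cvgB hc; exact: cvg_cst.
- move=> n; have [_ h] := root_iter_bound n; lra.
have saT : sa T.
  apply: (tends_sa _ hT) => n; elim: n => [|n ih] /=; first exact: sa0.
  by apply/saZ/saD => //; exact: sa_sq.
have T1 : nrm T <= 1.
  apply: (tends_nrm_le hT) => n; have [h _] := root_iter_bound n.
  by rewrite (le_trans h) //; have /andP[] := root_bound01 n.
have eT : T = (2^-1 : R)%:C *: (a + T * T).
  apply: (tends_uniq (tends_sub (f := S) (fun n => leqnSn n) hT)).
  exact: tendsZ (tendsD (tends_cst a) (tendsM hT hT)).
exists (1 - T); split; first by apply: saB => //; exact: sa1.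
- apply/ople_subr; apply: ople_trans (ople_nrm T) _.
  by rewrite -[X in ople _ X]scale1C; exact: ople_scalar.
- have e2 : T + T = a + T * T.
    rewrite {1 2}eT -scalerDlC (_ : _ + _ = 1) ?scale1C //; lra.
  by rewrite mulrBl mul1r mulrBr mulr1 -addrA -opprD addrA e2 addrK.
Qed.
End SquareRoot.

(** Scaling by c > nrm x moves x / c to within distance 1 of the identity. *)
Lemma sqrt_exists x : sa x -> ople 0 x -> exists s : A, [/\ sa s, ople 0 s & s * s = x].
Proof.
move=> hx h; pose c := nrm x + 1.
have c0 : 0 < c by rewrite ltr_wpDl ?nrm_ge0.
have hy : sa (1 - c^-1%:C *: x) by apply: saB; [exact: sa1|exact: saZ].
have [|s [s1 s2 s3]] := sqrt_near1 hy.
  apply: nrm_ople => //.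
    move=> xi; rewrite !qfD qfN !qfZ qf1.
    have : c^-1 * qf x xi <= rdot xi xi.
      rewrite mulrC ler_pdivrMr // mulrC.
      apply: le_trans (ople_nrm x xi) _; rewrite qfZ qf1.
      by rewrite ler_wpM2r ?rdot_ge0 // lerDl.
    by have := rdot_ge0 xi; lra.
  move=> xi; rewrite qfD qfN !qfZ qf1 mul1r gerDl oppr_le0.
  by rewrite mulr_ge0 ?invr_ge0 ?(ltW c0) //; have := h xi; rewrite qf0.
exists ((Num.sqrt c : R)%:C *: s); split; first exact: saZ.
  by move=> xi; rewrite qfZ qf0 mulr_ge0 ?sqrtr_ge0 //; have := s2 xi; rewrite qf0.
rewrite -scalerAl -scalerAr scalerC -expr2 sqr_sqrtr ?ltW // s3.
by rewrite opprB addrC subrK scalerC divff ?gt_eqF // scale1C.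
Qed.

Lemma positiveP x : sa x -> ople 0 x -> positive x.
Proof. by move=> hx /(sqrt_exists hx)[s [hs _ <-]]; exists s; rewrite hs. Qed.

Lemma positive_ople x : positive x -> ople 0 x.
Proof. by move=> [b ->]; exact: ople_starM. Qed.

End ExpOrder.

(** * Existence of logarithms *)

Section Log.
Variables (R : realType) (A : vonNeumannAlgebra R).
Local Open Scope complex_scope.
Local Notation op := (@vop R A).
Implicit Types (u v : nat -> A) (a b g q x y z l : A) (s t c e : R).

(** Matrix elements separate operators and depend linearly on them, so a linear
    identity between operators becomes, by [mel_inj] and [melE], an identity
    between real numbers. *)
Definition mel x xi eta : R := rdot (op x xi) eta.
Lemma melD x y xi eta : mel (x + y) xi eta = mel x xi eta + mel y xi eta.
Proof. by rewrite /mel opD rdotDl. Qed.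
Lemma melN x xi eta : mel (- x) xi eta = - mel x xi eta.
Proof. by rewrite /mel opN rdotNl. Qed.
Lemma melZ t x xi eta : mel (t%:C *: x) xi eta = t * mel x xi eta.
Proof. by rewrite /mel opZ rdotZl. Qed.
Lemma mel0 xi eta : mel 0 xi eta = 0.
Proof. by rewrite -(subrr 0) melD melN subrr. Qed.
Definition melE := (melD, melN, melZ, mel0).
Lemma mel_inj x y : (forall xi eta, mel x xi eta = mel y xi eta) -> x = y.
Proof.
move=> h; apply: vn_op_inj => xi; apply/eqP; rewrite -subr_eq0; apply/eqP/rdot_eq0.
by rewrite {1}rdotDl rdotNl; have := h xi (op x xi - op y xi); rewrite /mel => ->; rewrite subrr.
Qed.

Lemma sa_inv x : sa x -> x \is a GRing.unit -> sa x^-1.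
Proof.
move=> hx ux; rewrite /sa -[LHS]mulr1 -(mulrV ux) mulrA.
by rewrite -{2}hx -starM mulrV // star1 mul1r.
Qed.

Lemma unit_sq x : x * x \is a GRing.unit -> x \is a GRing.unit.
Proof.
move=> h; apply/unitrP; exists ((x * x)^-1 * x).
have e : x * (x * x)^-1 = (x * x)^-1 * x.
  apply: (mulrI h); apply: (mulIr h).
  by rewrite -!mulrA mulVr // mulr1 !mulrA mulrV // mul1r.
by split; [rewrite -mulrA mulVr|rewrite mulrA e -mulrA mulVr].
Qed.

Lemma ople_inv0 x : sa x -> x \is a GRing.unit -> ople 0 x -> ople 0 x^-1.
Proof.
move=> hx ux h xi; have hi := sa_inv hx ux.
rewrite -[x^-1]mul1r -(mulVr ux) qf_conjs // qf0.
by have := h (op x^-1 xi); rewrite qf0.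
Qed.

Lemma nrm_powB x y N c : (forall n, (n <= N)%N -> nrm (y ^+ n) <= c) -> nrm x <= 1 ->
  nrm (x ^+ N - y ^+ N) <= N%:R * (c * nrm (x - y)).
Proof.
move=> h x1; have c0 : 0 <= c := le_trans (nrm_ge0 _) (h 0 (leq0n N)).
elim: N h => [|N ih] h; first by rewrite !expr0 subrr nrm0 mul0r.
rewrite (_ : _ - _ = x * (x ^+ N - y ^+ N) + (x - y) * y ^+ N); last first.
  by rewrite mulrBr mulrBl -!exprS addrA subrK.
rewrite (le_trans (nrmD _ _)) // -natr1 [leRHS]mulrDl mul1r lerD //.
  rewrite -[leRHS]mul1r nrmM_le //; apply: ih => n nN; apply: h; exact: leqW.
by rewrite mulrC nrmM_le // h.
Qed.

Definition pos_sqrt x : A := xget 0 [set s : A | [/\ sa s, ople 0 s & s * s = x]].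

Lemma pos_sqrtP x : sa x -> ople 0 x ->
  [/\ sa (pos_sqrt x), ople 0 (pos_sqrt x) & pos_sqrt x * pos_sqrt x = x].
Proof.
move=> hx h; have [s hs] := sqrt_exists hx h.
by apply: (@xgetPex A 0 [set s : A | [/\ sa s, ople 0 s & s * s = x]]); exists s.
Qed.

Section LogConstruction.
Variable q : A.
Hypotheses (hq : sa q) (q0 : ople 0 q) (q1 : ople q 1) (uq : q \is a GRing.unit).

(** The dyadic roots q^(1/2^k). *)
Let qk k := iter k pos_sqrt q.

Lemma qkP k : [/\ sa (qk k), ople 0 (qk k), ople (qk k) 1 & qk k \is a GRing.unit].
Proof.
elim: k => [|k [h1 h2 h3 h4]] //=; rewrite -/(qk k).
have [k1 k2 k3] := pos_sqrtP h1 h2; split => //; last by apply: unit_sq; rewrite k3.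
have : nrm (pos_sqrt (qk k)) ^+ 2 <= 1.
  rewrite -nrm_sa_sq // k3; apply: nrm_ople => //; last by rewrite scale1C.
  by apply: ople_trans h2; rewrite -[X in ople _ X](scale0r 1); exact: ople_scalar.
rewrite expr_le1 ?nrm_ge0 // => h; apply: ople_trans (ople_nrm _) _.
by rewrite -[X in ople _ X]scale1C; exact: ople_scalar.
Qed.

Lemma qk_sq k : qk k.+1 * qk k.+1 = qk k.
Proof. by have [h1 h2 h3 h4] := qkP k; have [] := pos_sqrtP h1 h2. Qed.

(** Both sequences should converge to log q, the first from above and the second
    from below; their monotonicity bounds y_k in norm. *)
Let yk k : A := (2 ^+ k : R)%:C *: (qk k - 1).
Let zk k : A := (2 ^+ k : R)%:C *: (1 - (qk k)^-1).

Lemma yk_sa k : sa (yk k).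
Proof. by have [h _ _ _] := qkP k; apply/saZ/saB => //; exact: sa1. Qed.

(** With p = q^(1/2^(k+1)), up to the factor 2^k, this is
    (p^2 - 1) - 2 (p - 1) = (p - 1)^2. *)
Lemma yk_step k : yk k - yk k.+1 = (2 ^+ k : R)%:C *: ((qk k.+1 - 1) * (qk k.+1 - 1)).
Proof.
rewrite /yk -(qk_sq k) exprS; set p := qk k.+1.
rewrite !(mulrBl, mulrBr) !mulr1 !mul1r.
by apply: mel_inj => xi eta; rewrite !melE; ring.
Qed.

Lemma zk_step k : zk k.+1 - zk k =
  (2 ^+ k : R)%:C *: ((1 - (qk k.+1)^-1) * (1 - (qk k.+1)^-1)).
Proof.
have [_ _ _ up] := qkP k.+1.
rewrite /zk -(qk_sq k) exprS invrM //; set p := (qk k.+1)^-1.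
rewrite !(mulrBl, mulrBr) !mulr1 !mul1r.
by apply: mel_inj => xi eta; rewrite !melE; ring.
Qed.

Lemma yk_sub_zk k : yk k - zk k = (2 ^+ k : R)%:C *: ((qk k - 1) * (qk k)^-1 * (qk k - 1)).
Proof.
have [_ _ _ up] := qkP k.
rewrite /yk /zk !(mulrBl, mulrBr, mulr1, mul1r) mulVr // mulrV // mul1r.
by apply: mel_inj => xi eta; rewrite !melE; ring.
Qed.

Lemma yk_bounded : exists c, 0 <= c /\ forall k, nrm (yk k) <= c.
Proof.
pose c := Num.max (nrm (yk 0)) (nrm (zk 0)).
have c0 : 0 <= c by rewrite le_max nrm_ge0.
exists c; split=> // k; apply: nrm_ople => //; first exact: yk_sa.
  apply: (@ople_trans _ _ _ (zk k)); last first.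
    apply/ople_subr; rewrite yk_sub_zk => xi.
    have [h1 h2 h3 h4] := qkP k.
    rewrite qfZ qf0 mulr_ge0 ?exprn_ge0 // qf_conjs; last by apply: saB => //; exact: sa1.
    by have := ople_inv0 h1 h4 h2 (op (qk k - 1) xi); rewrite qf0.
  apply: (@ople_trans _ _ _ (zk 0)).
    apply: ople_trans (ople_nrmN (zk 0)); apply: ople_scalar.
    by rewrite lerN2 le_max lexx orbT.
  elim: k => [|k ih]; first exact: ople_refl.
  apply: ople_trans ih _; apply/ople_subr; rewrite zk_step => xi.
  have [h1 h2 h3 h4] := qkP k.+1.
  rewrite qfZ qf0 mulr_ge0 ?exprn_ge0 //.
  have hs : sa (1 - (qk k.+1)^-1) by apply: saB; [exact: sa1|exact: sa_inv].
  by have := ople_sq hs xi; rewrite qf0.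
apply: (@ople_trans _ _ _ (yk 0)); last first.
  by apply: ople_trans (ople_nrm (yk 0)) _; apply: ople_scalar; rewrite le_max lexx.
elim: k => [|k ih]; first exact: ople_refl.
apply: ople_trans _ ih; apply/ople_subr; rewrite yk_step => xi.
have [h1 h2 h3 h4] := qkP k.+1.
rewrite qfZ qf0 mulr_ge0 ?exprn_ge0 //.
by have := ople_sq (saB h1 (sa1 A)) xi; rewrite qf0.
Qed.

Lemma pow2K k : (2 : R) ^+ k * 2^-1 ^+ k = 1.
Proof. by rewrite -exprMn divff ?expr1n // pnatr_eq0. Qed.

(** As q^(1/2^k) = 1 + y_k / 2^k with y_k bounded, the increments of y_k are
    O(2^-k) by [yk_step], and y_k converges to some y.  Then q^(1/2^k) and
    e^(y/2^k) differ by O(4^-k), and taking the power 2^k of both multiplies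
    the difference by O(2^k) only. *)
Lemma log_small : exists y, sa y /\ op_exp y = q.
Proof.
have [c [c0 hc]] := yk_bounded.
have qkE k : qk k = 1 + (2^-1 ^+ k : R)%:C *: yk k.
  by rewrite /yk scalerC mulrC pow2K scale1C subrKC.
have step k : nrm (yk k.+1 - yk k) <= c ^+ 2 * 2^-1 ^+ k - c ^+ 2 * 2^-1 ^+ k.+1.
  rewrite nrm_distC yk_step qkE (addrC 1) addrK -scalerAl -scalerAr !scalerC nrmZ.
  have -> : 2 ^+ k * 2^-1 ^+ k.+1 * 2^-1 ^+ k.+1 = 2^-1 ^+ k * 4^-1 :> R.
    transitivity (2 ^+ k * 2^-1 ^+ k * 2^-1 ^+ k * 4^-1 : R); last by rewrite pow2K mul1r.
    by rewrite exprS; field.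
  have p0 : 0 <= (2^-1 : R) ^+ k by rewrite exprn_ge0 ?invr_ge0.
  rewrite ger0_norm ?mulr_ge0 ?invr_ge0 //.
  apply: (@le_trans _ _ (2^-1 ^+ k / 4 * (c * c))).
    by rewrite ler_wpM2l ?mulr_ge0 ?invr_ge0 // nrmM_le.
  rewrite (exprS 2^-1 k) -subr_ge0 (_ : _ - _ = 2^-1 ^+ k * c ^+ 2 / 4); last by field.
  by rewrite divr_ge0 ?mulr_ge0 ?exprn_ge0.
have c20 : 0 <= c ^+ 2 by rewrite exprn_ge0.
have [|y [hy yb]] := telescoping_tends _ (null_seq_pow2 c20) step.
  by move=> n; rewrite mulr_ge0 ?exprn_ge0 ?invr_ge0.
have say : sa y := tends_sa yk_sa hy.
exists y; split=> //.
pose C := expR (nrm y) * (c ^+ 2 + nrm y ^+ 2 * expR (nrm y)).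
have C0 : 0 <= C by rewrite mulr_ge0 ?expR_ge0 // addr_ge0 // mulr_ge0 ?expR_ge0 ?exprn_ge0 ?nrm_ge0.
apply: (@tends_uniq _ _ (fun=> op_exp y)); first exact: tends_cst.
apply: tends_le_nrm (null_seq_pow2 C0) => k.
have qp : qk k ^+ (2 ^ k) = q.
  by elim: k => [|k ih]; [rewrite expr1|rewrite expnS exprM expr2 qk_sq].
(* q and e^y are compared through their roots of order 2^k, which are close *)
have ep : op_exp ((2^-1 ^+ k : R)%:C *: y) ^+ (2 ^ k) = op_exp y.
  by rewrite -exp_natZ scalerC natrX pow2K scale1C.
have p0 : 0 <= (2^-1 : R) ^+ k by rewrite exprn_ge0 ?invr_ge0.
have [h1 h2 h3 h4] := qkP k.
rewrite nrm_distC -{1}qp -ep.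
have /nrm_powB : forall n, (n <= 2 ^ k)%N ->
    nrm (op_exp ((2^-1 ^+ k : R)%:C *: y) ^+ n) <= expR (nrm y).
  move=> n nk; rewrite -exp_natZ scalerC (le_trans (nrm_exp _)) // ler_expR nrmZ.
  rewrite ler_piMl ?nrm_ge0 // ger0_norm ?mulr_ge0 //.
  by rewrite -[leRHS](pow2K k) ler_wpM2r // -natrX ler_nat.
move=> /(_ (qk k)) h; apply: (le_trans (h _)).
  apply: nrm_ople => //; last by rewrite scale1C.
  by apply: ople_trans h2; rewrite -[X in ople _ X](scale0r 1); exact: ople_scalar.
have d : nrm (qk k - op_exp ((2^-1 ^+ k : R)%:C *: y)) <=
    2^-1 ^+ k * (c ^+ 2 * 2^-1 ^+ k) + (2^-1 ^+ k * nrm y) ^+ 2 * expR (nrm y).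
  rewrite (_ : _ - _ = (2^-1 ^+ k : R)%:C *: (yk k - y) -
     (op_exp ((2^-1 ^+ k : R)%:C *: y) - 1 - (2^-1 ^+ k : R)%:C *: y)); last first.
    by rewrite qkE; apply: mel_inj => xi eta; rewrite !melE; ring.
  rewrite (le_trans (nrmB _ _)) // lerD //.
    by rewrite nrmZ ger0_norm // ler_wpM2l // nrm_distC.
  rewrite (le_trans (nrm_exp_rem _)) // nrmZ ger0_norm //.
  rewrite ler_wpM2l ?exprn_ge0 ?mulr_ge0 ?nrm_ge0 // ler_expR ler_piMl ?nrm_ge0 //.
  by rewrite exprn_ile1 ?invr_ge0 ?invf_le1 ?ler1n.
rewrite natrX; apply: (@le_trans _ _ (2 ^+ k * (expR (nrm y) *
   (2^-1 ^+ k * (c ^+ 2 * 2^-1 ^+ k) + (2^-1 ^+ k * nrm y) ^+ 2 * expR (nrm y))))).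
  by rewrite ler_wpM2l ?exprn_ge0 // ler_wpM2l ?expR_ge0.
rewrite [leLHS](_ : _ = (2 ^+ k * 2^-1 ^+ k) * (C * 2^-1 ^+ k)); last by rewrite /C; ring.
by rewrite pow2K mul1r.
Qed.
End LogConstruction.

Lemma log_exists q : sa q -> ople 0 q -> q \is a GRing.unit ->
  exists y, sa y /\ op_exp y = q.
Proof.
move=> hq q0 uq; pose c := nrm q + 1.
have c0 : 0 < c by rewrite ltr_wpDl ?nrm_ge0.
have [||||y [hy ey]] := @log_small (c^-1%:C *: q).
- exact: saZ.
- by move=> xi; rewrite qfZ qf0 mulr_ge0 ?invr_ge0 ?(ltW c0) //; have := q0 xi; rewrite qf0.
- move=> xi; rewrite qfZ qf1 mulrC ler_pdivrMr // mulrC.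
  apply: le_trans (ople_nrm q xi) _; rewrite qfZ qf1.
  by rewrite ler_wpM2r ?rdot_ge0 // lerDl.
- apply/unitrP; exists (c%:C *: q^-1).
  rewrite -!scalerAl -!scalerAr !scalerC (mulVr uq) (mulrV uq).
  by rewrite (mulrC c^-1) divff ?gt_eqF // !scale1C.
exists ((ln c : R)%:C *: 1 + y); split; first by apply: saD => //; exact/saZ/sa1.
by rewrite exp_addscalar lnK ?posrE // ey scalerC divff ?gt_eqF // scale1C.
Qed.

Lemma unit_star g : g \is a GRing.unit -> star g \is a GRing.unit.
Proof.
move=> ug; apply/unitrP; exists (star g^-1).
by rewrite -!starM mulrV // mulVr // star1.
Qed.

Lemma star_inv g : g \is a GRing.unit -> star g^-1 = (star g)^-1.
Proof.
move=> ug; apply: (mulrI (unit_star ug)).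
by rewrite mulrV ?unit_star // -starM mulVr // star1.
Qed.

Lemma log_gram g : g \is a GRing.unit -> exists y, sa y /\ op_exp y = star g * g.
Proof.
move=> ug; apply: log_exists; [exact: sa_starM|exact: ople_starM|].
by rewrite unitrMl ?unit_star.
Qed.

End Log.

(** * The trace and its L2 norm *)

Section TraceInnerProduct.
Variables (R : realType) (A : vonNeumannAlgebra R) (tau : A -> R[i]).
Implicit Types g x y : A.

Definition trace_re x : R := complex.Re (tau x).
Definition l2_dot x y : R := trace_re (star x * y).
Definition l2_norm x : R := Num.sqrt (l2_dot x x).

(** Twice the L2 norm of log |g|. *)
Definition log_length g : R := l2_norm (op_ln (star g * g)).

(** With a = e^x and b = e^y this is the L2 norm of log (a^(-1/2) b a^(-1/2)),
    the length of the geodesic from a to b. *)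
Definition exp_dist x y : R :=
  log_length (op_exp ((2^-1 : R)%:C%C *: y) * op_exp (- ((2^-1 : R)%:C%C *: x))).

End TraceInnerProduct.

Section Trace.
Variables (R : realType) (A : vonNeumannAlgebra R) (tau : {scalar A}).
Hypothesis htau : normal_faithful_tracial_state tau.
Local Open Scope complex_scope.
Local Notation tr := (trace_re tau).
Local Notation ip := (l2_dot tau).
Local Notation n2 := (l2_norm tau).
Implicit Types (a b g k u v x y z w : A) (s t c e : R).

Lemma trD x y : tr (x + y) = tr x + tr y.
Proof. by rewrite /trace_re linearD raddfD. Qed.
Lemma trN x : tr (- x) = - tr x.
Proof. by rewrite /trace_re linearN raddfN. Qed.
Lemma trB x y : tr (x - y) = tr x - tr y.
Proof. by rewrite trD trN. Qed.
Lemma trZ t x : tr (t%:C *: x) = t * tr x.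
Proof. by rewrite /trace_re linearZ /= Re_realM. Qed.
Lemma tr0 : tr 0 = 0.
Proof. by rewrite -(subrr 0) trB subrr. Qed.
Lemma tr1 : tr 1 = 1.
Proof. by rewrite /trace_re (tau_unit htau). Qed.
Lemma trC x y : tr (x * y) = tr (y * x).
Proof. by rewrite /trace_re (tau_tracial htau). Qed.
Lemma tr_sum (n : nat) (F : 'I_n -> A) : tr (\sum_(i < n) F i) = \sum_(i < n) tr (F i).
Proof. by elim/big_rec2: _ => [|i p q _ <-]; [exact: tr0|exact: trD]. Qed.

(** Positive elements have real trace, and nrm x - x is positive. *)
Lemma tau_real x : sa x -> complex.Im (tau x) = 0.
Proof.
have pos y : sa y -> ople 0 y -> complex.Im (tau y) = 0.
  move=> hy /(positiveP hy)[b ->]; exact: ger0_Im (tau_pos htau b).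
move=> hx.
have e : complex.Im (tau ((nrm x)%:C *: 1 - x)) = 0.
  apply: pos; first by apply: saB => //; exact/saZ/sa1.
  by apply/ople_subr; exact: ople_nrm.
move: e; rewrite linearB linearZ /= (tau_unit htau) mulr1 raddfB /=.
by rewrite sub0r => /eqP; rewrite oppr_eq0 => /eqP.
Qed.

Lemma tau_sa x : sa x -> tau x = (tr x)%:C.
Proof.
by move=> hx; rewrite /trace_re; have := tau_real hx; case: (tau x) => p q /= ->.
Qed.

Lemma tr_ge0 x : sa x -> ople 0 x -> 0 <= tr x.
Proof.
move=> hx h; rewrite -ler0c -tau_sa //.
by have [b ->] := positiveP hx h; exact: tau_pos htau b.
Qed.

Lemma tr_le x y : sa x -> sa y -> ople x y -> tr x <= tr y.
Proof.
by move=> hx hy /ople_subr h; rewrite -subr_ge0 -trB tr_ge0 //; exact: saB.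
Qed.

Lemma starZc (c : R[i]) x : star (c *: x) = Num.conj c *: star x.
Proof.
apply: star_inj => xi eta; rewrite vn_adjr !opZ linearZl_LR linearZr_LR /=.
by rewrite vn_adjr.
Qed.

(** The element i (x - star x) is selfadjoint, so its trace is real. *)
Lemma tr_star x : tr (star x) = tr x.
Proof.
have hs : sa ('i *: (x - star x)).
  rewrite /sa starZc starB starK -[LHS]opprK -scalerN opprB -scaleNr.
  by congr (_ *: _); apply/eqP; rewrite eq_complex /= oppr0 opprK !eqxx.
have := tau_real hs; rewrite linearZ /= linearB /trace_re.
case: (tau x) => a1 a2; case: (tau (star x)) => b1 b2 /=.
by rewrite mul0r add0r mul1r => /eqP; rewrite subr_eq0 => /eqP.
Qed.

Lemma tr_le_nrm_sa x : sa x -> `|tr x| <= nrm x.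
Proof.
move=> hx; rewrite ler_norml; apply/andP; split.
  have := tr_le (saZ (- nrm x) (sa1 A)) hx (@ople_nrmN _ _ x).
  by rewrite trZ tr1 mulr1.
have := tr_le hx (saZ (nrm x) (sa1 A)) (@ople_nrm _ _ x).
by rewrite trZ tr1 mulr1.
Qed.

Lemma tr_le_nrm x : `|tr x| <= nrm x.
Proof.
have hs : sa (x + star x) by rewrite /sa starD starK addrC.
have := tr_le_nrm_sa hs; rewrite trD tr_star.
have := nrmD x (star x); rewrite nrm_star => h1 h2.
have : `|tr x + tr x| <= nrm x + nrm x by exact: le_trans h2 h1.
by rewrite -mulr2n normrMn -mulr2n lerMn2r.
Qed.

Lemma tends_tr (f : nat -> A) l : tends f l -> null_seq (fun n => `|tr (f n) - tr l|).
Proof. by apply: null_seq_le => n; rewrite -trB tr_le_nrm. Qed.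

Lemma tends_tr_le (f : nat -> A) l c : tends f l -> (forall n, tr (f n) <= c) -> tr l <= c.
Proof.
move=> h k; rewrite -subr_le0; apply: (null_seq_bound (tends_tr h)) => n.
by have := k n; have := ler_norm (tr l - tr (f n)); rewrite distrC; lra.
Qed.

Lemma ipC x y : ip x y = ip y x.
Proof. by rewrite /l2_dot -tr_star starM starK. Qed.
Lemma ipDl x y z : ip (x + y) z = ip x z + ip y z.
Proof. by rewrite /l2_dot starD mulrDl trD. Qed.
Lemma ipNl x z : ip (- x) z = - ip x z.
Proof. by rewrite /l2_dot starN mulNr trN. Qed.
Lemma ipZl t x z : ip (t%:C *: x) z = t * ip x z.
Proof. by rewrite /l2_dot starZ -scalerAl trZ. Qed.
Lemma ipDr x y z : ip z (x + y) = ip z x + ip z y.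
Proof. by rewrite !(ipC z) ipDl. Qed.
Lemma ipNr x z : ip z (- x) = - ip z x.
Proof. by rewrite !(ipC z) ipNl. Qed.
Lemma ipZr t x z : ip z (t%:C *: x) = t * ip z x.
Proof. by rewrite !(ipC z) ipZl. Qed.
Definition ipE := (ipDl, ipNl, ipZl, ipDr, ipNr, ipZr).
Lemma ip_ge0 x : 0 <= ip x x.
Proof. by apply: tr_ge0; [exact: sa_starM|exact: ople_starM]. Qed.
Lemma ip_sa x y : sa x -> ip x y = tr (x * y).
Proof. by move=> hx; rewrite /l2_dot hx. Qed.
Lemma ip_eq0 x : ip x x = 0 -> x = 0.
Proof.
move=> h; apply: (tau_faithful htau); rewrite tau_sa; last exact: sa_starM.
by rewrite -/(ip x x) h.
Qed.
Lemma n2_ge0 x : 0 <= n2 x. Proof. exact: sqrtr_ge0. Qed.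
Lemma n2_sqr x : n2 x ^+ 2 = ip x x.
Proof. by rewrite sqr_sqrtr // ip_ge0. Qed.
Lemma n2_0 : n2 0 = 0.
Proof. by rewrite /l2_norm /l2_dot mulr0 tr0 sqrtr0. Qed.
Lemma n2_le x c : 0 <= c -> ip x x <= c ^+ 2 -> n2 x <= c.
Proof. by move=> c0 h; apply: sqr_le_le => //; rewrite n2_sqr. Qed.

Lemma ip_CS x y : ip x y <= n2 x * n2 y.
Proof.
apply: sqr_le_le; first by rewrite mulr_ge0 ?n2_ge0.
rewrite exprMn !n2_sqr.
have [/ip_eq0 ->|e0] := eqVneq (ip y y) 0.
  by rewrite /l2_dot mulr0 tr0 expr0n mulr_ge0 ?ip_ge0 // star0 mul0r tr0.
have {}e0 : 0 < ip y y by rewrite lt_neqAle eq_sym e0 ip_ge0.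
have := ip_ge0 ((ip y y)%:C *: x - (ip x y)%:C *: y); rewrite !ipE (ipC y x).
set p := ip x x; set q := ip y y in e0 *; set r := ip x y.
move=> h; have {h} : 0 <= q * (p * q - r ^+ 2) by lra.
by rewrite pmulr_rge0 // subr_ge0.
Qed.

Lemma n2D x y : n2 (x + y) <= n2 x + n2 y.
Proof.
apply: n2_le; first by rewrite addr_ge0 ?n2_ge0.
rewrite !ipE (ipC y x) -!n2_sqr; have := ip_CS x y; lra.
Qed.
Lemma n2Z t x : n2 (t%:C *: x) = `|t| * n2 x.
Proof. by rewrite /l2_norm !ipE mulrA -expr2 sqrtrM ?sqr_ge0 // sqrtr_sqr. Qed.
Lemma n2N x : n2 (- x) = n2 x.
Proof. by rewrite /l2_norm !ipE opprK. Qed.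
Lemma n2_distC x y : n2 (x - y) = n2 (y - x).
Proof. by rewrite -n2N opprB. Qed.
Lemma n2_dist x y z : n2 (x - z) <= n2 (x - y) + n2 (y - z).
Proof. by rewrite (le_trans _ (n2D _ _))// addrA subrK. Qed.
Lemma n2_star x : n2 (star x) = n2 x.
Proof. by rewrite /l2_norm /l2_dot starK trC. Qed.
Lemma n2Ml x y : n2 (x * y) <= nrm x * n2 y.
Proof.
apply: n2_le; first by rewrite mulr_ge0 ?n2_ge0 ?nrm_ge0.
rewrite exprMn n2_sqr /l2_dot starM -mulrA (mulrA (star x)) mulrA.
have := tr_le (sa_conj y (sa_starM x)) (sa_conj y (saZ (nrm (star x * x)) (sa1 A)))
  (ople_conj y (ople_nrm _)).
by rewrite -scalerAr mulr1 -scalerAl trZ nrm_starM.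
Qed.
Lemma n2Mr x y : n2 (x * y) <= n2 x * nrm y.
Proof. by rewrite -n2_star starM (le_trans (n2Ml _ _)) // nrm_star n2_star mulrC. Qed.
Lemma n2_le_nrm x : n2 x <= nrm x.
Proof.
rewrite -{1}[x]mulr1 (le_trans (n2Ml _ _)) // ler_piMr ?nrm_ge0 //.
by rewrite (_ : n2 1 = 1) // /l2_norm /l2_dot star1 mul1r tr1 sqrtr1.
Qed.

End Trace.

(** * First variation of the L2 norm of a logarithm *)

Section SecondOrder.
Variables (R : realType) (A : vonNeumannAlgebra R) (tau : {scalar A}).
Hypothesis htau : normal_faithful_tracial_state tau.
Local Open Scope complex_scope.
Local Notation tr := (trace_re tau).
Local Notation n2 := (l2_norm tau).
Implicit Types (a b g h k u v x y z w d : A) (s t c e : R).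

Lemma n2_conj v x : v * star v = 1 -> n2 (star v * x * v) = n2 x.
Proof.
move=> vv; rewrite /l2_norm /l2_dot !starM starK.
have -> : star v * (star x * v) * (star v * x * v) = star v * (star x * x) * v.
  by rewrite !mulrA -(mulrA _ v (star v)) vv mulr1.
by rewrite (trC htau) mulrA vv mul1r.
Qed.

(** The terms of (u + d)^n of degree 1 in d, and then those of higher degree,
    for elements that need not commute. *)
Fixpoint pow_lin u d n : A :=
  if n is n'.+1 then pow_lin u d n' * u + u ^+ n' * d else 0.

Fixpoint pow_rem u d n : A :=
  if n is n'.+1 then pow_lin u d n' * d + pow_rem u d n' * (u + d) else 0.

Lemma pow_expand u d n : (u + d) ^+ n = u ^+ n + pow_lin u d n + pow_rem u d n.
Proof.
elim: n => [|n ih] /=; first by rewrite !expr0 !addr0.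
rewrite exprSr ih mulrDl (mulrDr (u ^+ n + _)) !(mulrDl (u ^+ n)) -exprSr.
by apply: mel_inj => xi eta; rewrite !melE; ring.
Qed.

Lemma nrm_pow_lin u d n c : 1 <= c -> nrm u <= c ->
  nrm (pow_lin u d n) <= n%:R * c ^+ n * nrm d.
Proof.
move=> c1 uc; have c0 : 0 <= c by lra.
elim: n => [|n ih] /=; first by rewrite nrm0 !mul0r.
have h1 : nrm (pow_lin u d n * u) <= n%:R * c ^+ n * nrm d * c by exact: nrmM_le.
have h2 : nrm (u ^+ n * d) <= c ^+ n * c * nrm d.
  rewrite nrmM_le // (le_trans (nrmX _ _)) //.
  apply: (@le_trans _ _ (c ^+ n)); first by rewrite lerXn2r ?nnegrE ?nrm_ge0.
  by rewrite ler_peMr ?exprn_ge0.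
rewrite (le_trans (nrmD _ _)) // (le_trans (lerD h1 h2)) //.
by rewrite -(natr1 n) (exprSr c n) [leLHS](_ : _ = (n%:R + 1) * (c ^+ n * c) * nrm d) //; ring.
Qed.

Lemma nrm_pow_rem u d n c : 1 <= c -> nrm u + nrm d <= c ->
  nrm (pow_rem u d n) <= n%:R ^+ 2 * c ^+ n * nrm d ^+ 2.
Proof.
move=> c1 uc; have c0 : 0 <= c by lra.
have uc' : nrm u <= c by rewrite (le_trans _ uc) // lerDl nrm_ge0.
elim: n => [|n ih] /=; first by rewrite nrm0 expr0n !mul0r.
have h1 : nrm (pow_lin u d n * d) <= n%:R * c ^+ n * nrm d * nrm d.
  by rewrite nrmM_le // nrm_pow_lin.
have h2 : nrm (pow_rem u d n * (u + d)) <= n%:R ^+ 2 * c ^+ n * nrm d ^+ 2 * c.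
  by rewrite nrmM_le // (le_trans (nrmD _ _)).
rewrite (le_trans (nrmD _ _)) // (le_trans (lerD h1 h2)) //.
set D := nrm d; have D0 : 0 <= D := nrm_ge0 d; clearbody D.
rewrite -(natr1 n); have := ler0n R n; move: (n%:R : R) => m m0.
rewrite (exprSr c n); have := exprn_ge0 n c0; move: (c ^+ n) => p p0 {h1 h2 ih}.
rewrite -subr_ge0 (_ : _ - _ = (m * p * D ^+ 2) * (c - 1) + (m + 1) * p * D ^+ 2 * c); last by ring.
have c10 : 0 <= c - 1 by lra.
have m10 : 0 <= m + 1 by lra.
by rewrite addr_ge0 ?(mulr_ge0, exprn_ge0).
Qed.

(** Each monomial is u^i d u^j; as g commutes with u, cyclicity of the trace
    brings all n + 1 of them to the form g u^n d. *)
Lemma tr_pow_lin g u d n : g * u = u * g ->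
  tr (g * pow_lin u d n.+1) = n.+1%:R * tr (g * u ^+ n * d).
Proof.
elim: n g => [|n ih] g gu.
  by rewrite /= mul0r add0r expr0 mul1r mulr1 mul1r.
rewrite [pow_lin _ _ n.+2]/= -/(pow_lin u d n.+1) mulrDr trD.
rewrite mulrA (trC htau) mulrA -gu ih; last by rewrite mulrA gu.
by rewrite -(mulrA g u) -exprS mulrA -(natr1 n.+1) mulrDl mul1r.
Qed.

Lemma sqr_le_4X n : (n%:R : R) ^+ 2 <= 4 ^+ n.
Proof.
rewrite (_ : 4 = 2 ^+ 2 :> R); last by rewrite -natrX.
rewrite -exprM mulnC exprM lerXn2r ?nnegrE ?exprn_ge0 // -natrX ler_nat.
exact/ltnW/ltn_expl.
Qed.

(** The differential of the exponential at u is not a multiplication, but it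
    becomes one under the trace, against an element commuting with u.  The
    error is quadratic in d, with a constant depending only on a bound for
    the norms. *)
Lemma tr_exp_expand g u d c : g * u = u * g -> 1 <= c -> nrm u + nrm d <= c ->
  tr (g * op_exp u * d) - tr (g * (op_exp (u + d) - op_exp u)) <=
  nrm g * (nrm d ^+ 2 * expR (4 * c)).
Proof.
move=> gu c1 uc; have c0 : 0 <= c by lra.
rewrite -trB.
have h1 := tendsMr d (tendsMl g (epart_exp u)).
have h2 := tendsMl g (tendsB (tends_sub (f := S) (fun n => leqnSn n) (epart_exp (u + d)))
  (tends_sub (f := S) (fun n => leqnSn n) (epart_exp u))).
apply: (tends_tr_le htau (tendsB h1 h2)) => n.
have -> : epart (u + d) n.+1 - epart u n.+1 =
    \sum_(k < n.+1) (k`!%:R^-1 : R[i]) *: (pow_lin u d k + pow_rem u d k).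
  rewrite /epart -sumrB; apply: eq_bigr => k _.
  by rewrite -scalerBr pow_expand -[u ^+ k + _ + _]addrA [u ^+ k + _]addrC addrK.
have -> : \sum_(k < n.+1) (k`!%:R^-1 : R[i]) *: (pow_lin u d k + pow_rem u d k) =
  \sum_(k < n.+1) (k`!%:R^-1 : R[i]) *: pow_lin u d k +
  \sum_(k < n.+1) (k`!%:R^-1 : R[i]) *: pow_rem u d k.
  by rewrite -big_split; apply: eq_bigr => k _; rewrite scalerDr.
rewrite mulrDr opprD addrA trB.
have -> : tr (g * epart u n * d - g * (\sum_(k < n.+1) (k`!%:R^-1 : R[i]) *: pow_lin u d k)) = 0.
  rewrite trB /epart mulr_sumr mulr_suml [X in _ - tr X]mulr_sumr !tr_sum.
  rewrite [X in _ - X]big_ord_recl /= scaler0 mulr0 tr0 add0r -sumrB big1 // => k _.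
  rewrite !natVC -!scalerAr -scalerAl !trZ /bump /= add1n -/(pow_lin u d k.+1).
  rewrite tr_pow_lin // factS natrM invfM.
  by rewrite [X in _ - X]mulrACA mulVf ?pnatr_eq0 // mul1r subrr.
rewrite sub0r -trN (le_trans (ler_norm _)) // (le_trans (tr_le_nrm htau _)) // nrmN.
apply: nrmM_le => //.
apply: (@le_trans _ _ (nrm d ^+ 2 * exp_psum (4 * c) n.+1)); last first.
  by rewrite ler_wpM2l ?exprn_ge0 ?nrm_ge0 // exp_psum_le // mulr_ge0.
rewrite (le_trans (nrm_sum _ _ _)) // mulr_sumr; apply: ler_sum => k _.
rewrite natVC nrmZ ger0_norm ?invr_ge0 // mulrCA ler_wpM2l ?invr_ge0 //.
rewrite (le_trans (nrm_pow_rem _ c1 uc)) // mulrC ler_wpM2l ?exprn_ge0 ?nrm_ge0 //.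
by rewrite exprMn ler_wpM2r ?exprn_ge0 // sqr_le_4X.
Qed.

Lemma expRN2_le c : 0 <= c <= 2^-1 -> expR (- (2 * c)) <= 1 - c.
Proof.
move=> /andP[c0 c1]; rewrite expRN.
have h : 1 + 2 * c <= expR (2 * c) := expR_ge1Dx (2 * c).
have h0 : 0 < 1 + 2 * c by lra.
apply: (@le_trans _ _ (1 + 2 * c)^-1); first by rewrite lef_pV2 ?posrE ?expR_gt0.
by rewrite -(ler_pM2l h0) divff ?gt_eqF //; nra.
Qed.

(** With eta = nrm (k - 1), the bounds e^(-2 eta) <= k <= e^eta and
    monotonicity of the logarithm give u - 2 eta <= u' <= u + eta: the
    logarithm is controlled without inverting the differential of the
    exponential. *)
Lemma log_perturb u k u' :
  sa u -> sa k -> sa u' -> nrm (k - 1) <= 2^-1 ->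
  op_exp u' = op_exp ((2^-1 : R)%:C *: u) * k * op_exp ((2^-1 : R)%:C *: u) ->
  nrm (u' - u) <= 2 * nrm (k - 1).
Proof.
move=> hu hk hu' k1 e; set eta := nrm (k - 1) in k1 *.
have eta0 : 0 <= eta := nrm_ge0 _.
have hv : sa (op_exp ((2^-1 : R)%:C *: u)) by apply/sa_exp/saZ.
have qk xi : `|qf k xi - rdot xi xi| <= eta * rdot xi xi.
  by have := qf_le_nrm (k - 1) xi; rewrite qfD qfN qf1.
have up : ople u' (eta%:C *: 1 + u).
  apply: exp_mono_inv => //; first by apply: saD => //; exact/saZ/sa1.
  rewrite e exp_addscalar (exp_half u).
  have kle : ople k ((expR eta : R)%:C *: 1).
    move=> xi; rewrite qfZ qf1; have := qk xi; have := expR_ge1Dx eta.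
    have := rdot_ge0 xi; rewrite ler_norml => r0 e1 /andP[_ h]; nra.
  by have := ople_conjs hv kle; rewrite -scalerAr mulr1 -scalerAl.
have lo : ople ((- (2 * eta) : R)%:C *: 1 + u) u'.
  apply: exp_mono_inv => //; first by apply: saD => //; exact/saZ/sa1.
  rewrite e exp_addscalar (exp_half u).
  have kle : ople ((expR (- (2 * eta)) : R)%:C *: 1) k.
    move=> xi; rewrite qfZ qf1; have := qk xi.
    have := @expRN2_le eta; rewrite eta0 k1 => /(_ isT).
    have := rdot_ge0 xi; rewrite ler_norml => r0 e1 /andP[h _]; nra.
  by have := ople_conjs hv kle; rewrite -scalerAr mulr1 -scalerAl.
apply: nrm_ople; rewrite ?mulr_ge0 //; first exact: saB.
  by move=> xi; have := lo xi; rewrite !qfD qfN; lra.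
move=> xi; have := up xi; rewrite !qfD qfN !qfZ qf1.
by have := rdot_ge0 xi; nra.
Qed.

(** Put d = u' - u, which is O(nrm (k - 1)) by [log_perturb], so that
    ||u'||^2 = ||u||^2 + 2 tr (u d) + O(d^2).  By [tr_exp_expand] with
    g = u e^-u, tr (u d) is at most tr (g (e^u' - e^u)) up to O(d^2), and
    cyclicity evaluates this last trace as tr (u (k - 1)). *)
Lemma first_variation c : 0 <= c -> exists2 C, 0 <= C & forall u k u',
  sa u -> sa k -> sa u' -> nrm u <= c -> nrm (k - 1) <= 2^-1 ->
  op_exp u' = op_exp ((2^-1 : R)%:C *: u) * k * op_exp ((2^-1 : R)%:C *: u) ->
  n2 u' ^+ 2 <= n2 u ^+ 2 + 2 * tr (u * (k - 1)) + C * nrm (k - 1) ^+ 2.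
Proof.
move=> c0; pose C0 := c * expR c * expR (4 * (c + 1)).
have C00 : 0 <= C0 by rewrite !mulr_ge0 ?expR_ge0.
exists (8 * C0 + 4); first by rewrite addr_ge0 ?mulr_ge0.
move=> u k u' hu hk hu' uc k1 e.
have := log_perturb hu hk hu' k1 e.
have e' : u' = u + (u' - u) by rewrite subrKC.
have hd : sa (u' - u) by exact: saB.
move: (u' - u) e' hd => d e' hd; set eta := nrm (k - 1) in k1 * => d2.
have eta0 : 0 <= eta := nrm_ge0 _.
have ee : op_exp (- u) * op_exp u = 1 := op_expNl u.
(* the factor e^-u cancels the e^u of the differential of the exponential *)
pose g := u * op_exp (- u).
have gu : g * u = u * g.
  by rewrite /g -mulrA -(@comm_exp _ _ u (- u)) // mulNr mulrN.
have gn : nrm g <= c * expR c.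
  by rewrite nrmM_le // (le_trans (nrm_exp _)) // nrmN ler_expR.
have := @tr_exp_expand g u d (c + 1) gu _ _; rewrite lerDr => /(_ c0).
have -> : g * op_exp u * d = u * d by rewrite /g -(mulrA u) ee mulr1.
have -> : tr (g * (op_exp (u + d) - op_exp u)) = tr (u * (k - 1)).
  rewrite -e' e {1}(exp_half u); set v := op_exp ((2^-1 : R)%:C *: u).
  have -> : v * k * v - v * v = v * (k - 1) * v by rewrite mulrBr mulr1 mulrBl.
  have uv : v * u = u * v by apply/esym/comm_exp; rewrite -scalerAl -scalerAr.
  have vev : v * op_exp (- u) * v = 1.
    have -> : - u = (-1 : R)%:C *: u by rewrite scaleNC scale1C.
    by rewrite /v -!op_expZD (_ : _ + _ = 0) ?scale0r ?op_exp0 //; lra.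
  rewrite /g mulrA (trC htau) !mulrA uv -(mulrA u v) -(mulrA u).
  by rewrite vev mulr1.
have -> : n2 u' ^+ 2 = n2 u ^+ 2 + 2 * tr (u * d) + n2 d ^+ 2.
  by rewrite !n2_sqr // e' !ipE // (ipC htau d u) (ip_sa tau d hu); ring.
have d4 : n2 d ^+ 2 <= 4 * eta ^+ 2.
  have h := le_trans (n2_le_nrm htau d) d2.
  rewrite (_ : 4 * eta ^+ 2 = (2 * eta) ^+ 2); last by ring.
  by rewrite lerXn2r ?nnegrE ?n2_ge0 // mulr_ge0.
have rem : nrm g * (nrm d ^+ 2 * expR (4 * (c + 1))) <= 4 * C0 * eta ^+ 2.
  rewrite (_ : 4 * C0 * eta ^+ 2 = c * expR c * ((2 * eta) ^+ 2 * expR (4 * (c + 1)))); last first.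
    by rewrite /C0; ring.
  apply: ler_pM => //; rewrite ?nrm_ge0 ?mulr_ge0 ?exprn_ge0 ?nrm_ge0 ?expR_ge0 //.
  by rewrite ler_wpM2r ?expR_ge0 // lerXn2r ?nnegrE ?nrm_ge0 // mulr_ge0.
have ucd : nrm u + nrm d <= c + 1 by rewrite lerD //; lra.
by move=> /(_ ucd) h; lra.
Qed.

End SecondOrder.

(** * Logarithmic length of invertible elements *)

Section Jets.
Variables (R : realType) (A : vonNeumannAlgebra R).
Local Open Scope complex_scope.
Implicit Types (a b x y : A) (s t c e : R) (p q : R -> A).

(** The curve p leaves 1 with velocity a, with an error of second order in the
    operator norm. *)
Definition jet p a := exists2 C, 0 <= C &
  forall e, 0 <= e <= 1 -> nrm (p e - 1 - e%:C *: a) <= C * e ^+ 2.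

Lemma jet_exp t x : jet (fun e => op_exp ((e * t : R)%:C *: x)) (t%:C *: x).
Proof.
exists ((`|t| * nrm x) ^+ 2 * expR (`|t| * nrm x)).
  by rewrite mulr_ge0 ?exprn_ge0 ?expR_ge0 ?mulr_ge0 ?nrm_ge0.
move=> e /andP[e0 e1]; rewrite scalerC (le_trans (nrm_exp_rem _)) // nrmZ normrM.
rewrite (ger0_norm e0) -(mulrA e); set m := `|t| * nrm x.
have m0 : 0 <= m by rewrite mulr_ge0 ?nrm_ge0.
rewrite [leRHS](_ : _ = (e * m) ^+ 2 * expR m); last by ring.
by rewrite ler_wpM2l ?sqr_ge0 // ler_expR ler_piMl.
Qed.

Lemma jet_near p a : jet p a -> exists2 C, 0 <= C &
  forall e, 0 <= e <= 1 -> nrm (p e - 1) <= C * e.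
Proof.
move=> [C C0 h]; exists (C + nrm a); first by rewrite addr_ge0 ?nrm_ge0.
move=> e e01; have /andP[e0 e1] := e01.
rewrite -(subrK (e%:C *: a) (p e - 1)) (le_trans (nrmD _ _)) // mulrDl lerD //.
  by rewrite (le_trans (h _ e01)) // ler_wpM2l // expr2 ler_piMl.
by rewrite nrmZ ger0_norm // mulrC.
Qed.

Lemma jetM p q a b : jet p a -> jet q b -> jet (fun e => p e * q e) (a + b).
Proof.
move=> hp hq; have [Cp' Cp'0 hp'] := jet_near hp; have [Cq' Cq'0 hq'] := jet_near hq.
have [Cp Cp0 {}hp] := hp; have [Cq Cq0 {}hq] := hq.
exists (Cp' * Cq' + Cp + Cq); first by rewrite !addr_ge0 ?mulr_ge0.
move=> e e01.
rewrite (_ : _ - _ = (p e - 1) * (q e - 1) + (p e - 1 - e%:C *: a) + (q e - 1 - e%:C *: b)).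
  rewrite [leRHS]mulrDl [X in _ <= X + _]mulrDl; do 2!rewrite (le_trans (nrmD _ _)) // lerD ?hp ?hq //.
  by rewrite expr2 mulrACA nrmM_le ?hp' ?hq'.
rewrite !(mulrBl, mulrBr) !mul1r !mulr1.
by apply: mel_inj => xi eta; rewrite !melE; ring.
Qed.
End Jets.

Section LogLength.
Variables (R : realType) (A : vonNeumannAlgebra R) (tau : {scalar A}).
Hypothesis htau : normal_faithful_tracial_state tau.
Local Open Scope complex_scope.
Local Notation tr := (trace_re tau).
Local Notation n2 := (l2_norm tau).
Local Notation L := (log_length tau).
Implicit Types (a b g h k u v x y z w d : A) (s t c e : R).

Lemma ln_gram g : g \is a GRing.unit ->
  sa (op_ln (star g * g)) /\ op_exp (op_ln (star g * g)) = star g * g.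
Proof. by move=> ug; have [y [hy <-]] := log_gram ug; rewrite op_lnK. Qed.

Lemma loglenE g y : sa y -> op_exp y = star g * g -> L g = n2 y.
Proof. by move=> hy e; rewrite /log_length -e op_lnK. Qed.

Lemma loglen_ge0 g : 0 <= L g.
Proof. exact: n2_ge0. Qed.

Lemma loglen_exp x : sa x -> L (op_exp x) = 2 * n2 x.
Proof.
move=> hx; rewrite (@loglenE _ (2%:C *: x)); first by rewrite n2Z // ger0_norm.
  exact: saZ.
by rewrite star_exp hx -[in LHS](_ : 1 + 1 = 2) // op_expZD scale1C.
Qed.

Lemma loglen_unitaryl u g : star u * u = 1 -> L (u * g) = L g.
Proof. by move=> uu; rewrite /log_length starM mulrA -(mulrA (star g)) uu mulr1. Qed.

Lemma loglen_unitaryr v g : g \is a GRing.unit -> star v * v = 1 -> v * star v = 1 ->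
  L (g * v) = L g.
Proof.
move=> ug vv1 vv2; have [hy e] := ln_gram ug.
rewrite (@loglenE _ (star v * op_ln (star g * g) * v)).
- by rewrite n2_conj.
- exact: sa_conj.
- by rewrite exp_conj // e starM !mulrA.
Qed.

(** Polar decomposition of g with the positive factor on the left. *)
Lemma unitary_of g y : sa y -> op_exp y = g * star g ->
  let v := op_exp ((- 2^-1 : R)%:C *: y) * g in
  g = op_exp ((2^-1 : R)%:C *: y) * v /\ v * star v = 1.
Proof.
move=> hy e /=; split.
  by rewrite mulrA -op_expZD addrN scale0r op_exp0 mul1r.
rewrite starM star_exp starZ hy mulrA -(mulrA _ g) -e (exp_half y).
rewrite !mulrA -op_expZD addNr scale0r op_exp0 mul1r -op_expZD.
by rewrite addrN scale0r op_exp0.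
Qed.

Lemma unitary_sym v : v \is a GRing.unit -> v * star v = 1 -> star v * v = 1.
Proof. by move=> uv h; apply: (mulrI uv); rewrite mulrA h mul1r mulr1. Qed.

(** The polar decomposition exhibits star g * g as a unitary conjugate of
    g * star g. *)
Lemma loglen_star g : g \is a GRing.unit -> L (star g) = L g.
Proof.
move=> ug; have [hy e] := ln_gram (unit_star ug); rewrite starK in hy e.
set y := op_ln _ in hy e.
have [eg vv] := unitary_of hy e; set v := _ * g in eg vv.
have uv : v \is a GRing.unit by rewrite unitrMl // exp_unit.
have vv' := unitary_sym uv vv.
rewrite (@loglenE _ y) ?starK // [in RHS]eg loglen_unitaryr ?exp_unit //.
rewrite loglen_exp; last exact: saZ.
by rewrite n2Z // ger0_norm ?invr_ge0 // mulrA divff ?mul1r // pnatr_eq0.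
Qed.

Lemma loglen_inv g : g \is a GRing.unit -> L g^-1 = L g.
Proof.
move=> ug; have [hy e] := ln_gram (unit_star ug); rewrite starK in hy e.
rewrite -(loglen_star ug) (@loglenE (star g) _ hy) ?starK //.
rewrite (@loglenE _ (- op_ln (g * star g))) ?n2N //; first exact: saN.
by rewrite -exp_inv e star_inv // invrM ?unit_star.
Qed.

Lemma loglen1 : L 1 = 0.
Proof. by rewrite (@loglenE _ 0) ?n2_0 // ?op_exp0 ?star1 ?mul1r //; exact: sa0. Qed.

(** From -nrm u <= u <= nrm u, exponentiation and conjugation by e^(x/2) give
    e^(x - nrm u) <= e^u' <= e^(x + nrm u); then take logarithms. *)
Lemma exp_conj_bounds u x u' : sa u -> sa x -> sa u' ->
  op_exp u' = op_exp ((2^-1 : R)%:C *: x) * op_exp u * op_exp ((2^-1 : R)%:C *: x) ->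
  ople u' ((nrm u)%:C *: 1 + x) /\ ople ((- nrm u)%:C *: 1 + x) u'.
Proof.
move=> hu hx hu' e.
have hv : sa (op_exp ((2^-1 : R)%:C *: x)) by apply/sa_exp/saZ.
have hs t : sa (t%:C *: 1 + x) by apply: saD => //; exact/saZ/sa1.
split; apply: exp_mono_inv => //; rewrite e exp_addscalar (exp_half x).
  have := ople_conjs hv (exp_le_scalar hu (ople_nrm u)).
  by rewrite -scalerAr mulr1 -scalerAl.
have := ople_conjs hv (exp_ge_scalar hu (@ople_nrmN _ _ u)).
by rewrite -scalerAr mulr1 -scalerAl.
Qed.

Lemma exp_conj_nrm u x u' : sa u -> sa x -> sa u' ->
  op_exp u' = op_exp ((2^-1 : R)%:C *: x) * op_exp u * op_exp ((2^-1 : R)%:C *: x) ->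
  nrm u' <= nrm u + nrm x.
Proof.
move=> hu hx hu' e; have [up lo] := exp_conj_bounds hu hx hu' e.
apply: nrm_ople => //; first by rewrite addr_ge0 ?nrm_ge0.
  move=> xi; have := lo xi; have := ople_nrmN x xi.
  by rewrite !qfD !qfZ; lra.
move=> xi; have := up xi; have := ople_nrm x xi.
by rewrite !qfD !qfZ; lra.
Qed.

(** [first_variation] along a curve.  The constants C and d serve all u in a
    ball, so the estimate can be iterated along a path. *)
Lemma jet_variation (k : R -> A) a c : jet k a -> (forall e, sa (k e)) -> 0 <= c ->
  exists C : R, exists d : R, [/\ 0 <= C, 0 < d <= 1 & forall u u' e, 0 <= e <= d ->
    sa u -> nrm u <= c -> sa u' ->
    op_exp u' = op_exp ((2^-1 : R)%:C *: u) * k e * op_exp ((2^-1 : R)%:C *: u) ->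
    n2 u' ^+ 2 <= n2 u ^+ 2 + 2 * e * tr (u * a) + C * e ^+ 2].
Proof.
move=> jk hk c0; have [C1 C10 h1] := jet_near jk; have [C2 C20 h2] := jk.
have [C3 C30 h3] := first_variation htau c0.
exists (2 * c * C2 + C3 * C1 ^+ 2), (2 * (C1 + 1))^-1.
have d0 : 0 < 2 * (C1 + 1) by lra.
have C1d : C1 * (2 * (C1 + 1))^-1 <= 2^-1 by rewrite ler_pdivrMr //; lra.
have d1 : (2 * (C1 + 1))^-1 <= 1 by rewrite invf_le1 //; lra.
split.
- by rewrite addr_ge0 ?mulr_ge0 ?exprn_ge0.
- by rewrite invr_gt0 d0.
move=> u u' e /andP[e0 ed] hu uc hu' E.
have e01 : 0 <= e <= 1 by rewrite e0 (le_trans ed).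
have ke : nrm (k e - 1) <= C1 * e := h1 _ e01.
have k2 : nrm (k e - 1) <= 2^-1.
  by rewrite (le_trans ke) // (le_trans _ C1d) // ler_wpM2l.
have := h3 u (k e) u' hu (hk e) hu' uc k2 E.
have t1 : tr (u * (k e - 1)) <= e * tr (u * a) + c * C2 * e ^+ 2.
  rewrite -(subrK (e%:C *: a) (k e - 1)) mulrDr trD -scalerAr trZ addrC lerD2l.
  rewrite (le_trans (ler_norm _)) // (le_trans (tr_le_nrm htau _)) //.
  by rewrite -mulrA nrmM_le // h2.
have t2 : C3 * nrm (k e - 1) ^+ 2 <= C3 * C1 ^+ 2 * e ^+ 2.
  by rewrite -mulrA ler_wpM2l // -exprMn lerXn2r ?nnegrE ?nrm_ge0 ?mulr_ge0.
lra.
Qed.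

(** A discrete form of: if (F^2)' <= 2 F Y then F' <= Y.  Dividing by F is
    illegitimate where F vanishes, and sqrt (F^2 + (e/2)^2) >= e/2 replaces
    it; the N errors C / N^2 then add up to at most C / (e N). *)
Lemma discrete_growth (F0 F1 Y C d : R) : 0 <= Y -> 0 <= C -> 0 < d -> 0 <= F0 ->
  (forall N : nat, (0 < N)%N -> N%:R^-1 <= d -> exists f : nat -> R,
    [/\ f 0 = F0, f N = F1, forall j, 0 <= f j & forall j, (j < N)%N ->
      f j.+1 ^+ 2 <= f j ^+ 2 + 2 * N%:R^-1 * (f j * Y) + C * N%:R^-1 ^+ 2]) ->
  F1 <= F0 + Y.
Proof.
move=> Y0 C0 d0 F00 h; apply/ler_addgt0Pr => e e0.
have e20 : 0 < e / 2 by rewrite divr_gt0.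
have ce : 0 <= C / e by rewrite divr_ge0 // ltW.
have [n hn] := null_seq_inv ce e20.
have [n' hn'] := null_seq_inv (@ler01 R) d0.
pose N := (maxn n n').+1.
have := hn _ (leq_maxl n n'); have := hn' _ (leq_maxr n n').
rewrite -/N div1r => Nd Ne.
have [f [f0 fN fge fS]] := h N isT Nd.
set eps := N%:R^-1 in Nd Ne fS.
have eps0 : 0 < eps by rewrite invr_gt0 ltr0n.
(* the regularised length, bounded below by e / 2 *)
pose s j := Num.sqrt (f j ^+ 2 + (e / 2) ^+ 2).
have pos j : 0 <= f j ^+ 2 + (e / 2) ^+ 2 by rewrite addr_ge0 ?sqr_ge0.
have s2 j : s j ^+ 2 = f j ^+ 2 + (e / 2) ^+ 2 by rewrite sqr_sqrtr.
have s0 j : 0 <= s j := sqrtr_ge0 _.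
have se j : e / 2 <= s j by apply: sqr_le_le => //; rewrite s2 lerDr sqr_ge0.
have sf j : f j <= s j by apply: sqr_le_le => //; rewrite s2 lerDl sqr_ge0.
have step j : (j < N)%N -> s j.+1 <= s j + eps * (Y + C / e * eps).
  move=> jN; have inc : 0 <= eps * (Y + C / e * eps).
    have eps0' := ltW eps0.
    by rewrite mulr_ge0 // addr_ge0 // mulr_ge0.
  apply: sqr_le_le; first by rewrite addr_ge0.
  rewrite s2 (le_trans (lerD (fS j jN) (lexx _))) // sqrrD s2.
  have i1 : eps * (f j * Y) <= eps * (s j * Y).
    by rewrite ler_wpM2l ?(ltW eps0) // ler_wpM2r.
  have i2 : C * eps ^+ 2 <= 2 * s j * (C / e * eps ^+ 2).
    rewrite [leRHS](_ : _ = (C * eps ^+ 2) * (s j * 2 / e)); last by field; rewrite gt_eqF.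
    apply: ler_peMr; first by rewrite mulr_ge0 ?sqr_ge0.
    by rewrite ler_pdivlMr // mul1r; have := se j; lra.
  have i3 := sqr_ge0 (eps * (Y + C / e * eps)).
  by rewrite -mulr_natr; lra.
have tot j : (j <= N)%N -> s j <= s 0%N + j%:R * (eps * (Y + C / e * eps)).
  elim: j => [|j ih] jN; first by rewrite mul0r addr0.
  rewrite (le_trans (step j jN)) // -natr1 mulrDl mul1r addrA lerD2r.
  exact/ih/ltnW.
have := tot N (leqnn N); rewrite mulrA divff ?pnatr_eq0 // mul1r => tN.
have s00 : s 0%N <= F0 + e / 2.
  apply: sqr_le_le; first by lra.
  by rewrite s2 f0 sqrrD -mulr_natr; nra.
have := sf N; rewrite fN; lra.
Qed.
End LogLength.

(** * The geodesic distance *)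

Section Distance.
Variables (R : realType) (A : vonNeumannAlgebra R) (tau : {scalar A}).
Hypothesis htau : normal_faithful_tracial_state tau.
Local Open Scope complex_scope.
Local Notation n2 := (l2_norm tau).
Local Notation L := (log_length tau).
Local Notation dst := (exp_dist tau).
Implicit Types (a b g h k u v x y z w d : A) (s t c e : R).
Local Notation half := ((2^-1 : R)%:C).

Lemma unitary_ofl g y : sa y -> op_exp y = star g * g ->
  exists v, star v * v = 1 /\ g = v * op_exp (half *: y).
Proof.
move=> hy e; exists (g * op_exp ((- 2^-1 : R)%:C *: y)); split; last first.
  by rewrite -mulrA -op_expZD addNr scale0r op_exp0 mulr1.
rewrite starM star_exp starZ hy mulrA -(mulrA _ (star g)) -e (exp_half y).
by rewrite -!op_expZD (_ : _ + _ = 0) ?scale0r ?op_exp0 //; lra.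
Qed.

Lemma loglen_unitary_mul v w x y : star v * v = 1 -> sa w -> sa x ->
  w \is a GRing.unit -> x \is a GRing.unit -> sa y -> op_exp y = w * (x * x) * w ->
  L (v * w * x) = n2 y.
Proof.
move=> vv hw hx uw ux hy e; rewrite -mulrA (loglen_unitaryl _ _ vv).
rewrite -(loglen_star htau); last by rewrite unitrMl.
apply: loglenE => //; rewrite e starK starM hw hx.
by rewrite !mulrA.
Qed.

(** By the polar decomposition g = v e^(u/2), the unitary v disappears from
    the length, and so does the order of the two remaining positive
    factors. *)
Lemma loglen_mulexp_step g u y e : g \is a GRing.unit -> sa u ->
  op_exp u = star g * g -> sa y -> exists u', [/\ sa u',
    L (g * op_exp ((e / 2 : R)%:C *: y)) = n2 u' &
    op_exp u' = op_exp (half *: u) * op_exp (e%:C *: y) * op_exp (half *: u)].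
Proof.
move=> ug hu eu hy; have [v [vv gv]] := unitary_ofl hu eu.
have hx : sa (op_exp ((e / 2 : R)%:C *: y)) by apply/sa_exp/saZ.
have hw : sa (op_exp (half *: u)) by apply/sa_exp/saZ.
have xx : op_exp (e%:C *: y) =
    op_exp ((e / 2 : R)%:C *: y) * op_exp ((e / 2 : R)%:C *: y).
  by rewrite -op_expZD -splitr.
have ux : op_exp ((e / 2 : R)%:C *: y) \is a GRing.unit := exp_unit _.
have uw : op_exp (half *: u) \is a GRing.unit := exp_unit _.
rewrite xx gv; move: ux uw hx hw.
move: (op_exp ((e / 2 : R)%:C *: y)) (op_exp (half *: u)) => x w ux uw hx hw.
have uxw : x * w \is a GRing.unit by rewrite unitrMl.
have [y' [hy' ey']] := log_gram uxw.
have E : op_exp y' = w * (x * x) * w by rewrite ey' starM hx hw !mulrA.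
by exists y'; split; [|exact: loglen_unitary_mul|].
Qed.

(** Along t |-> g e^(t y/2), with u_t the logarithm attached to the running
    product, [jet_variation] bounds the derivative of the squared length by
    2 tr (u_t y) <= 2 ||u_t|| ||y||; [discrete_growth] integrates this. *)
Lemma loglen_mulexp g y : g \is a GRing.unit -> sa y ->
  L (g * op_exp (half *: y)) <= L g + n2 y.
Proof.
move=> ug hy; have [hu0 eu0] := ln_gram ug; set u0 := op_ln _ in hu0 eu0.
have c0 : 0 <= nrm u0 + nrm y by rewrite addr_ge0 ?nrm_ge0.
have [|C [d [C0 /andP[d0 d1] hv]]] := jet_variation htau (jet_exp 1 y) _ c0.
  by move=> e; apply/sa_exp/saZ.
apply: (discrete_growth (n2_ge0 tau y) C0 d0 (loglen_ge0 tau g)) => N N0 Nd.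
have Npos : 0 < N%:R :> R by rewrite ltr0n.
have NN : N%:R / N%:R / 2 = 2^-1 :> R by rewrite divff ?gt_eqF // mul1r.
exists (fun j => L (g * op_exp ((j%:R / N%:R / 2 : R)%:C *: y))); split.
- by rewrite !mul0r scale0r op_exp0 mulr1.
- by rewrite NN.
- by move=> j; exact: loglen_ge0.
move=> j jN; set t : R := j%:R / N%:R.
have uw : g * op_exp ((t / 2 : R)%:C *: y) \is a GRing.unit.
  by rewrite unitrMl ?exp_unit.
have [hu eu] := ln_gram uw; set u := op_ln _ in hu eu.
have [u' [hu' Lu' eu']] := loglen_mulexp_step N%:R^-1 uw hu eu hy.
have es : j.+1%:R / N%:R / 2 = t / 2 + N%:R^-1 / 2 :> R.
  by rewrite -natr1 !mulrDl mul1r.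
have -> : g * op_exp ((j.+1%:R / N%:R / 2 : R)%:C *: y) =
    g * op_exp ((t / 2 : R)%:C *: y) * op_exp ((N%:R^-1 / 2 : R)%:C *: y).
  by rewrite es op_expZD mulrA.
rewrite Lu' (loglenE _ hu eu).
have t01 : 0 <= t <= 1.
  by rewrite divr_ge0 //= ler_pdivrMr // mul1r ler_nat ltnW.
have un : nrm u <= nrm u0 + nrm y.
  apply: (@le_trans _ _ (nrm u0 + nrm (t%:C *: y))).
    apply: exp_conj_nrm => //; first exact: saZ.
    rewrite eu eu0 starM star_exp starZ hy scalerC (mulrC 2^-1) !mulrA //.
  have /andP[t0 t1] := t01.
  by rewrite lerD2l nrmZ ger0_norm // ler_piMl ?nrm_ge0.
have := hv u u' N%:R^-1; rewrite invr_ge0 ler0n Nd mulr1 => /(_ isT hu un hu' eu').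
rewrite scale1C => /le_trans; apply; rewrite lerD2r lerD2l.
by rewrite ler_wpM2l ?mulr_ge0 ?invr_ge0 // -(ip_sa tau _ hu) ip_CS.
Qed.

(** The polar decomposition of h reduces to a positive second factor. *)
Lemma loglenM g h : g \is a GRing.unit -> h \is a GRing.unit -> L (g * h) <= L g + L h.
Proof.
move=> ug uh; have [hy e] := ln_gram (unit_star uh); rewrite starK in hy e.
have [eh vv] := unitary_of hy e; set v := _ * h in eh vv.
have uv : v \is a GRing.unit by rewrite unitrMl // exp_unit.
have vv' := unitary_sym uv vv.
rewrite {1}eh mulrA loglen_unitaryr //; last by rewrite unitrMl ?exp_unit.
rewrite (le_trans (loglen_mulexp ug hy)) // lerD2l -(loglen_star htau uh).
by rewrite (loglenE _ hy _) // starK.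
Qed.

Lemma loglenX g n : g \is a GRing.unit -> L (g ^+ n) <= n%:R * L g.
Proof.
move=> ug; elim: n => [|n ih]; first by rewrite expr0 loglen1 // mul0r.
rewrite exprSr -natr1 mulrDl mul1r (le_trans (loglenM _ ug)) ?unitrX // lerD2r.
exact: ih.
Qed.

Lemma dst_unit x y : op_exp (half *: y) * op_exp (- (half *: x)) \is a GRing.unit.
Proof. by rewrite unitrMl exp_unit. Qed.

Lemma dst_ge0 x y : 0 <= dst x y.
Proof. exact: loglen_ge0. Qed.

Lemma dstC x y : dst x y = dst y x.
Proof.
rewrite /exp_dist -(loglen_inv htau (dst_unit x y)) invrM ?exp_unit //.
by rewrite !exp_inv opprK.
Qed.

Lemma dst_triangle x y z : dst x z <= dst x y + dst y z.
Proof.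
rewrite addrC; apply: le_trans (loglenM (dst_unit _ _) (dst_unit _ _)).
by rewrite mulrA -(mulrA _ _ (op_exp (half *: y))) op_expNl mulr1.
Qed.

(** Any a with e^x = a (star a) differs from e^(x/2) by a unitary on the right,
    which does not affect lengths. *)
Lemma dstE x y a b : sa x -> sa y -> a \is a GRing.unit -> b \is a GRing.unit ->
  op_exp x = a * star a -> op_exp y = b * star b ->
  dst x y = L (star b * (star a)^-1).
Proof.
move=> hx hy ua ub ea eb.
have [ea' vv] := unitary_of hx ea; set v := _ * a in ea' vv.
have [eb' ww] := unitary_of hy eb; set w := _ * b in eb' ww.
have uv : v \is a GRing.unit by rewrite unitrMl // exp_unit.
have uw : w \is a GRing.unit by rewrite unitrMl // exp_unit.
have vv' := unitary_sym uv vv; have ww' := unitary_sym uw ww.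
clearbody v w.
have vi : (star v)^-1 = v by rewrite -[RHS]mul1r -(mulVr (unit_star uv)) -mulrA vv' mulr1.
rewrite {1}eb' {1}ea' !starM !star_exp !starZ hx hy invrM ?exp_unit ?unit_star //.
rewrite vi mulrA loglen_unitaryr //; last first.
  by rewrite unitrMl ?unitrV ?exp_unit // unitrMl ?exp_unit ?unit_star.
have wu : star (star w) * star w = 1 by rewrite starK.
by rewrite /exp_dist -[in RHS]mulrA (loglen_unitaryl _ _ wu) exp_inv.
Qed.

(** Invariance of the metric under congruence by a: a e^(x/2) is an admissible
    root of e^x' in [dstE]. *)
Lemma dst_congr a x y x' y' : sa x -> sa y -> sa x' -> sa y' -> a \is a GRing.unit ->
  op_exp x' = a * op_exp x * star a -> op_exp y' = a * op_exp y * star a ->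
  dst x' y' = dst x y.
Proof.
move=> hx hy hx' hy' ua ex ey.
have sq z : sa z -> a * op_exp z * star a =
    (a * op_exp (half *: z)) * star (a * op_exp (half *: z)).
  by move=> hz; rewrite starM star_exp starZ hz {1}(exp_half z) !mulrA.
rewrite (@dstE x' y' (a * op_exp (half *: x)) (a * op_exp (half *: y))) ?unitrMl ?exp_unit //; first last.
- by rewrite ey sq.
- by rewrite ex sq.
rewrite !starM !star_exp !starZ hx hy invrM ?exp_unit ?unit_star // mulrA.
by rewrite -(mulrA _ (star a)) mulrV ?unit_star // mulr1 exp_inv.
Qed.

Lemma dst_ln x y (c : A) : sa x -> sa y -> sa c ->
  op_exp c = op_exp (- (half *: x)) * op_exp y * op_exp (- (half *: x)) -> dst x y = n2 c.
Proof.
move=> hx hy hc e; apply: loglenE => //; rewrite e starM !star_exp !starZ starN starZ hx hy.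
by rewrite {1}(exp_half y) !mulrA.
Qed.

Lemma ln_conj x y : sa x -> sa y -> exists c : A, sa c /\
  op_exp c = op_exp (- (half *: x)) * op_exp y * op_exp (- (half *: x)).
Proof.
move=> hx hy; have [c [hc e]] := log_gram (dst_unit x y); exists c; split=> //.
rewrite e starM !star_exp !starZ starN starZ hx hy (exp_half y); by rewrite !mulrA.
Qed.

(** Z = e^y e^-x has length dist (e^2x, e^2y) and is conjugate to e^c, where
    ||c|| = dist (e^x, e^y).  By subadditivity
    2 n ||c|| = L (e^(n c)) <= n L (Z) + const for every n, hence
    2 ||c|| <= L (Z). *)
Lemma dst_double x y : sa x -> sa y -> 2 * dst x y <= dst (2%:C *: x) (2%:C *: y).
Proof.
move=> hx hy; have [c [hc e]] := ln_conj hx hy; rewrite (dst_ln hx hy hc e).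
have h2 : 2^-1 * 2 = 1 :> R by rewrite mulVf ?pnatr_eq0.
rewrite {1}/exp_dist !scalerC h2 !scale1C.
set Z := op_exp y * op_exp (- x).
set g := op_exp (half *: x); set gi := op_exp (- (half *: x)) in e *.
have uZ : Z \is a GRing.unit by rewrite unitrMl exp_unit.
have ug : g \is a GRing.unit by exact: exp_unit.
have ugi : gi \is a GRing.unit by exact: exp_unit.
have ggi : g * gi = 1 := op_expNr _.
have gig : gi * g = 1 := op_expNl _.
have gigi : op_exp (- x) = gi * gi.
  by rewrite (exp_half (- x)) scalerN.
have ZE : gi * Z * g = op_exp c by rewrite e /Z gigi !mulrA -(mulrA _ gi g) gig mulr1.
have key n : n%:R * (2 * n2 c - L Z) <= L gi + L g.
  rewrite mulrBr lerBlDr.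
  apply: (@le_trans _ _ (L (gi * Z ^+ n * g))).
    rewrite -(conjX _ _ ggi gig) ZE -exp_natZ loglen_exp //; last exact: saZ.
    by rewrite n2Z // ger0_norm // mulrCA.
  rewrite (le_trans (loglenM _ _)) ?unitrMl ?unitrX // addrAC lerD2r.
  rewrite (le_trans (loglenM _ _)) ?unitrX // lerD2l.
  exact: loglenX.
rewrite -subr_le0 leNgt; apply/negP => pos.
pose B := L gi + L g.
have B0 : 0 <= B by rewrite addr_ge0 ?loglen_ge0.
have [n hn] := null_seq_inv B0 (divr_gt0 pos (ltr0n R 2)).
have := hn n (leqnn n); rewrite ler_pdivrMr ?ltr0n // => h.
have := key n.+1; rewrite -/B => k.
have p0 : 0 < n.+1%:R * (2 * n2 c - L Z) by rewrite mulr_gt0 ?ltr0n.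
lra.
Qed.

End Distance.

(** * Comparison with the flat distance and nonpositive curvature *)

Section Curvature.
Variables (R : realType) (A : vonNeumannAlgebra R) (tau : {scalar A}).
Hypothesis htau : normal_faithful_tracial_state tau.
Local Open Scope complex_scope.
Local Notation n2 := (l2_norm tau).
Local Notation dst := (exp_dist tau).
Implicit Types (a b g h k l u v x y z w : A) (s t c d e : R).
Local Notation half := ((2^-1 : R)%:C).

(** The middle factor k in e^(-e x/2) e^(e y) e^(-e x/2) =
    e^(e (y-x)/2) k e^(e (y-x)/2). *)
Definition sandwich x y e : A :=
  op_exp ((e * - 2^-1 : R)%:C *: (y - x)) * (op_exp ((e * - 2^-1 : R)%:C *: x) *
   op_exp ((e * 1 : R)%:C *: y) * op_exp ((e * - 2^-1 : R)%:C *: x)) *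
  op_exp ((e * - 2^-1 : R)%:C *: (y - x)).

Lemma jet_sandwich x y : jet (sandwich x y) 0.
Proof.
have := jetM (jetM (jet_exp (- 2^-1) (y - x)) (jetM (jetM (jet_exp (- 2^-1) x)
  (jet_exp 1 y)) (jet_exp (- 2^-1) x))) (jet_exp (- 2^-1) (y - x)).
rewrite (_ : _ + _ + _ = 0) //.
by apply: mel_inj => xi eta; rewrite !melE; field.
Qed.

Lemma expZK t x : op_exp (t%:C *: x) * op_exp ((- t : R)%:C *: x) = 1.
Proof. by rewrite -op_expZD addrN scale0r op_exp0. Qed.

Lemma sandwich_dst x y e l : sa x -> sa y -> sa l ->
  op_exp l = op_exp (- (half *: (e%:C *: x))) * op_exp (e%:C *: y) *
             op_exp (- (half *: (e%:C *: x))) ->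
  op_exp l = op_exp (half *: (e%:C *: (y - x))) * sandwich x y e *
             op_exp (half *: (e%:C *: (y - x))).
Proof.
move=> hx hy hl ->; rewrite /sandwich mulr1 mulrN !scalerC -scaleNC (mulrC 2^-1).
have := expZK (e / 2) (y - x); have := expZK (- (e / 2)) (y - x); rewrite opprK.
move: (op_exp ((e / 2 : R)%:C *: (y - x))) (op_exp ((- (e / 2) : R)%:C *: (y - x))).
move=> p q qp pq.
rewrite !mulrA pq mul1r -!mulrA qp mulr1.
by [].
Qed.

(** The velocities in [sandwich] add up to 0, so k = 1 + O(e^2), and the
    logarithm of the left-hand side is e (y - x) + O(e^2) by
    [log_perturb]. *)
Lemma dst_small x y : sa x -> sa y -> exists2 C, 0 <= C &
  exists2 d, 0 < d & forall e, 0 <= e <= 1 -> e <= d ->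
    e * n2 (y - x) - C * e ^+ 2 <= dst (e%:C *: x) (e%:C *: y).
Proof.
move=> hx hy; have [C C0 hC] := jet_sandwich x y.
exists (2 * C); first by rewrite mulr_ge0.
have d0 : 0 < 2 * (C + 1) by lra.
exists (2 * (C + 1))^-1; first by rewrite invr_gt0.
move=> e e01 ed; have /andP[e0 e1] := e01.
have hd : sa (y - x) by exact: saB.
have [l [hl el]] := ln_conj (saZ e hx) (saZ e hy).
rewrite (dst_ln tau (saZ e hx) (saZ e hy) hl el).
have el' := sandwich_dst hx hy hl el.
have k1 : nrm (sandwich x y e - 1) <= C * e ^+ 2.
  by have := hC e e01; rewrite scaler0 subr0.
have k2 : nrm (sandwich x y e - 1) <= 2^-1.
  apply: (le_trans k1); apply: (@le_trans _ _ (C * (2 * (C + 1))^-1)).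
    by rewrite ler_wpM2l // (le_trans _ ed) // expr2 ler_piMl.
  by rewrite ler_pdivrMr //; lra.
have hk : sa (sandwich x y e).
  rewrite /sandwich; apply: sa_conjs; last exact/sa_exp/saZ.
  by apply: sa_conjs; apply/sa_exp/saZ.
have P := log_perturb (saZ e hd) hk hl k2 el'.
have h1 : n2 (l - e%:C *: (y - x)) <= 2 * (C * e ^+ 2).
  by rewrite (le_trans (n2_le_nrm htau _)) // (le_trans P) // ler_wpM2l.
have h2 := n2D htau (e%:C *: (y - x) - l) l.
rewrite subrK n2Z // ger0_norm // in h2.
by rewrite n2_distC // in h1; lra.
Qed.

(** The exponential does not shorten: by [dst_double],
    dist (e^x, e^y) >= 2^k dist (e^(x/2^k), e^(y/2^k)), and by [dst_small] the
    right-hand side tends to ||y - x||. *)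
Lemma dst_ge_n2 x y : sa x -> sa y -> n2 (y - x) <= dst x y.
Proof.
move=> hx hy; have [C C0 [d d0 h]] := dst_small hx hy.
apply/ler_addgt0Pr => e e0.
have h2 (k : nat) : 2 * 2^-1 ^+ k.+1 = 2^-1 ^+ k :> R.
  by rewrite exprS mulrA divff ?pnatr_eq0 // mul1r.
have dbl (k : nat) : 2 ^+ k * dst ((2^-1 ^+ k : R)%:C *: x) ((2^-1 ^+ k : R)%:C *: y) <= dst x y.
  elim: k => [|k ih]; first by rewrite !expr0 mul1r !scale1C.
  apply: le_trans ih; rewrite exprSr -mulrA ler_wpM2l ?exprn_ge0 //.
  apply: (le_trans (dst_double htau (saZ _ hx) (saZ _ hy))).
  by rewrite !scalerC h2.
have [k1 h1] := null_seq_pow2 C0 e0.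
have [k2 h2'] := null_seq_pow2 (@ler01 R) d0.
pose k := maxn k1 k2.
have ke := h1 k (leq_maxl _ _); have kd := h2' k (leq_maxr _ _); rewrite mul1r in kd.
have q0 : 0 < (2^-1 : R) ^+ k by rewrite exprn_gt0 ?invr_gt0.
have q1 : (2^-1 : R) ^+ k <= 1 by rewrite exprn_ile1 ?invr_ge0 ?invf_le1 ?ler1n.
have := h (2^-1 ^+ k); rewrite (ltW q0) q1 => /(_ isT kd) low.
have := dbl k; have pk := pow2K R k.
set D := dst _ _ in low *; set q := (2^-1 : R) ^+ k in pk q0 q1 ke kd low *.
move=> up; have p0 : 0 <= (2 : R) ^+ k by rewrite exprn_ge0.
have := ler_wpM2l p0 low; rewrite mulrBr mulrA pk mul1r => low'.
have e2 : 2 ^+ k * (C * q ^+ 2) = C * q.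
  by transitivity (C * (2 ^+ k * q * q)); [ring|rewrite pk mul1r].
by rewrite e2 in low'; lra.
Qed.

Lemma dst_opp z : sa z -> dst (- z) z = 2 * n2 z.
Proof.
move=> hz; rewrite /exp_dist scalerN opprK -exp_half; exact: loglen_exp.
Qed.

Lemma n2_parallelogram x y : n2 (x + y) ^+ 2 + n2 (x - y) ^+ 2 =
  2 * (n2 x ^+ 2 + n2 y ^+ 2).
Proof. by rewrite !n2_sqr // !ipE // (ipC htau y x); ring. Qed.

Lemma dst0 z : sa z -> dst 0 z = n2 z.
Proof.
move=> hz; rewrite /exp_dist scaler0 oppr0 op_exp0 mulr1 loglen_exp //; last exact: saZ.
by rewrite n2Z // ger0_norm ?invr_ge0 // mulrA divff ?mul1r // pnatr_eq0.
Qed.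

(** The congruence by a^-1 moves the midpoint to 1 and the end points to e^-l
    and e^l.  Distances from 1, and between these end points, are the flat
    ones, the distances to the third point dominate the flat ones by
    [dst_ge_n2], and in the flat case the parallelogram law is an
    equality. *)
Lemma semiparallelogram a (l p q m r : A) : sa l -> sa p -> sa q -> sa m -> sa r ->
  a \is a GRing.unit -> op_exp m = a * star a ->
  op_exp p = a * op_exp (- l) * star a -> op_exp q = a * op_exp l * star a ->
  2 * dst m r ^+ 2 + 2^-1 * dst p q ^+ 2 <= dst p r ^+ 2 + dst q r ^+ 2.
Proof.
move=> hl hp hq hm hr ua em ep eq.
have ub : op_exp (half *: r) * star a^-1 \is a GRing.unit.
  by rewrite unitrMl ?exp_unit // unit_star // unitrV.
have [z [hz ez]] := log_gram ub.
have er : op_exp r = a * op_exp z * star a.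
  rewrite ez starM starK star_exp starZ hr !mulrA mulrV // mul1r -op_expZD.
  rewrite -mulrA -starM mulrV // star1 mulr1.
  by rewrite (_ : _ + _ = 1) ?scale1C //; lra.
have em' : op_exp m = a * op_exp 0 * star a by rewrite op_exp0 mulr1.
rewrite (dst_congr htau (saN hl) hz hp hr ua ep er) (dst_congr htau hl hz hq hr ua eq er).
rewrite (dst_congr htau (sa0 A) hz hm hr ua em' er) dst0 //.
rewrite (dst_congr htau (saN hl) hl hp hq ua ep eq) dst_opp //.
have h1 : n2 (z + l) ^+ 2 <= dst (- l) z ^+ 2.
  have := dst_ge_n2 (saN hl) hz; rewrite opprK => h.
  by rewrite lerXn2r ?nnegrE ?n2_ge0 // dst_ge0.
have h2 : n2 (z - l) ^+ 2 <= dst l z ^+ 2.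
  by rewrite lerXn2r ?nnegrE ?n2_ge0 ?dst_ge0 // dst_ge_n2.
apply: le_trans (lerD h1 h2); rewrite n2_parallelogram mulrDr lerD2l exprMn.
by rewrite mulrA ler_wpM2r ?sqr_ge0 // expr2 mulrA mulVf ?pnatr_eq0 // mul1r.
Qed.

End Curvature.

(** * Strong limits and inverses *)

Section StrongLimits.
Variables (R : realType) (A : vonNeumannAlgebra R).
Local Open Scope complex_scope.
Local Notation K := (vn_hilbert A).
Local Notation op := (@vop R A).
Implicit Types (u : nat -> A) (a b g x y z d : A) (xi eta : K) (s t c e : R).

Lemma tends_op x (v : nat -> K) (l : K) : tends v l -> tends (fun n => op x (v n)) (op x l).
Proof.
move=> h; apply: null_seq_le (null_seqZ (nrm_ge0 x) h) => n.
by rewrite -op_vN -op_vD nrm_op.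
Qed.

Lemma rdot_le xi eta : rdot xi eta <= nrm xi * nrm eta.
Proof.
apply: sqr_le_le; first by rewrite mulr_ge0 ?nrm_ge0.
by rewrite exprMn !nrm_sqr_rdot rdot_CS.
Qed.

Lemma rdot_abs_le xi eta : `|rdot xi eta| <= nrm xi * nrm eta.
Proof. by rewrite ler_norml rdot_le andbT lerNl -rdotNl (le_trans (rdot_le _ _)) // nrmN. Qed.

(** Convergence in the strong operator topology. *)
Definition stends u x := forall xi, tends (fun n => op (u n) xi) (op x xi).

(* the strong closure of the von Neumann algebra is itself: this is the only
   use of the bicommutant *)
Lemma strong_complete u c : (forall n, nrm (u n) <= c) ->
  (forall xi, exists l, tends (fun n => op (u n) xi) l) ->
  exists2 x, stends u x & nrm x <= c.
Proof.
move=> uc h; have [T hT] := choice h.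
have c0 : 0 <= c := le_trans (nrm_ge0 _) (uc 0).
have Tb xi : nrm (T xi) <= c * nrm xi.
  apply: (tends_nrm_le (hT xi)) => n.
  by rewrite (le_trans (nrm_op _ _)) // ler_wpM2r ?nrm_ge0.
have Tlin : linear T.
  move=> k xi eta; apply: (tends_uniq (hT _)); apply: cvg_tends.
  under eq_fun do rewrite op_vD op_vZ.
  by apply: cvgD; [apply: cvgZr|]; exact: tends_cvg.
have Tcont : continuous T.
  move=> xi; apply/cvgrPdist_le => e; rewrite ltcE /= => /andP[/eqP i0 e0].
  have c1 : 0 < c + 1 by lra.
  have d0 : 0 < (complex.Re e / (c + 1))%:C :> R[i] by rewrite ltcR divr_gt0.
  have nb : \forall eta \near xi, `|xi - eta| < (complex.Re e / (c + 1))%:C.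
    by apply/nbhs_normP; exists (complex.Re e / (c + 1))%:C.
  apply: filterS nb => eta he.
  have TB : T xi - T eta = T (xi - eta).
    by rewrite -[X in X - _](subrK (T eta)) addrK -scaleN1r addrC -Tlin scaleN1r addrC.
  rewrite TB -nrmE lecE /= i0 eqxx (le_trans (Tb _)) //.
  have : nrm (xi - eta) <= complex.Re e / (c + 1).
    by rewrite -lecR nrmE ltW.
  move=> hd; apply: (@le_trans _ _ ((c + 1) * (complex.Re e / (c + 1)))).
    by rewrite ler_pM ?nrm_ge0 // lerDl.
  by rewrite mulrC divfK // gt_eqF.
(* strong limits of elements of the algebra commute with its commutant *)
have : commutant (commutant (range (@vn_op R A))) T.
  split=> // S [Slin Scont SA]; apply/funext => xi /=.
  apply: (tends_uniq (hT _)); apply: cvg_tends.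
  have e n : op (u n) (S xi) = S (op (u n) xi).
    have /(congr1 (fun f => f xi)) /= SAn := SA (vn_op (u n)) (ex_intro2 _ _ (u n) I erefl).
    exact/esym.
  under eq_fun do rewrite e.
  apply: (cvg_comp _ _ (tends_cvg (hT xi))); exact: Scont.
rewrite vn_bicommutant => -[x _ xT].
have xE xi : op x xi = T xi by rewrite -xT.
exists x; first by move=> xi; rewrite xE.
apply: nrm_lub => // xi; rewrite xE -!nrm_sqr_rdot -exprMn.
by rewrite lerXn2r ?nnegrE ?mulr_ge0 ?nrm_ge0.
Qed.

Lemma stends_qf u x xi : stends u x -> null_seq (fun n => `|qf (u n) xi - qf x xi|).
Proof.
move=> h; apply: null_seq_le (null_seqZ (nrm_ge0 xi) (h xi)) => n.
by rewrite -rdotNl -rdotDl (le_trans (rdot_abs_le _ _)) // mulrC.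
Qed.

Lemma stends_cst x : stends (fun=> x) x.
Proof. by move=> xi e e0; exists 0 => n _; rewrite subrr nrm0 ltW. Qed.

Lemma stends_le u v x y : stends u x -> stends v y ->
  (forall n, ople (u n) (v n)) -> ople x y.
Proof.
move=> h k uv xi; rewrite -subr_le0.
apply: (null_seq_bound (null_seqD (stends_qf xi h) (stends_qf xi k))) => n.
have := uv n xi; have := ler_norm (qf x xi - qf (u n) xi).
have := ler_norm (qf (v n) xi - qf y xi); rewrite (distrC (qf x xi)); lra.
Qed.

Lemma stends_sub u x (f : nat -> nat) : (forall n, (n <= f n)%N) -> stends u x ->
  stends (fun n => u (f n)) x.
Proof. by move=> hf h xi; exact: null_seq_comp hf (h xi). Qed.

Lemma stends_sa u x : (forall n, sa (u n)) -> stends u x -> sa x.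
Proof.
move=> hu h; apply: mel_inj => xi eta; rewrite /mel rdot_adj starK.
apply/eqP; rewrite -subr_eq0 -normr_le0.
apply: (null_seq_bound (null_seqD (null_seqZ (nrm_ge0 xi) (h eta))
  (null_seqZ (nrm_ge0 eta) (h xi)))) => n.
have e1 : rdot (op (u n) xi) eta = rdot xi (op (u n) eta) by rewrite rdot_adj hu.
rewrite (_ : _ - _ = rdot (op (u n) xi - op x xi) eta - rdot (op (u n) eta - op x eta) xi).
  rewrite (le_trans (ler_normB _ _)) // addrC lerD //.
    by rewrite (le_trans (rdot_abs_le _ _)) // mulrC.
  by rewrite (le_trans (rdot_abs_le _ _)) // mulrC.
by rewrite !rdotDl !rdotNl e1 (rdotC (op (u n) eta)) (rdotC (op x eta)); ring.
Qed.

Lemma stends_nrm_le u x c : 0 <= c -> stends u x -> (forall n, nrm (u n) <= c) -> nrm x <= c.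
Proof.
move=> c0 h uc; apply: nrm_lub => // xi; rewrite -!nrm_sqr_rdot -exprMn.
rewrite lerXn2r ?nnegrE ?mulr_ge0 ?nrm_ge0 //.
apply: (tends_nrm_le (h xi)) => n.
by rewrite (le_trans (nrm_op _ _)) // ler_wpM2r ?nrm_ge0.
Qed.

Lemma stendsMr u x y : stends u x -> stends (fun n => u n * y) (x * y).
Proof.
move=> h xi; apply: null_seq_le (h (op y xi)) => n.
by rewrite !opM.
Qed.

Lemma stendsB u v x y : stends u x -> stends v y -> stends (fun n => u n - v n) (x - y).
Proof.
move=> h k xi; apply: null_seq_le (null_seqD (h xi) (k xi)) => n.
by rewrite !opB opprD addrACA -opprD (le_trans (nrmD _ _)) // nrmN.
Qed.

Lemma ople_sq_contraction d : sa d -> ople 0 d -> ople d 1 -> ople (d * d) d.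
Proof.
move=> hd d0 d1; have [s [hs _ ss]] := sqrt_exists hd d0.
have := ople_conjs hs d1; rewrite mulr1 ss.
by rewrite -[in X in ople X _]ss -ss !mulrA.
Qed.

Lemma noninc_null (r : nat -> R) : (forall n, 0 <= r n) -> (forall n, r n.+1 <= r n) ->
  exists l, null_seq (fun n => r n - l) /\ forall n, l <= r n.
Proof.
move=> r0 h; have mono : nonincreasing_seq r by apply/nonincreasing_seqP.
have bnd : has_lbound (range r) by exists 0 => _ [n _ <-].
have hc := nonincreasing_cvgn mono bnd; set l := inf _ in hc.
exists l; split.
  apply: null_seq_cvg; rewrite -(subrr l).
  by apply: cvgB => //; exact: cvg_cst.
by move=> n; have := nonincreasing_cvgn_ge mono (cvgP _ hc) n; rewrite (cvg_lim _ hc).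
Qed.

Lemma noninc_le (r : nat -> R) : (forall n, r n.+1 <= r n) ->
  forall n m, (n <= m)%N -> r m <= r n.
Proof.
by move=> h n m nm; have /nonincreasing_seqP mono := h; exact: mono.
Qed.

(* monotone convergence *)

(** For m <= n the difference D = u m - u n satisfies 0 <= D <= 1, so that
    |D xi|^2 <= <D xi, xi>, and the numbers <u_n xi, xi> decrease. *)
Lemma monotone_strong u : (forall n, [/\ sa (u n), ople 0 (u n) & ople (u n) 1]) ->
  (forall n, ople (u n.+1) (u n)) ->
  exists x, [/\ stends u x, sa x, ople 0 x & forall n, ople x (u n)].
Proof.
move=> hu dec.
have decl n m : (n <= m)%N -> ople (u m) (u n).
  by move=> nm xi; apply: (noninc_le (r := fun n => qf (u n) xi)) => // k; exact: dec.
have un n : nrm (u n) <= 1.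
  have [h0 h1 h2] := hu n; apply: nrm_ople => //; last by rewrite scale1C.
  by apply: ople_trans h1; rewrite -[X in ople _ X](scale0r 1); apply: ople_scalar; lra.
have [|x hx _] := strong_complete un.
  move=> xi; apply: complete_seq => e e0.
  have [||l [rl ln]] := @noninc_null (fun n => qf (u n) xi).
  - by move=> n; have [_ h _] := hu n; have := h xi; rewrite qf0.
  - by move=> n; exact: dec.
  have [N hN] := rl _ (exprn_gt0 2 e0); exists N.
  have key m n : (N <= m)%N -> (m <= n)%N -> nrm (op (u m) xi - op (u n) xi) <= e.
    move=> Nm mn; apply: sqr_le_le; first exact: ltW.
    rewrite nrm_sqr_rdot -opB -qf_starM.
    have [hm m0 m1] := hu m; have [hn n0 n1] := hu n.
    have hd : sa (u m - u n) by exact: saB.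
    have d0 : ople 0 (u m - u n) by apply/ople_subr; exact: decl.
    have d1 : ople (u m - u n) 1.
      by move=> eta; have := m1 eta; have := n0 eta; rewrite qfD qfN qf0; lra.
    rewrite hd; have := ople_sq_contraction hd d0 d1 xi; rewrite qfD qfN.
    by have := hN m Nm; have := ln n; lra.
  move=> m n Nm Nn; have [mn|/ltnW nm] := leqP m n; first exact: key.
  by rewrite nrm_distC key.
exists x; split=> //.
- by apply: (stends_sa _ hx) => n; have [] := hu n.
- by apply: (stends_le (stends_cst 0) hx) => n; have [] := hu n.
- move=> n; apply: (stends_le (stends_sub (f := addn n) _ hx) (stends_cst (u n))).
    by move=> k; exact: leq_addl.
  by move=> k; apply: decl; exact: leq_addr.
Qed.

(* inverses *)

(** Neumann series for 1 - x / c with c = nrm x, an element of norm at most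
    1 - 1/c because 1 <= x <= c. *)
Lemma unit_ge1 x : sa x -> ople 1 x -> x \is a GRing.unit.
Proof.
move=> hx h; pose c := nrm x.
have c1 : 1 <= c.
  have [xi xi0] : exists xi : K, 0 < rdot xi xi.
    apply: contrapT => /forallNP hn; have /eqP := oner_neq0 A; apply.
    apply: vn_op_inj => xi; have /negP := hn xi; rewrite -leNgt => le0.
    have xi0 : xi = 0 by apply/rdot_eq0/le_anti; rewrite le0 rdot_ge0.
    by rewrite xi0 -!/(op _ _) -(scale0r 0) !op_vZ !scale0r.
  have := ople_trans h (ople_nrm x) xi; rewrite qfZ qf1.
  by rewrite -{1}[rdot _ _]mul1r ler_pM2r.
have c0 : 0 < c by lra.
pose a := 1 - c^-1%:C *: x.
have ha : sa a by apply: saB; [exact: sa1|exact: saZ].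
have q0 : 0 <= 1 - c^-1 by rewrite subr_ge0 invf_le1.
have q1 : 1 - c^-1 < 1 by rewrite ltrBlDr ltrDl invr_gt0.
have an : nrm a <= 1 - c^-1.
  apply: nrm_ople => //.
    move=> xi; rewrite qfZ qfD qfN qfZ !qf1.
    have := ople_nrm x xi; rewrite qfZ qf1 -/c => h1.
    have : c^-1 * qf x xi <= rdot xi xi by rewrite mulrC ler_pdivrMr // mulrC.
    by have := mulr_ge0 q0 (rdot_ge0 xi); lra.
  move=> xi; rewrite qfZ qfD qfN qfZ !qf1.
  have := h xi; rewrite qf1 => h1.
  have : c^-1 * rdot xi xi <= c^-1 * qf x xi by rewrite ler_pM2l // invr_gt0.
  lra.
pose S n : A := \sum_(k < n) a ^+ k.
have [|||y [Sy _]] := @telescoping_tends _ _ S (fun n => c * (1 - c^-1) ^+ n).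
- by move=> n; rewrite mulr_ge0 ?exprn_ge0 // ltW.
- by apply: null_seq_geo; [rewrite q0|exact: ltW].
- move=> n; rewrite /S big_ord_recr /= addrAC subrr add0r (le_trans (nrmX _ _)) //.
  have key p : c * p - c * ((1 - c^-1) * p) = p.
    by rewrite -mulrBr -{1}[p]mul1r -mulrBl opprB addrC subrK mulrA divff ?gt_eqF ?mul1r.
  by rewrite exprS key lerXn2r ?nnegrE ?nrm_ge0.
have aS n : (1 - a) * S n = 1 - a ^+ n.
  elim: n => [|n ih]; first by rewrite /S big_ord0 mulr0 expr0 subrr.
  by rewrite /S big_ord_recr /= mulrDr ih mulrBl mul1r -exprS addrA subrK.
have Sa n : S n * (1 - a) = 1 - a ^+ n.
  elim: n => [|n ih]; first by rewrite /S big_ord0 mul0r expr0 subrr.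
  by rewrite /S big_ord_recr /= mulrDl ih mulrBr mulr1 -exprSr addrA subrK.
have an0 : tends (fun n => 1 - a ^+ n) 1.
  have geo : null_seq (fun n => 1 * (1 - c^-1) ^+ n) by apply: null_seq_geo; rewrite ?q0.
  apply: tends_le_nrm geo => n; rewrite addrAC subrr add0r nrmN mul1r.
  by rewrite (le_trans (nrmX _ _)) // lerXn2r ?nnegrE ?nrm_ge0.
have xE : x = c%:C *: (1 - a).
  by rewrite /a opprB addrCA subrr addr0 scalerC divff ?gt_eqF // scale1C.
have e1 : (1 - a) * y = 1.
  by apply: (tends_uniq (tendsMl (1 - a) Sy)); apply: tends_ext an0 => n; rewrite aS.
have e2 : y * (1 - a) = 1.
  by apply: (tends_uniq (tendsMr (1 - a) Sy)); apply: tends_ext an0 => n; rewrite Sa.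
apply/unitrP; exists (c^-1%:C *: y).
rewrite xE -!scalerAl -!scalerAr !scalerC e1 e2 (mulrC c^-1).
by rewrite divff ?gt_eqF // !scale1C.
Qed.

(** <x^-1 xi, xi> is the supremum over eta of 2 <xi, eta> - <x eta, eta>, from
    which inversion reverses the order. *)
Lemma qf_inv_variational x xi eta : sa x -> x \is a GRing.unit -> ople 0 x ->
  2 * rdot xi eta <= qf x eta + qf x^-1 xi.
Proof.
move=> hx ux h; have := h (eta - op x^-1 xi); rewrite qf0 /qf -!/(op _ _).
rewrite op_vD op_vN -opM mulrV // op1 !(rdotDl, rdotDr, rdotNl, rdotNr).
by rewrite (rdot_adj x eta (op x^-1 xi)) hx -opM mulrV // op1 (rdotC eta xi) (rdotC xi (op x^-1 xi)); lra.
Qed.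

Lemma ople_inv x y : sa x -> sa y -> x \is a GRing.unit -> y \is a GRing.unit ->
  ople 0 x -> ople x y -> ople y^-1 x^-1.
Proof.
move=> hx hy ux uy x0 xy xi.
have := qf_inv_variational xi (op y^-1 xi) hx ux x0.
have := xy (op y^-1 xi).
have -> : qf y (op y^-1 xi) = qf y^-1 xi.
  by rewrite /qf -!/(op _ _) -opM mulrV // op1 rdotC.
rewrite (rdotC xi) -[rdot (op y^-1 xi) xi]/(qf y^-1 xi); lra.
Qed.

Lemma ople_1_inv x : sa x -> x \is a GRing.unit -> ople 0 x -> ople (1 - x^-1) (x - 1).
Proof.
move=> hx ux x0 xi; have := qf_inv_variational xi xi hx ux x0.
by rewrite !qfD !qfN !qf1; lra.
Qed.

End StrongLimits.

(** * L2-completeness of norm balls *)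

Section Normality.
Variables (R : realType) (A : vonNeumannAlgebra R) (tau : {scalar A}).
Hypothesis htau : normal_faithful_tracial_state tau.
Local Open Scope complex_scope.
Local Notation tr := (trace_re tau).
Local Notation n2 := (l2_norm tau).
Local Notation op := (@vop R A).

Lemma op_leP (x y : A) : sa x -> sa y -> op_le x y <-> ople x y.
Proof.
move=> hx hy; split=> [/positive_ople|] h; first by apply/ople_subr.
by apply: positiveP; [exact: saB|apply/ople_subr].
Qed.

(** Normality is about suprema in the algebra: the strong limit of an increasing
    sequence is its supremum, as the order is tested on vectors. *)
Lemma tr_normal (u : nat -> A) x c : (forall n, [/\ sa (u n), ople 0 (u n) & ople (u n) 1]) ->
  (forall n, ople (u n.+1) (u n)) -> stends u x -> (forall n, ople x (u n)) -> sa x ->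
  (forall n, tr (1 - u n) <= c) -> tr (1 - x) <= c.
Proof.
move=> hu dec ux xu hx uc.
pose D := range (fun n => 1 - u n).
have hD n : sa (1 - u n) by apply: saB; [exact: sa1|have [] := hu n].
have hs : sa (1 - x) by apply: saB => //; exact: sa1.
rewrite -lecR -tau_sa //; apply: (tau_normal htau (D := D)).
- by move=> _ [n _ <-]; exact: hD.
- split; first by exists (1 - u 0), 0.
  move=> _ _ [n _ <-] [m _ <-]; exists (1 - u (maxn n m)).
  have le k : (k <= maxn n m)%N -> op_le (1 - u k) (1 - u (maxn n m)).
    move=> km; apply/op_leP => // xi; rewrite !qfD !qfN lerD2l lerN2.
    by apply: (noninc_le (r := fun n => qf (u n) xi)) => // j; exact: dec.
  split; [by exists (maxn n m)|exact/le/leq_maxl|exact/le/leq_maxr].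
- split=> // [_ [n _ <-]|y hy yu].
    by apply/op_leP => // xi; rewrite !qfD !qfN lerD2l lerN2; exact: xu.
  apply/op_leP => //; apply: (stends_le (stendsB (stends_cst 1) ux) (stends_cst y)) => n.
  by apply/op_leP => //; apply: yu; exists n.
- by move=> _ [n _ <-]; rewrite tau_sa // lecR.
Qed.

Section Completeness.
Variables (x : nat -> A) (c : R).
Hypothesis hx : forall n, sa (x n).
Hypothesis xc : forall n, nrm (x n) <= c.
Hypothesis x_fast : forall n, n2 (x n.+1 - x n) <= 4^-1 ^+ n.

(** A noncommutative Egorov argument.  The sums Y m j of 4^k d_k^2
    from k = m on need not stay bounded as j grows, but the weights b m j
    decrease to strong limits B m.  The latter satisfy
    nrm (d_n (B m)) <= 2^-n for n >= m and tr (1 - B m) <= 2 4^-m: the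
    sequence x converges in operator norm after multiplication by B m, which
    is close to 1 in trace. *)
Let d n := x n.+1 - x n.
Let Y m j : A := \sum_(k < j) (4 ^+ (m + k) : R)%:C *: (d (m + k)%N * d (m + k)%N).
Let b m j : A := (1 + Y m j)^-1.

Lemma d_sa n : sa (d n). Proof. exact: saB. Qed.

Lemma Y_S m j : Y m j.+1 = Y m j + (4 ^+ (m + j) : R)%:C *: (d (m + j)%N * d (m + j)%N).
Proof. by rewrite /Y big_ord_recr. Qed.

Lemma wd_ge0 n : ople 0 ((4 ^+ n : R)%:C *: (d n * d n)).
Proof.
move=> xi; rewrite qf0 qfZ mulr_ge0 ?exprn_ge0 //.
by have := ople_sq (d_sa n) xi; rewrite qf0.
Qed.

Lemma Y_sa m j : sa (Y m j).
Proof.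
elim: j => [|j ih]; first by rewrite /Y big_ord0; exact: sa0.
by rewrite Y_S; apply: saD => //; apply/saZ/sa_sq/d_sa.
Qed.

Lemma Y_mono m j : ople (Y m j) (Y m j.+1).
Proof. by move=> xi; rewrite Y_S qfD lerDl; have := wd_ge0 (m + j) xi; rewrite qf0. Qed.

Lemma Y_ge0 m j : ople 0 (Y m j).
Proof.
elim: j => [|j ih]; first by rewrite /Y big_ord0; exact: ople_refl.
exact: ople_trans ih (Y_mono m j).
Qed.

Lemma Y_shift m j : ople (Y m.+1 j) (Y m j.+1).
Proof.
have e : Y m j.+1 = (4 ^+ m : R)%:C *: (d m * d m) + Y m.+1 j.
  rewrite /Y big_ord_recl addn0; congr (_ + _).
  by apply: eq_bigr => k _; rewrite lift0 addSnnS.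
move=> xi; rewrite e qfD.
by rewrite lerDr; have := wd_ge0 m xi; rewrite qf0.
Qed.

Lemma Y_term m j k : (k < j)%N ->
  ople ((4 ^+ (m + k) : R)%:C *: (d (m + k)%N * d (m + k)%N)) (Y m j).
Proof.
elim: j => // j ih; rewrite ltnS leq_eqVlt => /predU1P[->|kj].
  by move=> xi; rewrite Y_S qfD lerDr; have := Y_ge0 m j xi; rewrite qf0.
exact: ople_trans (ih kj) (Y_mono m j).
Qed.

Lemma tr_Y m j : tr (Y m j) <= 2 * 4^-1 ^+ m - 2 * 4^-1 ^+ (m + j).
Proof.
elim: j => [|j ih]; first by rewrite /Y big_ord0 addn0 subrr tr0.
rewrite Y_S trD trZ -(ip_sa tau _ (d_sa _)) -n2_sqr // addnS.
have q0 : 0 <= (4^-1 : R) ^+ (m + j) by rewrite exprn_ge0 ?invr_ge0.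
have h : n2 (d (m + j)%N) ^+ 2 <= 4^-1 ^+ (m + j) * 4^-1 ^+ (m + j).
  by rewrite -expr2 lerXn2r ?nnegrE ?n2_ge0 // x_fast.
have p0 : 0 <= (4 : R) ^+ (m + j) by rewrite exprn_ge0.
have h' := ler_wpM2l p0 h.
have e : (4 : R) ^+ (m + j) * 4^-1 ^+ (m + j) = 1.
  by rewrite -exprMn divff ?expr1n // pnatr_eq0.
rewrite [leRHS]mulrA e mul1r in h'.
rewrite (exprS 4^-1); move: h' ih q0; set q := (4^-1 : R) ^+ (m + j); lra.
Qed.

Lemma X_props m j : [/\ sa (1 + Y m j), ople 1 (1 + Y m j), ople 0 (1 + Y m j) &
  1 + Y m j \is a GRing.unit].
Proof.
have h1 : sa (1 + Y m j) by apply: saD; [exact: sa1|exact: Y_sa].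
have h2 : ople 1 (1 + Y m j).
  by move=> xi; rewrite qfD lerDl; have := Y_ge0 m j xi; rewrite qf0.
have h3 : ople 0 (1 + Y m j).
  by apply: ople_trans h2 => xi; rewrite qf0 qf1 rdot_ge0.
by split=> //; exact: unit_ge1.
Qed.

Lemma b_props m j : [/\ sa (b m j), ople 0 (b m j) & ople (b m j) 1].
Proof.
have [h1 h2 h3 h4] := X_props m j; split; first exact: sa_inv.
  exact: ople_inv0.
rewrite -[X in ople _ X]invr1; apply: ople_inv => //; first exact: sa1.
  exact: unitr1.
by move=> xi; rewrite qf0 qf1 rdot_ge0.
Qed.

Lemma b_anti m j m' j' : ople (Y m j) (Y m' j') -> ople (b m' j') (b m j).
Proof.
move=> h; have [h1 h2 h3 h4] := X_props m j; have [k1 k2 k3 k4] := X_props m' j'.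
by apply: ople_inv => // xi; rewrite !qfD lerD2l.
Qed.

Lemma tr_1b m j : tr (1 - b m j) <= 2 * 4^-1 ^+ m.
Proof.
have [h1 h2 h3 h4] := X_props m j; have [k1 k2 k3] := b_props m j.
apply: (@le_trans _ _ (tr (Y m j))).
  apply: tr_le => //; first by apply: saB => //; exact: sa1.
    exact: Y_sa.
  by have := ople_1_inv h1 h4 h3; rewrite [X in ople _ X]addrAC subrr add0r.
by rewrite (le_trans (tr_Y m j)) // lerBlDr lerDl mulr_ge0 // exprn_ge0 // invr_ge0.
Qed.

(** 4^n d_n^2 <= Y and b Y b = b - b^2 <= 1. *)
Lemma db_bound m j n (xi : vn_hilbert A) : (m <= n)%N -> (n < m + j)%N ->
  nrm (op (d n) (op (b m j) xi)) <= 2^-1 ^+ n * nrm xi.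
Proof.
move=> mn nj; have kj : (n - m < j)%N by rewrite ltn_subLR.
have := Y_term m kj; rewrite subnKC // => hY.
have [h1 h2 h3 h4] := X_props m j; have [k1 k2 k3] := b_props m j.
have p0 : 0 <= (2^-1 : R) ^+ n by rewrite exprn_ge0 ?invr_ge0.
apply: sqr_le_le; first by rewrite mulr_ge0 ?nrm_ge0.
rewrite exprMn !nrm_sqr_rdot -qf_starM d_sa.
set eta := op (b m j) xi.
have := hY eta; rewrite qfZ => hq.
have hq2 : qf (Y m j) eta <= rdot xi xi.
  have e1 : qf (Y m j) eta = qf (1 + Y m j) eta - rdot eta eta by rewrite qfD qf1 addrC addKr.
  have e2 : qf (1 + Y m j) eta = qf (b m j) xi.
    rewrite /qf -!/(op _ _) /eta -opM mulrV // op1 rdotC //.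
  rewrite e1 e2; have := k3 xi; have := rdot_ge0 eta; rewrite qf1; lra.
rewrite -(@ler_pM2l _ (4 ^+ n)) ?exprn_gt0 // (le_trans hq) // (le_trans hq2) //.
rewrite mulrA -exprM mulnC exprM -exprMn.
by rewrite (_ : 4 * 2^-1 ^+ 2 = 1) ?expr1n ?mul1r // expr2; lra.
Qed.

(** For each m the x_n (B m) converge in norm.  As B m increases strongly to 1
    and the x_n are bounded, the x_n converge strongly; the limit l belongs to
    the algebra and to the ball.  To bound tr ((x_n - l)^2), write
    1 = B n + (1 - B n): the first part is small since (x_n - l) (B n) is small
    in norm, the second since tr (1 - B n) is. *)
Lemma l2_complete : exists l, [/\ sa l, nrm l <= c & null_seq (fun n => n2 (x n - l) ^+ 2)].
Proof.
have c0 : 0 <= c := le_trans (nrm_ge0 _) (xc 0).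
have bm m : exists y, [/\ stends (b m) y, sa y, ople 0 y & forall j, ople y (b m j)].
  by apply: monotone_strong => j; [exact: b_props|apply: b_anti; exact: Y_mono].
have [B hB] := choice bm.
have B1 m : ople (B m) 1.
  by have [_ _ _ h] := hB m; have [_ _ k] := b_props m 0; exact: ople_trans (h 0) k.
have Bsa m : sa (B m) by have [] := hB m.
have Bmono m : ople (B m) (B m.+1).
  have [h1 _ _ _] := hB m; have [k1 _ _ _] := hB m.+1.
  apply: (stends_le (stends_sub (f := S) (fun n => leqnSn n) h1) k1) => j.
  by apply: b_anti; exact: Y_shift.
have B1sa m : sa (1 - B m) by apply: saB => //; exact: sa1.
have B1ge0 m : ople 0 (1 - B m) by apply/ople_subr.
have trB1 m : tr (1 - B m) <= 2 * 4^-1 ^+ m.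
  have [h1 h2 h3 h4] := hB m.
  apply: (tr_normal (b_props m) _ h1 h4 h2) => j; last exact: tr_1b.
  by apply: b_anti; exact: Y_mono.
have [||C [hC Csa C0 Cle]] := @monotone_strong _ _ (fun m => 1 - B m).
- move=> m; split=> // xi; rewrite qfD qfN gerDl oppr_le0.
  by have [_ _ h _] := hB m; have := h xi; rewrite qf0.
- by move=> m xi; rewrite !qfD !qfN lerD2l lerN2; exact: Bmono.
(* the 1 - B m decrease to an element of trace 0, hence to 0 by faithfulness *)
have Cz : C = 0.
  have trC0 : tr C <= 0.
    apply: (null_seq_bound (r := fun m => 2 * 4^-1 ^+ m)).
      by apply: null_seq_geo => //; rewrite invr_ge0 ler0n /= invf_lt1 ?ltr1n.
    by move=> m; rewrite (le_trans _ (trB1 m)) // tr_le.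
  have [g gE] := positiveP Csa C0.
  rewrite gE (ip_eq0 htau (x := g)) ?mulr0 //.
  by apply/le_anti; rewrite ip_ge0 // andbT /l2_dot -gE.
have Bid xi : null_seq (fun m => nrm (xi - op (B m) xi)).
  apply: null_seq_le (hC xi) => m.
  by rewrite Cz op0 subr0 opB op1.
have dB m n : (m <= n)%N -> nrm (d n * B m) <= 2^-1 ^+ n.
  move=> mn; have p0 : 0 <= (2^-1 : R) ^+ n by rewrite exprn_ge0 ?invr_ge0.
  apply: nrm_lub => // xi; rewrite opM -!nrm_sqr_rdot -exprMn.
  rewrite lerXn2r ?nnegrE ?mulr_ge0 ?nrm_ge0 //.
  have [h1 _ _ _] := hB m.
  have h2 := stends_sub (f := addn n.+1) (fun j => leq_addl _ j) h1.
  apply: (tends_nrm_le (tends_op (d n) (h2 xi))) => j.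
  by apply: db_bound => //; rewrite addnC ltn_addr // ltn_addr.
have tele m : exists w, tends (fun k => x (m + k)%N * B m) w /\
    forall k, nrm (w - x (m + k)%N * B m) <= 2 * 2^-1 ^+ (m + k).
  apply: telescoping_tends.
  - by move=> k; rewrite mulr_ge0 ?exprn_ge0 ?invr_ge0.
  - have := null_seq_pow2 (@ler0n R 2); move=> /(null_seq_comp (f := addn m) (fun k => leq_addl _ k)).
    exact.
  - move=> k; rewrite -mulrBl addnS (le_trans (dB m _ (leq_addr _ _))) //.
    rewrite exprS mulrA divff ?pnatr_eq0 // mul1r; set q := _ ^+ _; lra.
have [l hl lc] : exists2 l, stends x l & nrm l <= c.
  apply: strong_complete => // xi; apply: complete_seq => e e0.
  have c1 : 0 < c + 1 by lra.
  have n1 : 0 < nrm xi + 1 by rewrite ltr_wpDl ?nrm_ge0.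
  have e4 : 0 < e / 4 by rewrite divr_gt0.
  have [m hm] := Bid xi _ (divr_gt0 e4 c1); have {}hm := hm m (leqnn m).
  have [w [hw _]] := tele m.
  have [N hN] := hw _ (divr_gt0 e4 n1); exists (m + N)%N.
  have half p : (m + N <= p)%N -> nrm (op (x p) xi - op w xi) <= e / 4 + e / 4.
    move=> pN; have mp : (m <= p)%N by rewrite (leq_trans _ pN) // leq_addr.
    rewrite (le_trans (nrm_dist _ (op (x p) (op (B m) xi)) _)) // lerD //.
      rewrite -op_vN -op_vD (le_trans (nrm_op _ _)) //.
      apply: (@le_trans _ _ ((c + 1) * (e / 4 / (c + 1)))).
        by rewrite ler_pM ?nrm_ge0 ?nrm_ge0 // (le_trans (xc p)) // lerDl.
      by rewrite mulrC divfK // gt_eqF.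
    have := hN (p - m)%N; rewrite leq_subRL // subnKC // => /(_ pN) h.
    rewrite -opM -opB (le_trans (nrm_op _ _)) //.
    apply: (@le_trans _ _ (e / 4 / (nrm xi + 1) * (nrm xi + 1))).
      by rewrite ler_pM ?nrm_ge0 ?nrm_ge0 // lerDl.
    by rewrite divfK // gt_eqF.
  move=> p q pN qN; rewrite (le_trans (nrm_dist _ (op w xi) _)) //.
  rewrite (nrm_distC (op w xi)) (le_trans (lerD (half _ pN) (half _ qN))) //; lra.
have lsa : sa l := stends_sa hx hl.
exists l; split=> //.
have lB n : nrm ((x n - l) * B n) <= 4 * 2^-1 ^+ n.
  rewrite -nrmN -mulNr opprB.
  have [w [hw wb]] := tele n.
  have p0 : 0 <= (2^-1 : R) ^+ n by rewrite exprn_ge0 ?invr_ge0.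
  have h := stendsMr (B n) (stendsB (stends_sub (f := addn n) (fun k => leq_addl _ k) hl) (stends_cst (x n))).
  apply: (stends_nrm_le _ h); first by rewrite mulr_ge0.
  move=> k; rewrite mulrBl (le_trans (nrm_dist _ w _)) // nrm_distC.
  have := wb k; have := wb 0; rewrite addn0 => w0 wk.
  have le2 : (2^-1 : R) ^+ (n + k) <= 2^-1 ^+ n.
    by rewrite exprD ler_piMr // exprn_ile1 ?invr_ge0 ?invf_le1 ?ler1n.
  by rewrite (le_trans (lerD wk w0)) //; lra.
pose M := 2 * c * 4 + (2 * c) ^+ 2 * 2.
have M0 : 0 <= M by rewrite addr_ge0 ?mulr_ge0 ?exprn_ge0 ?mulr_ge0.
apply: null_seq_le (null_seq_pow2 M0) => n.
have hz : sa (x n - l) by exact: saB.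
have zc : nrm (x n - l) <= 2 * c.
  by rewrite (le_trans (nrmB _ _)) // (le_trans (lerD (xc n) lc)) //; lra.
rewrite n2_sqr // (ip_sa tau _ hz).
have -> : tr ((x n - l) * (x n - l)) = tr ((x n - l) * (x n - l) * B n) +
    tr ((x n - l) * (x n - l) * (1 - B n)).
  by rewrite -trD -mulrDr subrKC mulr1.
rewrite /M [leRHS]mulrDl.
have p0 : 0 <= (2^-1 : R) ^+ n by rewrite exprn_ge0 ?invr_ge0.
apply: lerD.
  rewrite (le_trans (ler_norm _)) // (le_trans (tr_le_nrm htau _)) //.
  by rewrite -mulrA -[leRHS]mulrA nrmM_le.
(* with 1 - B n = g^2, the second part is ||(x_n - l) g||^2 *)
have [g [gsa _ gg]] := sqrt_exists (B1sa n) (B1ge0 n).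
rewrite -gg mulrA (trC htau) !mulrA.
have -> : g * (x n - l) * (x n - l) * g = star ((x n - l) * g) * ((x n - l) * g).
  by rewrite starM hz gsa !mulrA.
rewrite -/(l2_dot tau _ _) -n2_sqr //.
have le1 : n2 ((x n - l) * g) <= 2 * c * n2 g.
  by rewrite (le_trans (n2Ml htau _ _)) // ler_wpM2r ?n2_ge0.
have le2 : n2 ((x n - l) * g) ^+ 2 <= (2 * c * n2 g) ^+ 2.
  by rewrite lerXn2r ?nnegrE ?n2_ge0 ?mulr_ge0 ?n2_ge0.
rewrite (le_trans le2) // exprMn n2_sqr // (ip_sa tau _ gsa) gg -mulrA.
rewrite ler_wpM2l ?exprn_ge0 ?mulr_ge0 // (le_trans (trB1 n)) // ler_wpM2l //.
by rewrite lerXn2r ?nnegrE ?invr_ge0 // lef_pV2 ?posrE ?ler_nat.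
Qed.
End Completeness.
End Normality.

(** * Boundedness of the orthogonal projection *)

(** The H-component along S; the value outside the selfadjoint elements is
    arbitrary. *)
Definition ortho_proj (R : realType) (A : vonNeumannAlgebra R) (H S : set A)
  (x : A) : A := xget 0 [set h | H h /\ S (x - h)].

Section Projection.
Variables (R : realType) (A : vonNeumannAlgebra R) (tau : {scalar A}).
Hypothesis htau : normal_faithful_tracial_state tau.
Local Open Scope complex_scope.
Local Notation tr := (trace_re tau).
Local Notation n2 := (l2_norm tau).
Local Notation ip := (l2_dot tau).
Variables (H S : set A).
Local Notation hproj := (ortho_proj H S).
Hypotheses (hH : closed_real_subspace H) (hS : closed_orthogonal_supplement tau H S).
Implicit Types (x y z h s : A).

Lemma H_sa h : H h -> sa h. Proof. by have [k _ _ _] := hH; exact: k. Qed.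
Lemma S_sa s : S s -> sa s. Proof. by have [[k _ _ _] _ _] := hS; exact: k. Qed.
Lemma H_0 : H 0. Proof. by have [_ k _ _] := hH. Qed.
Lemma H_Z (t : R) h : H h -> H (t%:C *: h).
Proof. by move=> hh; have [_ h0 k _] := hH; have := k t h 0 hh h0; rewrite addr0. Qed.
Lemma H_D h k : H h -> H k -> H (h + k).
Proof. by move=> hh hk; have [_ _ l _] := hH; have := l 1 h k hh hk; rewrite scale1C. Qed.
Lemma H_N h : H h -> H (- h).
Proof. by move=> hh; have := H_Z (-1) hh; rewrite scaleNC scale1C. Qed.
Lemma H_B h k : H h -> H k -> H (h - k).
Proof. by move=> hh hk; apply: H_D => //; exact: H_N. Qed.
Lemma S_Z (t : R) s : S s -> S (t%:C *: s).
Proof. by move=> hs; have [[_ h0 k _] _ _] := hS; have := k t s 0 hs h0; rewrite addr0. Qed.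
Lemma S_D s k : S s -> S k -> S (s + k).
Proof. by move=> hh hk; have [[_ _ l _] _ _] := hS; have := l 1 s k hh hk; rewrite scale1C. Qed.
Lemma S_B s k : S s -> S k -> S (s - k).
Proof.
by move=> hh hk; apply: S_D => //; have := S_Z (-1) hk; rewrite scaleNC scale1C.
Qed.

Lemma HS_ortho h s : H h -> S s -> tr (h * s) = 0.
Proof. by move=> hh hs; have [_ _ k] := hS; rewrite /trace_re k. Qed.

Lemma HS_decomp x : sa x -> exists2 h, H h & S (x - h).
Proof.
move=> hx; have [_ [_ e] _] := hS.
have : (@selfadjoint R A) x by [].
by rewrite e => -[h hh [s hs <-]]; exists h => //; rewrite addrC addKr.
Qed.

Lemma projP x : sa x -> H (hproj x) /\ S (x - hproj x).
Proof.
move=> hx; have [h h1 h2] := HS_decomp hx.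
by apply: (@xgetPex A 0 [set h : A | H h /\ S (x - h)]); exists h.
Qed.

Lemma proj_uniq x h : sa x -> H h -> S (x - h) -> hproj x = h.
Proof.
move=> hx hh hs; have [p1 p2] := projP hx; have [_ [HS _] _] := hS.
have : (H `&` S) (hproj x - h).
  split; first exact: H_B.
  by have := S_B hs p2; rewrite opprB addrC addrA subrK addrC.
by rewrite HS /= => /eqP; rewrite subr_eq0 => /eqP.
Qed.

Lemma proj_sa x : sa x -> sa (hproj x).
Proof. by move=> hx; have [/H_sa h _] := projP hx. Qed.

Lemma proj_H h : H h -> hproj h = h.
Proof.
move=> hh; apply: proj_uniq => //; first exact: H_sa.
by rewrite subrr; have [[_ k _ _] _ _] := hS.
Qed.

Lemma projD x y : sa x -> sa y -> hproj (x + y) = hproj x + hproj y.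
Proof.
move=> hx hy; have [p1 p2] := projP hx; have [q1 q2] := projP hy.
apply: proj_uniq; [exact: saD|exact: H_D|].
by rewrite opprD addrACA; exact: S_D.
Qed.

Lemma projZ (t : R) x : sa x -> hproj (t%:C *: x) = t%:C *: hproj x.
Proof.
move=> hx; have [p1 p2] := projP hx.
by apply: proj_uniq; [exact: saZ|exact: H_Z|rewrite -scalerBr; exact: S_Z].
Qed.

Lemma projB x y : sa x -> sa y -> hproj (x - y) = hproj x - hproj y.
Proof.
move=> hx hy; rewrite projD //; last exact: saN.
by have := projZ (-1) hy; rewrite !scaleNC !scale1C => ->.
Qed.

Lemma ip_proj x : sa x -> ip x (hproj x) = ip (hproj x) (hproj x).
Proof.
move=> hx; have [p1 p2] := projP hx.
rewrite -{1}(subrK (hproj x) x) ipDl ipC // [X in X + _](_ : _ = 0) ?add0r //.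
by rewrite ip_sa ?HS_ortho //; exact: proj_sa.
Qed.

Lemma n2_proj x : sa x -> n2 (hproj x) <= n2 x.
Proof.
move=> hx; apply: n2_le; rewrite ?n2_ge0 // n2_sqr //.
have := ip_ge0 htau (x - hproj x); rewrite !ipE // (ipC htau (hproj x) x) ip_proj //; lra.
Qed.

(** If x is orthogonal to S then so is its S-component, as H is orthogonal
    to S, so this component is orthogonal to itself. *)
Lemma H_ortho x : sa x -> (forall s, S s -> tr (s * x) = 0) -> H x.
Proof.
move=> hx h; have [p1 p2] := projP hx.
suff /eqP : x - hproj x = 0 by rewrite subr_eq0 => /eqP ->.
apply: (ip_eq0 htau); rewrite ip_sa; last exact: S_sa.
by rewrite mulrBr trB h // trC // HS_ortho // subrr.
Qed.

(** Projections of a sequence converging to x in norm converge to that of x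
    for the L2 norm, which the projection does not increase; and a norm ball
    is L2-complete. *)
Lemma proj_ball_closed (n : R) x : sa x ->
  (forall e, 0 < e -> exists z, [/\ sa z, nrm (z - x) <= e & nrm (hproj z) <= n]) ->
  nrm (hproj x) <= n.
Proof.
move=> hx h.
have q0 (k : nat) : 0 < (4^-1 : R) ^+ k by rewrite exprn_gt0 ?invr_gt0.
have hz (k : nat) : exists z, [/\ sa z, nrm (z - x) <= 4^-1 ^+ k / 2 & nrm (hproj z) <= n].
  by apply: h; rewrite divr_gt0.
have [z zP] := choice hz.
have zsa (k : nat) : sa (z k) by have [] := zP k.
have zx (k : nat) : nrm (z k - x) <= 4^-1 ^+ k / 2 by have [] := zP k.
have [|||l [lsa ln lz]] := @l2_complete _ _ _ htau (fun k => hproj (z k)) n.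
- by move=> k; exact: proj_sa.
- by move=> k; have [] := zP k.
- move=> k; rewrite -projB // (le_trans (n2_proj _)) //; first exact: saB.
  rewrite (le_trans (n2_le_nrm htau _)) // (le_trans (nrm_dist _ x _)) //.
  rewrite (nrm_distC x) (le_trans (lerD (zx _) (zx _))) //.
  by rewrite (exprS 4^-1); have := q0 k; lra.
suff -> : hproj x = l by [].
apply/eqP; rewrite -subr_eq0; apply/eqP/(ip_eq0 htau)/le_anti; rewrite ip_ge0 // andbT.
have g0 : null_seq (fun k => 2 * (4^-1 : R) ^+ k).
  by apply: null_seq_geo => //; rewrite invr_ge0 ler0n /= invf_lt1 ?ltr1n.
rewrite -n2_sqr //.
apply: (null_seq_bound (null_seqD g0 (null_seqZ (ler0n R 2) lz))) => k.
have h1 : n2 (hproj x - hproj (z k)) <= 4^-1 ^+ k / 2.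
  rewrite -projB // (le_trans (n2_proj _)) //; first exact: saB.
  by rewrite (le_trans (n2_le_nrm htau _)) // nrm_distC.
have h2 := n2_dist htau (hproj x) (hproj (z k)) l.
set a := n2 (hproj x - l) in h2 *; set b := n2 (hproj x - _) in h1 h2.
set d := n2 (hproj (z k) - l) in h2 *.
have a0 : 0 <= a := n2_ge0 _ _; have b0 : 0 <= b := n2_ge0 _ _; have d0 : 0 <= d := n2_ge0 _ _.
have q1 : (4^-1 : R) ^+ k <= 1 by rewrite exprn_ile1 ?invr_ge0 ?invf_le1 ?ler1n.
have b2 : b ^+ 2 <= 4^-1 ^+ k by have := q0 k; nra.
have : a ^+ 2 <= (b + d) ^+ 2 by rewrite lerXn2r ?nnegrE ?addr_ge0.
have := sqr_ge0 (b - d); nra.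
Qed.

(** Baire category, with explicit nested balls: if the projection is unbounded,
    each ball contains a smaller one on which its norm exceeds n, by
    [proj_ball_closed], and it would be infinite at the common point. *)
Lemma proj_bounded : exists2 C : R, 0 <= C & forall x, sa x -> nrm (hproj x) <= C * nrm x.
Proof.
apply: contrapT => unb.
have big (C : R) : 0 <= C -> exists x, [/\ sa x, nrm x <= 1 & C < nrm (hproj x)].
  move=> C0; apply: contrapT => /forallNP k; apply: unb; exists C => // x hx.
  have [x0|x0] := eqVneq (nrm x) 0.
    by rewrite (nrm_eq0 x0) proj_H ?nrm0 ?mulr0 //; exact: H_0.
  have xp : 0 < nrm x by rewrite lt_neqAle eq_sym x0 nrm_ge0.
  have := k ((nrm x)^-1%:C *: x) => /not_and3P[||]; first by case; exact: saZ.
    by rewrite nrmZ ger0_norm ?invr_ge0 ?nrm_ge0 // mulVf // lexx.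
  move=> /negP; rewrite -leNgt projZ // nrmZ ger0_norm ?invr_ge0 ?nrm_ge0 //.
  by rewrite mulrC ler_pdivrMr.
(* a pair is a ball given by centre and radius; Q relates it to the next one *)
pose Q (n : nat) (p p' : A * R) := sa p.1 -> 0 < p.2 ->
  [/\ sa p'.1, 0 < p'.2, p'.2 <= p.2 / 2, nrm (p'.1 - p.1) <= p.2 / 2 &
      forall z, sa z -> nrm (z - p'.1) <= p'.2 -> n%:R < nrm (hproj z)].
have step n p : exists p', Q n p p'.
  have [[hy r0]|hn] := pselect (sa p.1 /\ 0 < p.2); last first.
    by exists p => h1 h2; case: hn.
  case: p hy r0 => y r /= hy r0.
  have [y' [hy' yy' ny']] : exists y', [/\ sa y', nrm (y' - y) <= r / 2 & n%:R < nrm (hproj y')].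
    have [ly|ny] := ltP n%:R (nrm (hproj y)).
      by exists y; rewrite subrr nrm0 divr_ge0 // ltW.
    have r20 : 0 < r / 2 by rewrite divr_gt0.
    have C0 : 0 <= 2 * n%:R / (r / 2) :> R by rewrite divr_ge0 ?mulr_ge0 // ltW.
    have [x [hx x1 nx]] := big _ C0.
    have hx' : sa ((r / 2 : R)%:C *: x) by exact: saZ.
    exists (y + (r / 2 : R)%:C *: x); split; first exact: saD.
      by rewrite addrC addKr nrmZ (ger0_norm (ltW r20)) ler_piMr // ltW.
    rewrite projD // projZ //.
    have := nrmB (hproj y + (r / 2 : R)%:C *: hproj x) (hproj y).
    rewrite addrC addKr nrmZ (ger0_norm (ltW r20)).
    by move: nx; rewrite ltr_pdivrMr // (mulrC _ (r / 2)); lra.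
  have [r' [r'0 hr']] : exists r' : R, 0 < r' /\ forall z, sa z ->
      nrm (z - y') <= r' -> n%:R < nrm (hproj z).
    apply: contrapT => /forallNP k; move: ny'; rewrite ltNge => /negP; apply.
    apply: proj_ball_closed => // e e0.
    have /not_andP[//|/existsNP[z]] := k e.
    move=> /not_implyP[hz /not_implyP[ze /negP]]; rewrite -leNgt => zn.
    by exists z.
  exists (y', Num.min r' (r / 2)) => _ _ /=; split=> //.
  - by rewrite lt_min r'0 divr_gt0.
  - by rewrite ge_min lexx orbT.
  - by move=> z hz; rewrite le_min => /andP[zr _]; exact: hr'.
have [F hF] := choice (fun np : nat * (A * R) => step np.1 np.2).
pose fix q n : A * R := if n is n'.+1 then F (n', q n') else (0, 1).
have qP n : sa (q n).1 /\ 0 < (q n).2.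
  elim: n => [|n [h1 h2]]; first by split; [exact: sa0|exact: ltr01].
  by have [] := hF (n, q n) h1 h2.
have qS n : [/\ (q n.+1).2 <= (q n).2 / 2, nrm ((q n.+1).1 - (q n).1) <= (q n).2 / 2 &
   forall z, sa z -> nrm (z - (q n.+1).1) <= (q n.+1).2 -> n%:R < nrm (hproj z)].
  by have [h1 h2] := qP n; have [] := hF (n, q n) h1 h2.
have qle n : (q n).2 <= 1 * 2^-1 ^+ n.
  elim: n => [|n ih]; first by rewrite expr0 mulr1.
  have [h _ _] := qS n; rewrite (le_trans h) // mul1r exprSr ler_wpM2r ?invr_ge0 //.
  by rewrite mul1r in ih.
have [|||y [ty yb]] := @telescoping_tends _ _ (fun n => (q n).1) (fun n => (q n).2).
- by move=> n; have [_ /ltW] := qP n.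
- exact: null_seq_le qle (null_seq_pow2 (@ler01 R)).
- by move=> n; have [h1 h2 _] := qS n; lra.
have hy : sa y by apply: (tends_sa _ ty) => n; have [] := qP n.
have big_y n : n%:R < nrm (hproj y).
  by have [_ _ h] := qS n; apply: h => //; exact: yb.
have := big_y (Num.bound (nrm (hproj y))).
by rewrite ltNge => /negP; apply; rewrite ltW // archi_boundP ?nrm_ge0.
Qed.

End Projection.

(** * L2-continuity of the distance *)

Section L2Lipschitz.
Variables (R : realType) (A : vonNeumannAlgebra R) (tau : {scalar A}).
Hypothesis htau : normal_faithful_tracial_state tau.
Local Open Scope complex_scope.
Local Notation n2 := (l2_norm tau).
Local Notation dst := (exp_dist tau).
Local Notation half := ((2^-1 : R)%:C).
Implicit Types (x y z h l u v w : A).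

Lemma n2_sum (n : nat) (F : 'I_n -> A) : n2 (\sum_(i < n) F i) <= \sum_(i < n) n2 (F i).
Proof.
elim/big_rec2: _ => [|i p q _ h]; first by rewrite n2_0.
by rewrite (le_trans (n2D htau _ _)) // lerD2l.
Qed.

Lemma tends_n2_le (u : nat -> A) l (c : R) : tends u l -> (forall n, n2 (u n) <= c) -> n2 l <= c.
Proof.
move=> h k; rewrite -subr_le0; apply: (null_seq_bound h) => n.
have := n2D htau (l - u n) (u n); rewrite subrK.
have := n2_le_nrm htau (l - u n); rewrite nrm_distC; have := k n; lra.
Qed.

Lemma n2_exp_lipschitz (c : R) x y : 1 <= c -> nrm x <= c -> nrm y <= c ->
  n2 (op_exp x - op_exp y) <= expR (2 * c) * n2 (x - y).
Proof.
move=> c1 xc yc; have c0 : 0 <= c by lra.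
apply: (tends_n2_le (tendsB (epart_exp x) (epart_exp y))) => n.
have pow k : n2 (x ^+ k - y ^+ k) <= k%:R * c ^+ k * n2 (x - y).
  elim: k => [|k ih]; first by rewrite !expr0 subrr n2_0 !mul0r.
  rewrite (_ : _ - _ = x * (x ^+ k - y ^+ k) + (x - y) * y ^+ k); last first.
    by rewrite mulrBr mulrBl -!exprS addrA subrK.
  have h1 : n2 (x * (x ^+ k - y ^+ k)) <= c * (k%:R * c ^+ k * n2 (x - y)).
    by rewrite (le_trans (n2Ml htau _ _)) // ler_pM ?nrm_ge0 ?n2_ge0.
  have h2 : n2 ((x - y) * y ^+ k) <= n2 (x - y) * (c * c ^+ k).
    rewrite (le_trans (n2Mr htau _ _)) // ler_wpM2l ?n2_ge0 //.
    rewrite (le_trans (nrmX _ _)) //; apply: (@le_trans _ _ (c ^+ k)).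
      by rewrite lerXn2r ?nnegrE ?nrm_ge0.
    by rewrite ler_peMl ?exprn_ge0.
  rewrite (le_trans (n2D htau _ _)) // (le_trans (lerD h1 h2)) //.
  by rewrite -(natr1 k) (exprS c k) le_eqVlt; apply/orP; left; apply/eqP; ring.
apply: (@le_trans _ _ (exp_psum (2 * c) n * n2 (x - y))); last first.
  by rewrite ler_wpM2r ?n2_ge0 // exp_psum_le // mulr_ge0.
rewrite /epart -sumrB (le_trans (n2_sum _)) // /exp_psum mulr_suml.
apply: ler_sum => k _; rewrite -scalerBr natVC n2Z // ger0_norm ?invr_ge0 // -mulrA.
rewrite ler_wpM2l ?invr_ge0 // (le_trans (pow k)) // ler_wpM2r ?n2_ge0 //.
rewrite exprMn ler_wpM2r ?exprn_ge0 // -natrX ler_nat.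
exact/ltnW/ltn_expl.
Qed.

Lemma n2_exp_rem x : n2 (op_exp x - 1 - x) <= n2 x * (nrm x * expR (nrm x)).
Proof.
have h := tends_sub (f := fun n => n.+2) (fun n => leqW (leqnSn n)) (epart_exp x).
apply: (tends_n2_le (tendsB (tendsB h (tends_cst (1 : A))) (tends_cst x))) => n.
rewrite epart1 big_ord_recl (_ : (@ord0 n).+1`! = 1%N) // invr1 scale1r expr1.
rewrite [1 + _]addrC addrK [x + _]addrC addrK (le_trans (n2_sum _)) //.
apply: (@le_trans _ _ (n2 x * (nrm x * exp_psum (nrm x) n))); last first.
  by rewrite ler_wpM2l ?n2_ge0 // ler_wpM2l ?nrm_ge0 // exp_psum_le ?nrm_ge0.
rewrite !mulr_sumr; apply: ler_sum => k _.
rewrite natVC n2Z // ger0_norm ?invr_ge0 // lift0 mulrA mulrCA.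
apply: ler_pM; rewrite ?invr_ge0 ?n2_ge0 //.
  by rewrite lef_pV2 ?posrE ?ltr0n ?fact_gt0 // ler_nat fact_le_add2.
rewrite exprS (le_trans (n2Mr htau _ _)) // -mulrA ler_wpM2l ?n2_ge0 //.
by rewrite -exprS nrmX.
Qed.

(** p - 1 = (p^2 - 1) (p + 1)^-1 for p = e^(x/2), and p + 1 >= 1. *)
Lemma n2_exp_half x : sa x -> n2 (op_exp (half *: x) - 1) <= n2 (op_exp x - 1).
Proof.
move=> hx; set p := op_exp (half *: x).
have hp : sa p by apply/sa_exp/saZ.
have p0 : ople 0 p by apply/exp_ge0/saZ.
have h1 : sa (p + 1) by apply: saD => //; exact: sa1.
have g1 : ople 1 (p + 1) by move=> xi; rewrite qfD lerDr; have := p0 xi; rewrite qf0.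
have g0 : ople 0 (p + 1) by apply: ople_trans g1 => xi; rewrite qf0 qf1 rdot_ge0.
have ug : p + 1 \is a GRing.unit := unit_ge1 h1 g1.
have ng : nrm (p + 1)^-1 <= 1.
  apply: nrm_ople => //; first exact: sa_inv.
    apply: ople_trans (ople_inv0 h1 ug g0).
    by rewrite -[X in ople _ X](scale0r 1); apply: ople_scalar; lra.
  rewrite scale1C -[X in ople _ X]invr1; apply: ople_inv => //; first exact: sa1.
    exact: unitr1.
  by move=> xi; rewrite qf0 qf1 rdot_ge0.
have e : p - 1 = (op_exp x - 1) * (p + 1)^-1.
  apply: (mulIr ug); rewrite mulrVK // (exp_half x) -/p.
  by rewrite mulrDr mulr1 mulrBl mul1r addrA subrK.
by rewrite e (le_trans (n2Mr htau _ _)) // ler_piMr ?n2_ge0.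
Qed.

(** Near 0, ||x|| <= 2 ||e^x - 1||.  A fixed number k of halvings brings the
    ball of radius c there, and [n2_exp_half] controls the right-hand side. *)
Lemma n2_le_exp_sub1 (c : R) : 0 <= c -> exists2 C : R, 0 <= C & forall x, sa x -> nrm x <= c ->
  n2 x <= C * n2 (op_exp x - 1).
Proof.
move=> c0; have e0 : 0 < 2^-1 :> R by rewrite invr_gt0.
have [k hk] := null_seq_pow2 (mulr_ge0 c0 (expR_ge0 c)) e0.
have {}hk := hk k (leqnn k).
exists (2 ^+ k * 2); first by rewrite mulr_ge0 ?exprn_ge0.
move=> x hx xc; pose v : A := (2^-1 ^+ k : R)%:C *: x.
have it j : n2 (op_exp ((2^-1 ^+ j : R)%:C *: x) - 1) <= n2 (op_exp x - 1).
  elim: j => [|j ih]; first by rewrite expr0 scale1C.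
  by rewrite exprS -scalerC (le_trans (n2_exp_half _)) //; exact: saZ.
have p0 : 0 <= (2^-1 : R) ^+ k by rewrite exprn_ge0 ?invr_ge0.
have p1 : (2^-1 : R) ^+ k <= 1 by rewrite exprn_ile1 ?invr_ge0 ?invf_le1 ?ler1n.
have nv : nrm v = 2^-1 ^+ k * nrm x by rewrite nrmZ ger0_norm.
have small : nrm v * expR (nrm v) <= 2^-1.
  apply: le_trans hk; rewrite [leRHS](_ : _ = 2^-1 ^+ k * c * expR c); last by ring.
  have vc : nrm v <= 2^-1 ^+ k * c by rewrite nv ler_wpM2l.
  rewrite ler_pM ?nrm_ge0 ?expR_ge0 // ler_expR (le_trans vc) // ler_piMl //.
have h1 := le_trans (n2_exp_rem v) (ler_wpM2l (n2_ge0 tau v) small).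
have h2 : n2 v <= n2 (op_exp v - 1) + n2 (op_exp v - 1 - v).
  have := n2D htau (op_exp v - 1) (- (op_exp v - 1 - v)).
  by rewrite n2N // opprB addrCA subrr addr0.
have h3 : n2 v <= 2 * n2 (op_exp x - 1).
  have := it k; rewrite -/v => itk; move: h1 h2 itk.
  by move: (n2 v) (n2 _) (n2 _) (n2 _) => *; lra.
have nv2 : n2 v = 2^-1 ^+ k * n2 x by rewrite /v n2Z // ger0_norm.
have e : n2 x = 2 ^+ k * n2 v by rewrite nv2 mulrA pow2K mul1r.
by rewrite e -mulrA ler_wpM2l // exprn_ge0.
Qed.

(** If e^l = e^(-x/2) e^y e^(-x/2) then
    e^l - 1 = e^(-x/2) (e^y - e^x) e^(-x/2).  The exponential is L2-Lipschitz
    on norm balls, and [n2_le_exp_sub1] bounds l by e^l - 1. *)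
Lemma dst_le_n2 (c : R) : 0 <= c -> exists2 C : R, 0 <= C & forall x y, sa x -> sa y ->
  nrm x <= c -> nrm y <= c -> dst x y <= C * n2 (x - y).
Proof.
move=> c0; have [|C C0 hC] := @n2_le_exp_sub1 (c + c); first by rewrite addr_ge0.
exists (C * (expR c * (expR (2 * (c + 1)) * expR c))).
  by rewrite !mulr_ge0 ?expR_ge0.
move=> x y hx hy xc yc; have [l [hl el]] := ln_conj hx hy.
rewrite (dst_ln tau hx hy hl el) -mulrA.
have hx2 : half *: - x = - (half *: x) by rewrite scalerN.
have lc : nrm l <= c + c.
  have := @exp_conj_nrm _ _ y (- x) l hy (saN hx) hl.
  by rewrite !hx2 nrmN => /(_ el) /le_trans; apply; rewrite lerD.
rewrite (le_trans (hC l hl lc)) // ler_wpM2l //.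
have e1 : op_exp l - 1 = op_exp (- (half *: x)) * (op_exp y - op_exp x) * op_exp (- (half *: x)).
  rewrite mulrBr mulrBl -el (exp_half x); congr (_ - _).
  by rewrite mulrA op_expNl mul1r op_expNr.
have ne : nrm (op_exp (- (half *: x))) <= expR c.
  rewrite (le_trans (nrm_exp _)) // ler_expR nrmN nrmZ ger0_norm ?invr_ge0 //.
  by apply: le_trans xc; rewrite ler_piMl ?nrm_ge0 // invf_le1 ?ler1n.
rewrite e1 (le_trans (n2Mr htau _ _)) //.
rewrite [leRHS](_ : _ = expR c * (expR (2 * (c + 1)) * n2 (x - y)) * expR c); last by ring.
apply: ler_pM; rewrite ?n2_ge0 ?nrm_ge0 //.
rewrite (le_trans (n2Ml htau _ _)) //; apply: ler_pM; rewrite ?n2_ge0 ?nrm_ge0 //.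
by rewrite (n2_distC htau x y) n2_exp_lipschitz // ?lerDr // (le_trans _ (_ : c <= c + 1)) // lerDl.
Qed.
End L2Lipschitz.

(** * Nearest points *)

Section RealBounds.
Variable R : realType.
Implicit Types I q a d m : R.

Lemma midpoint_bound I q a d (f1 f2 : R) m : 0 <= q -> I <= m ->
  f1 <= I + q / 4 -> f2 <= I + 16^-1 * q / 4 -> a <= d ->
  2 * m + 2^-1 * d <= f1 + f2 -> a <= q.
Proof. lra. Qed.

Lemma limit_bound I q a d m (C M : R) : m ^+ 2 <= (C * a + d) ^+ 2 ->
  d ^+ 2 <= I + q / 4 -> C * a * d <= C * a * M ->
  m ^+ 2 - I <= C ^+ 2 * a ^+ 2 + 2 * C * M * a + 4^-1 * q.
Proof. rewrite sqrrD exprMn -mulr_natr => *; lra. Qed.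
End RealBounds.

Section Minimisation.
Variables (R : realType) (A : vonNeumannAlgebra R) (tau : {scalar A}).
Hypothesis htau : normal_faithful_tracial_state tau.
Local Open Scope complex_scope.
Local Notation tr := (trace_re tau).
Local Notation n2 := (l2_norm tau).
Local Notation ip := (l2_dot tau).
Local Notation dst := (exp_dist tau).
Local Notation half := ((2^-1 : R)%:C).
Variables (H S : set A).
Hypotheses (hH : closed_real_subspace H) (hS : closed_orthogonal_supplement tau H S).
Hypothesis hconv : geodesically_convex (exp_set H).
Implicit Types (x y z h k l v w m : A).

Lemma geodesicE x y l (t : R) : sa x -> sa l ->
  op_exp l = op_exp (- (half *: x)) * op_exp y * op_exp (- (half *: x)) ->
  geodesic (op_exp x) (op_exp y) t =
  op_exp (half *: x) * op_exp (t%:C *: l) * op_exp (half *: x).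
Proof.
move=> hx hl e; rewrite /geodesic !op_pow_exp // scaleNC -e.
by rewrite op_pow_exp.
Qed.

Lemma exp_H_geodesic h k l (t : R) : H h -> H k -> sa l ->
  op_exp l = op_exp (- (half *: h)) * op_exp k * op_exp (- (half *: h)) ->
  exists2 m, H m & op_exp m = op_exp (half *: h) * op_exp (t%:C *: l) * op_exp (half *: h).
Proof.
move=> hh hk hl e; have [_ conv] := hconv.
have [||m hm em] := conv (op_exp h) (op_exp k) t; first by exists h.
  by exists k.
by exists m => //; rewrite em (geodesicE t _ hl e) //; exact: H_sa hH _ hh.
Qed.

(** The geodesic from p to q takes the value p q^-1 p at time -1; here
    p = e^(h/2) and q = e^-k. *)
Lemma exp_H_congr h k : H h -> H k ->
  exists2 l, H l & op_exp l = op_exp (half *: h) * op_exp k * op_exp (half *: h).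
Proof.
move=> hh hk; have hsa := H_sa hH hh; have ksa := H_sa hH hk.
have h2 : H (half *: h) by exact: H_Z.
have [l [hl el]] := ln_conj (saZ (2^-1) hsa) (saN ksa).
have [m hm em] := exp_H_geodesic (-1) h2 (H_N hH hk) hl el.
exists m => //; rewrite em scaleNC scale1C -exp_inv el.
rewrite !invrM ?unitrMl ?exp_unit // !exp_inv !opprK mulrA.
set p := op_exp (half *: (half *: h)).
have -> : op_exp (half *: h) = p * p by rewrite (exp_half (half *: h)).
by rewrite !mulrA.
Qed.

(** Convexity provides the midpoint.  It stays in the ball because taking the
    geometric mean with e^h is monotone, by monotonicity of the square root,
    and the mean of e^h <= e^K with e^K is at most e^K. *)
Lemma exp_H_midpoint h k r (K : R) : H h -> H k -> sa r -> nrm h <= K -> nrm k <= K ->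
  exists m, [/\ H m, nrm m <= K &
    2 * dst m r ^+ 2 + 2^-1 * dst h k ^+ 2 <= dst h r ^+ 2 + dst k r ^+ 2].
Proof.
move=> hh hk hr hK kK; have hsa := H_sa hH hh; have ksa := H_sa hH hk.
have K0 : 0 <= K := le_trans (nrm_ge0 _) hK.
have [l2 [hl2 el2]] := ln_conj hsa ksa.
have [m hm em] := exp_H_geodesic 2^-1 hh hk hl2 el2.
have msa := H_sa hH hm.
have hl : sa (half *: l2) by exact: saZ.
have hp : sa (op_exp (half *: h)) by apply/sa_exp/saZ.
have hmi : sa (op_exp (- (half *: h))) by apply/sa_exp/saN/saZ.
have pp : op_exp (half *: h) * op_exp (- (half *: h)) = 1 := op_expNr _.
exists m; split=> //.
  have up : ople (op_exp m) (op_exp (K%:C *: 1)).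
    have kl : ople (op_exp l2) (op_exp (K%:C *: 1 - h)).
      rewrite el2 exp_addscalar (exp_half (- h)) scalerN.
      have := ople_conjs hmi (exp_le_scalar ksa (ople_trans (ople_nrm k) (ople_scalar kK))).
      by rewrite -scalerAr mulr1 -scalerAl.
    have := exp_sqrt_mono hl2 (saB (saZ K (sa1 A)) hsa) kl => /(ople_conjs hp).
    rewrite -em => h1; apply: (ople_trans h1).
    rewrite scalerBr scalerC exp_addscalar -scalerAr -scalerAl pp mul1r.
    rewrite exp_scalar.
    have := exp_le_scalar (saZ (2^-1) hsa) (c := 2^-1 * K) => h2.
    apply: (ople_trans (ople_scale (expR_ge0 (2^-1 * K)) (h2 _))).
      move=> xi; have := ople_trans (ople_nrm h) (ople_scalar hK) xi.
      by rewrite !qfZ qf1 -mulrA ler_pM2l ?invr_gt0.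
    rewrite scalerC -expRD; apply: ople_scalar; rewrite ler_expR; lra.
  have lo : ople (op_exp ((- K : R)%:C *: 1)) (op_exp m).
    have kl : ople (op_exp ((- K : R)%:C *: 1 - h)) (op_exp l2).
      rewrite el2 exp_addscalar (exp_half (- h)) scalerN.
      have kk : ople ((- K : R)%:C *: 1) k.
        by apply: ople_trans (@ople_nrmN _ _ k); apply: ople_scalar; rewrite lerN2.
      have := ople_conjs hmi (exp_ge_scalar ksa kk).
      by rewrite -scalerAr mulr1 -scalerAl.
    have := exp_sqrt_mono (saB (saZ (- K) (sa1 A)) hsa) hl2 kl => /(ople_conjs hp).
    rewrite -em => h1; apply: ople_trans h1.
    rewrite scalerBr scalerC exp_addscalar -scalerAr -scalerAl pp mul1r.
    rewrite exp_scalar.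
    have := exp_ge_scalar (saZ (2^-1) hsa) (c := 2^-1 * - K) => h2.
    apply: (@ople_trans _ _ _ ((expR (2^-1 * - K) : R)%:C *: ((expR (2^-1 * - K) : R)%:C *: 1))).
      rewrite scalerC -expRD; apply: ople_scalar; rewrite ler_expR; lra.
    apply: (ople_scale (expR_ge0 _) (h2 _)) => xi.
    have hh' : ople ((- K : R)%:C *: 1) h.
      by apply: ople_trans (@ople_nrmN _ _ h); apply: ople_scalar; rewrite lerN2.
    have := hh' xi.
    by rewrite !qfZ qf1 -mulrA ler_pM2l ?invr_gt0.
  apply: nrm_ople => //.
    by apply: exp_mono_inv => //; exact/saZ/sa1.
  by apply: exp_mono_inv => //; exact/saZ/sa1.
have q2 : op_exp (half *: l2) = op_exp (half *: (half *: l2)) * op_exp (half *: (half *: l2)).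
  exact: exp_half.
(* e^m = a (star a), and the end points are a e^(-l2/2) (star a) and a e^(l2/2) (star a) *)
set a := op_exp (half *: h) * op_exp (half *: (half *: l2)).
have ua : a \is a GRing.unit by rewrite unitrMl exp_unit.
have sta : star a = op_exp (half *: (half *: l2)) * op_exp (half *: h).
  rewrite starM hp sa_exp //; exact: saZ.
have qq : op_exp (half *: (half *: l2)) * op_exp (- (half *: l2)) * op_exp (half *: (half *: l2)) = 1.
  have -> : - (half *: l2) = (- 2^-1 : R)%:C *: l2 by rewrite scaleNC.
  by rewrite !scalerC -!op_expZD (_ : _ + _ = 0) ?scale0r ?op_exp0 //; lra.
apply: (semiparallelogram htau hl hsa ksa msa hr ua).
- by rewrite em sta q2 /a !mulrA.
- rewrite sta /a.
  move: qq; move: (op_exp (half *: (half *: l2))) (op_exp (- (half *: l2))) => q o qq.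
  by rewrite !mulrA -(mulrA _ q o) -(mulrA _ (q * o) q) qq mulr1 -exp_half.
- rewrite sta /a; have e4 : op_exp (half *: (half *: l2)) * op_exp (half *: l2) *
     op_exp (half *: (half *: l2)) = op_exp l2.
    rewrite !scalerC -!op_expZD (_ : _ + _ = 1) ?scale1C //; lra.
  move: e4; move: (op_exp (half *: (half *: l2))) (op_exp (half *: l2)) => q o e4.
  rewrite !mulrA -(mulrA _ q o) -(mulrA _ (q * o) q) e4 el2.
  by rewrite !mulrA pp mul1r -mulrA op_expNl mulr1.
Qed.

(** H is the L2-orthogonal of S. *)
Lemma H_l2_closed (u : nat -> A) l : (forall n, H (u n)) -> sa l ->
  null_seq (fun n => n2 (u n - l) ^+ 2) -> H l.
Proof.
move=> hu hl h; apply: (H_ortho htau hS) => // s hs.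
have ssa := S_sa hS hs.
have e : tr (s * l) ^+ 2 <= 0.
  apply: (null_seq_bound (null_seqZ (sqr_ge0 (n2 s)) h)) => n.
  have -> : tr (s * l) = ip s (l - u n).
    rewrite ip_sa // mulrBr trB (trC htau s (u n)) (HS_ortho hS (hu n) hs) subr0 //.
  rewrite n2_distC // -exprMn -[leLHS]real_normK ?num_real //.
  rewrite lerXn2r ?nnegrE ?mulr_ge0 ?n2_ge0 // ler_norml ip_CS // andbT.
  by rewrite lerNl -ipNl (le_trans (ip_CS htau _ _)) // n2N.
have : tr (s * l) ^+ 2 == 0 by rewrite eq_le e sqr_ge0.
by rewrite sqrf_eq0 => /eqP.
Qed.

(** In a minimising sequence with errors 16^-n / 4, the midpoint of two
    consecutive terms is not better than the infimum, and the
    semiparallelogram law bounds their L2 distance by 4^-n; the sequence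
    converges to a point of the ball, and the distance to r is L2-continuous
    there. *)
Lemma nearest_point r (K : R) : sa r -> 0 <= K -> exists h, [/\ H h, nrm h <= K &
  forall k, H k -> nrm k <= K -> dst h r ^+ 2 <= dst k r ^+ 2].
Proof.
move=> hr K0; pose V : set R := [set dst h r ^+ 2 | h in [set h | H h /\ nrm h <= K]].
have V0 : V !=set0.
  by exists (dst 0 r ^+ 2), 0 => //; split; [exact: H_0 hH|rewrite nrm0].
have Vlb : has_lbound V by exists 0 => _ [h _ <-]; exact: sqr_ge0.
set I := inf V.
have Ile h : H h -> nrm h <= K -> I <= dst h r ^+ 2.
  by move=> hh hK; apply: ge_inf => //; exists h.
have q0 (n : nat) : 0 < (16^-1 : R) ^+ n / 4 by rewrite divr_gt0 ?exprn_gt0 ?invr_gt0.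
have ex (n : nat) : exists h, [/\ H h, nrm h <= K & dst h r ^+ 2 <= I + 16^-1 ^+ n / 4].
  have [_ [h [hh hK] <-] lt] := inf_adherent (q0 n) (conj V0 Vlb).
  by exists h; split=> //; exact: ltW.
have [u hu] := choice ex.
have uH n : H (u n) by have [] := hu n.
have uK n : nrm (u n) <= K by have [] := hu n.
have uI n : dst (u n) r ^+ 2 <= I + 16^-1 ^+ n / 4 by have [] := hu n.
have usa n : sa (u n) := H_sa hH (uH n).
have [|l [lsa lK lu]] := l2_complete htau usa uK.
  move=> n; apply: sqr_le_le; first by rewrite exprn_ge0 ?invr_ge0.
  have [m [hm mK par]] := exp_H_midpoint (uH n) (uH n.+1) hr (uK n) (uK n.+1).
  have h1 : n2 (u n.+1 - u n) ^+ 2 <= dst (u n) (u n.+1) ^+ 2.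
    by rewrite lerXn2r ?nnegrE ?n2_ge0 ?dst_ge0 // dst_ge_n2.
  (* the tolerance 16^-n is the square of the rate required for L2 convergence *)
  have e16 : (4^-1 ^+ n) ^+ 2 = 16^-1 ^+ n :> R.
    by rewrite -exprM mulnC exprM; congr (_ ^+ _); rewrite expr2 -invfM -natrM.
  rewrite e16; have uIS := uI n.+1; rewrite (exprS 16^-1) in uIS.
  apply: midpoint_bound (Ile m hm mK) (uI n) uIS h1 par.
  by rewrite exprn_ge0 ?invr_ge0.
have lH : H l := H_l2_closed uH lsa lu.
exists l; split; [exact: lH|exact: lK|move=> k hk kK].
apply: le_trans (Ile k hk kK).
have [C C0 hC] := dst_le_n2 htau K0.
pose M := Num.sqrt (I + 1).
have I0 : 0 <= I by apply: lb_le_inf => // _ [h _ <-]; exact: sqr_ge0.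
have M2 : M ^+ 2 = I + 1 by rewrite sqr_sqrtr // addr_ge0.
have uM n : dst (u n) r <= M.
  apply: sqr_le_le; first exact: sqrtr_ge0.
  apply: le_trans (uI n) _; rewrite M2 lerD2l ler_pdivrMr // mul1r.
  apply: (@le_trans _ _ 1); last by rewrite ler1n.
  by rewrite exprn_ile1 ?invr_ge0 // invf_le1 // ler1n.
have g0 : null_seq (fun n => 4^-1 * (16^-1 : R) ^+ n).
  by apply: null_seq_geo; rewrite ?invr_ge0 // ?ler0n /= ?invf_lt1 ?ltr1n.
have dl n : dst l (u n) <= C * n2 (u n - l).
  by rewrite n2_distC // hC.
have dn : null_seq (fun n => n2 (u n - l)).
  move=> e e0; have [N hN] := lu _ (exprn_gt0 2 e0); exists N => n Nn.
  by apply: sqr_le_le; [exact: ltW|exact: hN].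
have M0 : 0 <= M := sqrtr_ge0 _.
rewrite -subr_le0.
apply: (null_seq_bound (null_seqD (null_seqD (null_seqZ (sqr_ge0 C) lu)
   (null_seqZ (mulr_ge0 (mulr_ge0 (ler0n R 2) C0) M0) dn)) g0)) => n.
have h1 := dst_triangle htau l (u n) r.
have h2 : dst l r ^+ 2 <= (C * n2 (u n - l) + dst (u n) r) ^+ 2.
  rewrite lerXn2r ?nnegrE ?dst_ge0 ?addr_ge0 ?mulr_ge0 ?n2_ge0 ?dst_ge0 //.
  by rewrite (le_trans h1) // lerD2r.
have h3 : C * n2 (u n - l) * dst (u n) r <= C * n2 (u n - l) * M.
  by rewrite ler_wpM2l // mulr_ge0 ?n2_ge0.
exact: limit_bound h2 (uI n) h3.
Qed.
End Minimisation.

(** * Orthogonality at the nearest point *)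

Section Critical.
Variables (R : realType) (A : vonNeumannAlgebra R) (tau : {scalar A}).
Hypothesis htau : normal_faithful_tracial_state tau.
Local Open Scope complex_scope.
Local Notation tr := (trace_re tau).
Local Notation n2 := (l2_norm tau).
Local Notation dst := (exp_dist tau).
Local Notation half := ((2^-1 : R)%:C).
Variables (H S : set A).
Hypotheses (hH : closed_real_subspace H) (hS : closed_orthogonal_supplement tau H S).
Hypothesis hconv : geodesically_convex (exp_set H).
Implicit Types (x y z h k l v w m s r : A).
Local Notation hproj := (ortho_proj H S).

(** Monotonicity of the logarithm gives - h - nrm r <= s <= - h + nrm r: a bound
    on s + h that does not depend on h. *)
Lemma ln_conj_bound h r s : sa h -> sa r -> sa s ->
  op_exp s = op_exp (- (half *: h)) * op_exp r * op_exp (- (half *: h)) ->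
  nrm (s + h) <= nrm r.
Proof.
move=> hh hr hs e.
have := @exp_conj_bounds _ _ r (- h) s hr (saN hh) hs.
rewrite !scalerN => /(_ e) [up lo].
apply: nrm_ople; [exact: saD|exact: nrm_ge0| |].
  by move=> xi; have := lo xi; rewrite !qfD qfN; lra.
by move=> xi; have := up xi; rewrite !qfD qfN; lra.
Qed.

(** The curve e^((1-e)h/2) e^(e b) e^((1-e)h/2), seen from its starting point
    e^h, that is, conjugated by e^(-h/2). *)
Definition competitor h b (e : R) : A :=
  op_exp ((e * - 2^-1 : R)%:C *: h) * op_exp ((e * 1 : R)%:C *: b) *
  op_exp ((e * - 2^-1 : R)%:C *: h).

Lemma jet_competitor h b : jet (competitor h b) (b - h).
Proof.
have := jetM (jetM (jet_exp (- 2^-1) h) (jet_exp 1 b)) (jet_exp (- 2^-1) h).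
rewrite (_ : _ + _ + _ = b - h) //.
by apply: mel_inj => xi eta; rewrite !melE; field.
Qed.

Lemma competitor_sa h b e : sa h -> sa b -> sa (competitor h b e).
Proof. by move=> hh hb; apply: sa_conjs; apply/sa_exp/saZ. Qed.

(** Membership in M is [exp_H_congr], and the logarithm of the product has norm
    at most (1 - e) nrm h + e nrm b. *)
Lemma competitor_point h b (K e : R) : H h -> H b -> nrm h <= K -> nrm b <= K ->
  0 <= e <= 1 -> exists k, [/\ H k, nrm k <= K &
    op_exp k = op_exp (half *: h) * competitor h b e * op_exp (half *: h)].
Proof.
move=> hh hb hK bK /andP[e0 e1].
have [k hk ek] := exp_H_congr hH hconv (H_Z hH (1 - e) hh) (H_Z hH e hb).
have e1' : 0 <= 1 - e by rewrite subr_ge0.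
exists k; split=> //.
  have hsa := H_sa hH hh; have bsa := H_sa hH hb; have ksa := H_sa hH hk.
  apply: (le_trans (exp_conj_nrm (saZ e bsa) (saZ (1 - e) hsa) ksa ek)).
  rewrite !nrmZ !ger0_norm //.
  have := ler_wpM2l e0 bK; have := ler_wpM2l e1' hK; lra.
have e2 : 2^-1 + e * - 2^-1 = 2^-1 * (1 - e) by ring.
have PN : op_exp (half *: h) * op_exp ((e * - 2^-1 : R)%:C *: h) =
    op_exp (half *: ((1 - e : R)%:C *: h)) by rewrite scalerC -e2 op_expZD.
have NP : op_exp ((e * - 2^-1 : R)%:C *: h) * op_exp (half *: h) =
    op_exp (half *: ((1 - e : R)%:C *: h)) by rewrite scalerC -e2 addrC op_expZD.
rewrite ek /competitor mulr1; move: PN NP.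
move: (op_exp (half *: h)) (op_exp ((e * - 2^-1 : R)%:C *: h)) => p n <- {2}<-.
by rewrite !mulrA.
Qed.

Lemma first_order (a C d : R) : 0 < d ->
  (forall e, 0 < e <= d -> 0 <= - (2 * e * a) + C * e ^+ 2) -> a <= 0.
Proof.
move=> d0 h; apply/ler_addgt0Pr => t t0; rewrite add0r.
have C1 : 0 < `|C| + 1 by rewrite ltr_wpDl.
pose e := Num.min d (t / (`|C| + 1)).
have e0 : 0 < e by rewrite lt_min d0 divr_gt0.
have ed : e <= d by rewrite ge_min lexx.
have et : e * (`|C| + 1) <= t by rewrite -ler_pdivlMr // ge_min lexx orbT.
have := h e; rewrite e0 ed => /(_ isT).
rewrite (_ : _ + _ = e * (C * e - 2 * a)); last by ring.
rewrite pmulr_rge0 // => h1.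
have h2 : C * e <= `|C| * e by rewrite ler_wpM2r ?ler_norm // ltW.
have h3 : 0 <= `|C| * e by rewrite mulr_ge0 // ltW.
lra.
Qed.

(** At the nearest point h of the ball of radius nrm P * nrm r, with s the
    logarithm of e^(-h/2) e^r e^(-h/2), the competitors for b = P (s + h) are
    admissible by the bound on s + h.  The squared distance to e^r changes by
    -2 e tr (s (P s)) + O(e^2), so tr (s (P s)) = ||P s||^2 vanishes and s lies
    in S. *)
Lemma critical_point r : sa r -> exists h s, [/\ H h, S s &
  op_exp r = op_exp (half *: h) * op_exp s * op_exp (half *: h)].
Proof.
move=> hr; have [C C0 hC] := proj_bounded htau hH hS.
have K0 : 0 <= C * nrm r by rewrite mulr_ge0 ?nrm_ge0.
have [h [hh hK hmin]] := nearest_point htau hH hS hconv hr K0.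
have hsa := H_sa hH hh.
have [s [hs es]] := ln_conj hsa hr.
have pm : op_exp (half *: h) * op_exp (- (half *: h)) = 1 := op_expNr _.
have mp : op_exp (- (half *: h)) * op_exp (half *: h) = 1 := op_expNl _.
have er : op_exp r = op_exp (half *: h) * op_exp s * op_exp (half *: h).
  by rewrite es !mulrA pm mul1r -mulrA mp mulr1.
exists h, s; split => //.
have shsa : sa (s + h) by exact: saD.
have [bH _] := projP hS shsa.
have bK : nrm (hproj (s + h)) <= C * nrm r.
  by rewrite (le_trans (hC _ shsa)) // ler_wpM2l // (ln_conj_bound hsa hr hs es).
(* the competitors start in the direction P (s + h) - h = P s *)
have bE : hproj (s + h) = hproj s + h by rewrite (projD hH hS hs hsa) (proj_H hH hS hh).
have bsa := H_sa hH bH.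
have wE : hproj (s + h) - h = hproj s by rewrite bE addrK.
have hp : star (op_exp (half *: h)) = op_exp (half *: h) by apply/sa_exp/saZ.
have up : op_exp (half *: h) \is a GRing.unit := exp_unit _.
have eh : op_exp h = op_exp (half *: h) * op_exp 0 * star (op_exp (half *: h)).
  by rewrite op_exp0 mulr1 hp -exp_half.
have er' : op_exp r = op_exp (half *: h) * op_exp s * star (op_exp (half *: h)).
  by rewrite hp.
have dh : dst h r = n2 s.
  by rewrite (dst_congr htau (sa0 A) hs hsa hr up eh er') dst0.
have [D [d [D0 /andP[d0 d1] var]]] := jet_variation htau (jet_competitor h (hproj (s + h)))
  (fun e => competitor_sa e hsa bsa) (nrm_ge0 (- s)).
have key e : 0 < e <= d -> 0 <= - (2 * e * tr (s * hproj s)) + D * e ^+ 2.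
  move=> /andP[e0 ed].
  have e01 : 0 <= e <= 1 by rewrite ltW //= (le_trans ed).
  have [k [kH kK ek]] := competitor_point hh bH hK bK e01.
  have ksa := H_sa hH kH.
  have [l [hl el]] : exists l, sa l /\ op_exp l = competitor h (hproj (s + h)) e.
    have [l [hl el]] := ln_conj (saZ e hsa) (saZ e bsa); exists l; split=> //.
    by rewrite el /competitor mulr1 mulrN !scalerC -scaleNC (mulrC e).
  have ek' : op_exp k = op_exp (half *: h) * op_exp l * star (op_exp (half *: h)).
    by rewrite hp el.
  have dk : dst k r = dst s l.
    by rewrite (dst_congr htau hl hs ksa hr up ek' er') dstC.
  have [c [hc ec]] := ln_conj hs hl.
  have dc : dst k r = n2 c by rewrite dk (dst_ln tau hs hl hc ec).
  have ec' : op_exp c = op_exp (half *: - s) * competitor h (hproj (s + h)) e *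
      op_exp (half *: - s) by rewrite scalerN -el.
  have e0d : 0 <= e <= d by rewrite (ltW e0).
  have := var (- s) c e e0d (saN hs) (lexx _) hc ec'.
  have := hmin k kH kK.
  rewrite dh dc (n2N htau s) wE mulNr trN => min_k var_k; clear -min_k var_k; lra.
have tr0 := first_order d0 key.
have ps0 : hproj s = 0.
  apply: (ip_eq0 htau); apply/le_anti; rewrite ip_ge0 // andbT.
  by rewrite -(ip_proj htau hH hS hs) ip_sa.
by have [_] := projP hS hs; rewrite ps0 subr0.
Qed.

End Critical.

Theorem theorem5p4 (R : realType) (A : vonNeumannAlgebra R) (tau : {scalar A})
  (htau : normal_faithful_tracial_state tau)
  (H : set A) (hH : closed_real_subspace H)
  (hconv : geodesically_convex (exp_set H))
  (S : set A) (hS : closed_orthogonal_supplement tau H S)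
  (r : A) (hr : Sigma r) :
  orthogonal_geodesic_through tau H r.
Proof.
have [rho hrho <-] := hr.
have [h [s [hh hs e]]] := critical_point htau hH hS hconv hrho.
have hsa := H_sa hH hh; have ssa := S_sa hS hs.
have pH : op_pow (op_exp h) 2^-1 = op_exp (real_complex R 2^-1 *: h) by exact: op_pow_exp.
have pN : op_pow (op_exp h) (- 2^-1) = op_exp (- (real_complex R 2^-1 *: h)).
  by rewrite op_pow_exp // scaleNC.
have psa : sa (op_exp (real_complex R 2^-1 *: h)) by apply/sa_exp/saZ.
have pm : op_exp (real_complex R 2^-1 *: h) * op_exp (- (real_complex R 2^-1 *: h)) = 1 := op_expNr _.
have mp : op_exp (- (real_complex R 2^-1 *: h)) * op_exp (real_complex R 2^-1 *: h) = 1 := op_expNl _.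
have iE : (op_exp h)^-1 = op_exp (- (real_complex R 2^-1 *: h)) * op_exp (- (real_complex R 2^-1 *: h)).
  by rewrite exp_inv (exp_half (- h)) scalerN.
exists (op_exp h), (op_exp (real_complex R 2^-1 *: h) * s * op_exp (real_complex R 2^-1 *: h)).
split.
- by exists h.
- exact: sa_conjs.
- move=> _ [k kH <-]; rewrite /metric pH iE.
  have ortho : tau (s * k) = 0.
    by have [_ _ o] := hS; rewrite (tau_tracial htau) o.
  move: pm mp; move: (op_exp (real_complex R 2^-1 *: h)) (op_exp (- (real_complex R 2^-1 *: h))).
  move=> p q pq qp.
  have -> : p * s * p * (q * q) * (p * k * p) * (q * q) = p * (s * k * q).
    by rewrite !mulrA -(mulrA _ p q) pq mulr1 -(mulrA _ q p) qp mulr1 -(mulrA _ p q) pq mulr1.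
  by rewrite (tau_tracial htau) -mulrA qp mulr1.
- rewrite /Exp pH pN.
  move: e pm mp; move: (op_exp (real_complex R 2^-1 *: h)) (op_exp (- (real_complex R 2^-1 *: h))).
  move=> p q e pq qp.
  by rewrite !mulrA qp mul1r -(mulrA s) pq mulr1 e.
Qed.
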